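(* Let $N\in\mathbb{N}$, $\lambda_1,\dots,\lambda_N\in\mathbb{C}$. Suppose the $\lambda_j$ are indexed as follows: there are integers $r\ge1$, $n_1,\dots,n_r\ge1$ with $\sum_{s=1}^r n_s=N$ such that, writing $N_s=n_1+\cdots+n_{s-1}$ ($N_1=0$) and $B_s=\{\lambda_{N_s+1}/N,\dots,\lambda_{N_s+n_s}/N\}$, (i) $(\lambda_j-\lambda_{j'})/N\in\mathbb{Z}$ whenever $\lambda_j/N,\lambda_{j'}/N$ lie in the same block and $(\lambda_j-\lambda_{j'})/N\notin\mathbb{Z}$ whenever they lie in different blocks (the blocks are the congruence classes of $\{\lambda_1/N,\dots,\lambda_N/N\}$ modulo $\mathbb{Z}$); (ii) within each block, $\Re(\lambda_{N_s+1})\ge\cdots\ge\Re(\lambda_{N_s+n_s})$. For $1\le s\le r$, $1\le k\le n_s$ define $$\eta_{N_s+k}(\zeta)=G^{k,0}_{0,N}\left(\begin{array}{c}\\ \frac{\lambda_{N_s+1}}{N},\dots,\frac{\lambda_{N_s+k}}{N};\ \big(\tfrac{\lambda_j}{N}\big)_{j\notin\{N_s+1,\dots,N_s+k\}}\end{array}\Bigg|\ (-1)^k\zeta\right),$$ where the second group of lower parameters consists of all $\lambda_j/N$ with $j\in\{1,\dots,N\}\setminus\{N_s+1,\dots,N_s+k\}$. Then $\eta_1,\dots,\eta_N$ form a fundamental system of solutions of $$\Bigg[\prod_{j=1}^N\bigg(\zeta\frac{d}{d\zeta}-\frac{\lambda_j}{N}\bigg)-\zeta\Bigg]\eta(\zeta)=0,\quad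 \zeta\in\mathbb{C}\setminus\{0\},$$ and for $k=1$, $$\eta_{N_s+1}(\zeta)=\frac{(-\zeta)^{\lambda_{N_s+1}/N}}{\prod_{j'=1}^N\Gamma\big(1+\frac{\lambda_{N_s+1}-\lambda_{j'}}{N}\big)}\,{}_0F_{N-1}\left(\begin{array}{c}\\ \big(1+\frac{\lambda_{N_s+1}-\lambda_j}{N}\big)_{1\le j\le N,\ j\neq N_s+1}\end{array}\Bigg|\ \zeta\right).$$ Moreover, for every $\mu\in\mathbb{C}\setminus\{0\}$, the functions $y_j(\mu,z)=\eta_j\big(\mu(z/N)^N\big)$, $1\le j\le N$, form a fundamental system of solutions of the generalized Euler eigenvalue problem $$z^{-N}\prod_{j=1}^N\bigg[z\frac{d}{dz}-\lambda_j\bigg]y(\mu,z)=\mu\,y(\mu,z),\quad z\in\mathbb{C}\setminus\{0\}.$$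
   Context: Meijer's $G$-function: for $1 \leq m \leq q$ and $c_1,\dots,c_q \in \mathbb{C}$, $$G^{m,0}_{0,q}\left(\begin{array}{c} \\ c_1,\dots,c_m; c_{m+1},\dots,c_q\end{array}\Bigg|\ x\right) = \frac{1}{2\pi i}\int_{\mathcal{C}} d\omega\, \frac{\prod_{j=1}^m \Gamma(c_j-\omega)}{\prod_{j=m+1}^q \Gamma(1-c_j+\omega)}\, x^{\omega},$$ where $\mathcal{C}$ is a contour beginning and ending at $+\infty$ encircling all poles of $\Gamma(c_j-\cdot)$, $1\le j\le m$, once in the negative direction; the integral is defined as minus the sum of the residues of the integrand at these poles. Here $x^\omega=e^{\omega\log x}$ for a fixed branch of the logarithm, and $(-\zeta)^b=e^{b\log(-\zeta)}$ with the same branch. The value does not depend on the order of parameters within each group. ${}_0F_{N-1}\left(\begin{array}{c}\\ \beta_1,\dots,\beta_{N-1}\end{array}\big|\ \zeta\right)=\sum_{k\ge0}\frac{\zeta^k}{k!\prod_{m=1}^{N-1}(\beta_m)_k}$ with $(\gamma)_0=1$, $(\gamma)_k=\gamma(\gamma+1)\cdots(\gamma+k-1)$. A fundamental system of solutions means $N$ linearly independent solutions (on a simply connected subdomain of $\mathbb{C}\setminus\{0\}$ where branches are fixed). *)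

(* Defs.v *)
From Stdlib Require Import Reals ClassicalEpsilon List Arith.
From Coquelicot Require Import Coquelicot.
Open Scope C_scope.

Definition Cexp (z : C) : C :=
  (exp (Re z) * cos (Im z), exp (Re z) * sin (Im z))%R.

(* limit of a complex sequence (epsilon-chosen; meaningful when it exists) *)
Definition Clim_seq (u : nat -> C) : C :=
  epsilon (inhabits (RtoC 0)) (fun l => filterlim u eventually (locally l)).

Definition Clim_right0 (F : R -> C) : C :=
  epsilon (inhabits (RtoC 0)) (fun l => filterlim F (at_right 0) (locally l)).

Definition Cseries (a : nat -> C) : C :=
  epsilon (inhabits (RtoC 0)) (fun l => is_series a l).

Fixpoint Cprod_nat (f : nat -> C) (n : nat) : C :=
  match n with
  | O => 1
  | S m => Cprod_nat f m * f m
  end.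

Fixpoint Csum_nat (f : nat -> C) (n : nat) : C :=
  match n with
  | O => 0
  | S m => Csum_nat f m + f m
  end.

Definition Cprod_list (f : C -> C) (l : list C) : C :=
  fold_right (fun c acc => f c * acc) 1 l.

(* reciprocal Gamma function 1/Gamma (entire), via Gauss' limit formula
   1/Gamma(z) = lim_n z(z+1)...(z+n) / (n! n^z)  (taken along n+1 >= 1) *)
Definition rGamma (z : C) : C :=
  Clim_seq (fun n =>
    Cprod_nat (fun i => z + INR i) (S (S n)) /
    (INR (fact (S n)) * Cexp (z * ln (INR (S n))))).

(* Gamma(z) = 1 / (1/Gamma(z))  (junk at the poles z in -N) *)
Definition Gamma (z : C) : C := / rGamma z.

Definition poch (b : C) (k : nat) : C := Cprod_nat (fun i => b + INR i) k.

Definition hyp0F (betas : list C) (z : C) : C :=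
  Cseries (fun k => z ^ k / (INR (fact k) * Cprod_list (fun b => poch b k) betas)).

Definition Cpowb (L : C -> C) (x w : C) : C := Cexp (w * L x).

Definition log_branch_on (L : C -> C) (U : C -> Prop) : Prop :=
  forall w, U w -> Cexp (L w) = w /\ continuous L w.

(* (1/(2 pi i)) \oint_{|w-a|=r} f(w) dw
   = (1/(2 pi)) \int_0^{2pi} f(a + r e^{it}) r e^{it} dt *)
Definition circle_integral (f : C -> C) (a : C) (r : R) : C :=
  / (2 * PI) * RInt (V := C_R_CompleteNormedModule)
    (fun t => f (a + r * Cexp (Ci * t)) * (r * Cexp (Ci * t))) 0 (2 * PI).

Definition residue (f : C -> C) (a : C) : C :=
  Clim_right0 (fun r => circle_integral f a r).

(** * Meijer G^{m,0}_{0,q} with lower parameters a (first group, m = length a)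
      and b (second group), for the branch L *)

Definition meijer_integrand (L : C -> C) (a b : list C) (x : C) (w : C) : C :=
  Cprod_list (fun c => Gamma (c - w)) a *
  Cprod_list (fun c => rGamma (1 - c + w)) b *
  Cpowb L x w.

(* the pole a_i + n is counted at its first occurrence (smallest i), so that
   each distinct pole of prod_j Gamma(a_j - w) is counted exactly once *)
Definition first_occurrence (a : list C) (i n : nat) : Prop :=
  ~ (exists i' n', (i' < i)%nat /\ nth i' a 0 + INR n' = nth i a 0 + INR n).

Definition occ_weight (a : list C) (i n : nat) : C :=
  if excluded_middle_informative (first_occurrence a i n) then 1 else 0.

(* G = - (sum of the residues of the integrand at all poles of
   prod_j Gamma(a_j - w)); the poles are a_i + n, summed in order of n *)
Definition meijerG (L : C -> C) (a b : list C) (x : C) : C :=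
  - Cseries (fun n =>
      Csum_nat (fun i => occ_weight a i n *
                          residue (meijer_integrand L a b x) (nth i a 0 + INR n))
               (length a)).

(* h = prod_{j=1}^N (z d/dz - a_j) f  on the (open) set D:
   g_0 = f, g_{i+1} = z g_i' - a_{i+1} g_i, h = g_N on D *)
Definition euler_apply (a : nat -> C) (N : nat) (D : C -> Prop) (f h : C -> C) : Prop :=
  exists g : nat -> C -> C,
    g O = f /\
    (forall i, (i < N)%nat -> forall z, D z ->
       exists d, is_derive (g i) z d /\ g (S i) z = z * d - a (S i) * g i z) /\
    (forall z, D z -> g N z = h z).

Definition lin_indep_on (N : nat) (D : C -> Prop) (f : nat -> C -> C) : Prop :=
  forall c : nat -> C,
    (forall z, D z -> Csum_nat (fun i => c (S i) * f (S i) z) N = 0) ->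
    forall j, (1 <= j <= N)%nat -> c j = 0.

Definition fundamental_system (P : (C -> C) -> Prop) (N : nat)
    (D : C -> Prop) (f : nat -> C -> C) : Prop :=
  (forall j, (1 <= j <= N)%nat -> P (f j)) /\ lin_indep_on N D f.

Definition block_start (n : nat -> nat) (s : nat) : nat :=
  fold_right Nat.add O (map n (seq 1 (s - 1))).

Definition in_block (n : nat -> nat) (s j : nat) : Prop :=
  (block_start n s < j <= block_start n s + n s)%nat.

Definition isZ (z : C) : Prop := exists k : Z, z = RtoC (IZR k).

(* Main.v *)
Require Import Defs.
From Stdlib Require Import Reals ClassicalEpsilon FunctionalExtensionality List Arith ZArith Permutation Lra Lia.
From Coquelicot Require Import Coquelicot.
Open Scope C_scope.

(** Let Phi be the Gamma quotient in the integrand and c_1, ..., c_N the parameters.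
    The functional equation of 1/Gamma gives
      Phi(w - 1) = (-1)^k prod_j (w - c_j) Phi(w),
    and the poles are al + m, m >= 0, with al the smallest of the first k parameters.
    In the variable u = log x the residue at al + m is e^((al+m)u) times a polynomial in u of
    degree < k, x d/dx is d/du, and the functional equation becomes a recurrence between
    consecutive polynomials: it yields both the rapid convergence of the residue sum and the
    differential equation.

    Independence: in the variable u the solutions are entire, so a relation valid near one
    point is valid everywhere.  The translation by 2 pi i acts on the solutions of block s with
    the single generalized eigenvalue e^(2 pi i c), c in the block; these eigenvalues are
    distinct, which separates the blocks.  Inside a block the k-th solution has degree exactly
    k - 1 in u (all k Gamma factors have a pole at the largest parameter), so the unipotent
    part of the translation separates the solutions.

    Instead of Cauchy's theory, analyticity is expressed by Taylor expansions to all orders with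
    uniformly bounded weighted norm (the predicate Sc); Gauss' product for 1/Gamma converges in
    this norm, and a residue is read off from the expansion at the pole. *)

(** Each of the k Gamma factors contributes a sign to the functional equation, so a G-function
    satisfies prod_j (d/du - c_j) G = (-1)^k e^u G; the argument (-1)^k zeta in eta removes this
    sign. This is also why the branch is given on both D and -D: the parity of k decides which of
    them is visited, and the values of the branch at z0 and -z0 enter the independence argument only
    as constant shifts of u. The obstacle is multiplicity. Poles of different Gamma factors overlap
    and the 1/Gamma factors of the second group may lower their order, so for k > 1 the residues
    have no convenient closed form. They are never computed: only their recurrence is used, together
    with boundary values. The polynomial one step left of al is zero, since no Gamma factor has a
    pole there; at the largest of the first k parameters the coefficient of u^(k-1) is nonzero,
    since no 1/Gamma factor vanishes there; for k = 1 the leading coefficient is explicit. These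
    give, respectively, the exact differential equation, independence and the normalization of the
    hypergeometric formula. *)

Ltac rmin_facts :=
  repeat match goal with
  | _ : context [Rmin ?a ?b] |- _ =>
      lazymatch goal with
      | _ : (Rmin a b <= a)%R |- _ => fail
      | _ => pose proof (Rmin_l a b); pose proof (Rmin_r a b)
      end
  end.

(** * Inequalities for the complex modulus *)

Lemma Cmod_minus_sym (x y : C) : Cmod (x - y) = Cmod (y - x).
Proof. rewrite <- Cmod_opp. f_equal. ring. Qed.

Lemma Cmod_triangle_minus (x y : C) : (Cmod (x - y) <= Cmod x + Cmod y)%R.
Proof. unfold Cminus. rewrite <- (Cmod_opp y). apply Cmod_triangle. Qed.

Lemma Cmod_triangle_rev (x y : C) : (Cmod x - Cmod y <= Cmod (x - y))%R.
Proof. pose proof (Cmod_triangle (x - y) y). replace (x - y + y) with x in H by ring. lra. Qed.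

Lemma Cmod_minus_ge (x y : C) : (Cmod x - Cmod y <= Cmod (x + y))%R.
Proof.
  pose proof (Cmod_triangle_rev x (- y)). rewrite Cmod_opp in H.
  replace (x - - y) with (x + y) in H by ring. exact H.
Qed.

Lemma Cmod_small_eq (x y : C) : (forall eps, (0 < eps)%R -> (Cmod (x - y) <= eps)%R) -> x = y.
Proof.
  intros H. destruct (Req_dec (Cmod (x - y)) 0) as [E|E].
  - apply Cmod_eq_0 in E. replace x with (x - y + y) by ring. rewrite E. ring.
  - pose proof (Cmod_ge_0 (x - y)).
    specialize (H (Cmod (x - y) / 2)%R). lra.
Qed.

Lemma im_le_Cmod (z : C) : (Rabs (Im z) <= Cmod z)%R.
Proof.
  pose proof (Rmax_Cmod z). pose proof (Rmax_r (Rabs (fst z)) (Rabs (snd z))).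
  unfold Im. lra.
Qed.

Lemma Cmod_le_re_im (z : C) : (Cmod z <= Rabs (Re z) + Rabs (Im z))%R.
Proof.
  replace z with (RtoC (Re z) + Ci * RtoC (Im z)).
  - eapply Rle_trans. apply Cmod_triangle.
    rewrite Cmod_mult, Cmod_Ci, !Cmod_R.
    replace (Re (Re z + Ci * Im z)) with (Re z) by (unfold Re, Im, Ci; simpl; ring).
    replace (Im (Re z + Ci * Im z)) with (Im z) by (unfold Re, Im, Ci; simpl; ring). lra.
  - destruct z as [a b]. unfold Re, Im, Ci, Cplus, Cmult, RtoC; simpl. f_equal; ring.
Qed.

Lemma Cmod_INR (n : nat) : Cmod (INR n) = INR n.
Proof. rewrite Cmod_R. apply Rabs_right. apply Rle_ge, pos_INR. Qed.

Lemma RtoC_INR_S (n : nat) : RtoC (INR (S n)) = INR n + 1.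
Proof. rewrite S_INR. rewrite RtoC_plus. reflexivity. Qed.

(** * Sequences and series of complex numbers *)

Definition Cconv (u : nat -> C) (l : C) : Prop :=
  forall eps, (0 < eps)%R -> exists n0, forall n, (n0 <= n)%nat -> (Cmod (u n - l) < eps)%R.

Definition cser (a : nat -> C) (l : C) : Prop := Cconv (Csum_nat a) l.

Fixpoint Rsum (b : nat -> R) (n : nat) : R :=
  match n with O => 0%R | S m => (Rsum b m + b m)%R end.

(** A majorant is recorded by a bound [s] on its partial sums, a form that scales, telescopes and
    can be enlarged without mentioning a limit. *)
Definition summ (b : nat -> R) (s : R) : Prop :=
  (forall n, (0 <= b n)%R) /\ forall n, (Rsum b n <= s)%R.

(** The uniform structure of C is that of a product, so its balls are squares; comparing them with
    discs costs the factor sqrt 2. *)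
Lemma locally_Cmod (l : C) (P : C -> Prop) :
  @locally C_UniformSpace l P <->
  exists d, (0 < d)%R /\ forall y, (Cmod (y - l) < d)%R -> P y.
Proof.
  split.
  - intros [d H]. exists d. split. apply cond_pos.
    intros y Hy. apply H. apply (C_NormedModule_mixin_compat1 l y d). exact Hy.
  - intros [d [Hd H]].
    assert (Hs : (0 < sqrt 2)%R) by (apply sqrt_lt_R0; lra).
    assert (Hd' : (0 < d / sqrt 2)%R) by (apply Rdiv_lt_0_compat; lra).
    exists (mkposreal _ Hd'). intros y Hy. apply H.
    pose proof (C_NormedModule_mixin_compat2 l y (mkposreal _ Hd') Hy) as H1.
    simpl in H1. replace (sqrt 2 * (d / sqrt 2))%R with d in H1 by (field; lra). exact H1.
Qed.

Lemma filterlim_Cmod {T : Type} (F : (T -> Prop) -> Prop) {FF : Filter F} (f : T -> C) (l : C) :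
  filterlim f F (@locally C_UniformSpace l) <->
  forall eps, (0 < eps)%R -> F (fun x => (Cmod (f x - l) < eps)%R).
Proof.
  split.
  - intros H eps He. apply (H (fun y => (Cmod (y - l) < eps)%R)).
    apply locally_Cmod. exists eps; auto.
  - intros H P HP. apply locally_Cmod in HP. destruct HP as [d [Hd HP]].
    unfold filtermap. eapply filter_imp. 2: apply (H d Hd). intros x Hx. apply HP, Hx.
Qed.

Lemma Cconv_filterlim (u : nat -> C) (l : C) :
  filterlim u eventually (@locally C_UniformSpace l) <-> Cconv u l.
Proof. apply (filterlim_Cmod eventually). Qed.

Lemma Cconv_unique (u : nat -> C) (l l' : C) : Cconv u l -> Cconv u l' -> l = l'.
Proof.
  intros H H'. apply Cmod_small_eq. intros eps He.
  destruct (H (eps / 2)%R ltac:(lra)) as [n0 H0].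
  destruct (H' (eps / 2)%R ltac:(lra)) as [n1 H1].
  specialize (H0 (n0 + n1)%nat ltac:(lia)). specialize (H1 (n0 + n1)%nat ltac:(lia)).
  replace (l - l') with ((u (n0 + n1)%nat - l') - (u (n0 + n1)%nat - l)) by ring.
  eapply Rle_trans. apply Cmod_triangle_minus. lra.
Qed.

(** One witness of convergence certifies the value picked by [epsilon], and limits are unique.
    [Cseries_unique] and [Clim_right0_unique] play the same role for series and one-sided limits. *)
Lemma Clim_seq_unique (u : nat -> C) (l : C) : Cconv u l -> Clim_seq u = l.
Proof.
  intros H. unfold Clim_seq.
  apply (Cconv_unique u). 2: exact H.
  apply Cconv_filterlim. apply (epsilon_spec (inhabits (RtoC 0))).
  exists l. now apply Cconv_filterlim.
Qed.

Lemma sum_n_Csum_nat (a : nat -> C) (n : nat) :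
  @sum_n C_AbelianMonoid a n = Csum_nat a (S n).
Proof.
  induction n.
  - rewrite sum_O. simpl. ring.
  - rewrite sum_Sn, IHn. reflexivity.
Qed.

Lemma Cconv_ext (u v : nat -> C) (l : C) : (forall n, u n = v n) -> Cconv u l -> Cconv v l.
Proof. intros E H eps He. destruct (H eps He) as [n0 H0]. exists n0. intros n Hn. rewrite <- E. auto. Qed.

Lemma Cconv_incr_1 (u : nat -> C) (l : C) : Cconv (fun n => u (S n)) l <-> Cconv u l.
Proof.
  split; intros H eps He; destruct (H eps He) as [n0 H0].
  - exists (S n0). intros [|n] Hn. lia. apply H0. lia.
  - exists n0. intros n Hn. apply H0. lia.
Qed.

Lemma is_series_cser (a : nat -> C) (l : C) :
  @is_series C_AbsRing C_NormedModule a l <-> cser a l.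
Proof.
  unfold cser. rewrite <- Cconv_incr_1.
  unfold is_series. split.
  - intros H. apply (Cconv_ext (fun n => @sum_n C_AbelianMonoid a n)).
    apply sum_n_Csum_nat. apply Cconv_filterlim. exact H.
  - intros H. apply (Cconv_filterlim (fun n => @sum_n C_AbelianMonoid a n)).
    apply (Cconv_ext (fun n => Csum_nat a (S n))). intros; symmetry; apply sum_n_Csum_nat. exact H.
Qed.

Lemma cser_unique (a : nat -> C) (l l' : C) : cser a l -> cser a l' -> l = l'.
Proof. apply Cconv_unique. Qed.

Lemma Cseries_unique (a : nat -> C) (l : C) : cser a l -> Cseries a = l.
Proof.
  intros H. unfold Cseries. apply (cser_unique a). 2: exact H.
  apply is_series_cser. apply (epsilon_spec (inhabits (RtoC 0))).
  exists l. now apply is_series_cser.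
Qed.

Lemma Cconv_const (c : C) : Cconv (fun _ => c) c.
Proof. intros eps He. exists O. intros n _. replace (c - c) with (RtoC 0) by ring. rewrite Cmod_0. exact He. Qed.

Lemma Cconv_plus (u v : nat -> C) (l m : C) :
  Cconv u l -> Cconv v m -> Cconv (fun n => u n + v n) (l + m).
Proof.
  intros H H' eps He.
  destruct (H (eps / 2)%R ltac:(lra)) as [n0 H0].
  destruct (H' (eps / 2)%R ltac:(lra)) as [n1 H1].
  exists (n0 + n1)%nat. intros n Hn. specialize (H0 n ltac:(lia)). specialize (H1 n ltac:(lia)).
  replace (u n + v n - (l + m)) with ((u n - l) + (v n - m)) by ring.
  eapply Rle_lt_trans. apply Cmod_triangle. lra.
Qed.

Lemma Cconv_bound (u : nat -> C) (l : C) (M : R) :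
  Cconv u l -> (exists n0, forall n, (n0 <= n)%nat -> (Cmod (u n) <= M)%R) -> (Cmod l <= M)%R.
Proof.
  intros H [n1 HM]. apply Rnot_lt_le. intros Hl.
  destruct (H (Cmod l - M)%R ltac:(lra)) as [n0 H0].
  specialize (H0 (n0 + n1)%nat ltac:(lia)). specialize (HM (n0 + n1)%nat ltac:(lia)).
  rewrite Cmod_minus_sym in H0. pose proof (Cmod_triangle_rev l (u (n0 + n1)%nat)). lra.
Qed.

Lemma Cconv_mult (u v : nat -> C) (l m : C) :
  Cconv u l -> Cconv v m -> Cconv (fun n => u n * v n) (l * m).
Proof.
  intros H H' eps He.
  pose proof (Cmod_ge_0 l) as Hl. pose proof (Cmod_ge_0 m) as Hm.
  set (d := Rmin 1 (eps / (2 * (Cmod l + Cmod m + 1)))).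
  assert (Hd : (0 < d)%R).
  { apply Rmin_pos. lra. apply Rdiv_lt_0_compat; lra. }
  destruct (H d Hd) as [n0 H0].
  destruct (H' d Hd) as [n1 H1].
  exists (n0 + n1)%nat. intros n Hn. specialize (H0 n ltac:(lia)). specialize (H1 n ltac:(lia)).
  replace (u n * v n - l * m) with ((u n - l) * (v n - m) + ((u n - l) * m + l * (v n - m))) by ring.
  eapply Rle_lt_trans. apply Cmod_triangle.
  eapply Rle_lt_trans. apply Rplus_le_compat_l, Cmod_triangle. rewrite !Cmod_mult.
  assert (Hd1 : (d <= 1)%R) by apply Rmin_l.
  assert (Hd2 : (d * (Cmod l + Cmod m + 1) <= eps / 2)%R).
  { eapply Rle_trans. apply Rmult_le_compat_r. lra. apply Rmin_r. right. field. lra. }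
  pose proof (Cmod_ge_0 (u n - l)). pose proof (Cmod_ge_0 (v n - m)). nra.
Qed.

Lemma Cconv_scal (c : C) (u : nat -> C) (l : C) : Cconv u l -> Cconv (fun n => c * u n) (c * l).
Proof. intros H. apply (Cconv_mult (fun _ => c)). apply Cconv_const. exact H. Qed.

Lemma Csum_nat_ext (a b : nat -> C) (n : nat) :
  (forall i, (i < n)%nat -> a i = b i) -> Csum_nat a n = Csum_nat b n.
Proof. induction n; intros H; simpl. reflexivity. rewrite IHn, H; auto. Qed.

Lemma Csum_nat_plus (a b : nat -> C) (n : nat) :
  Csum_nat (fun i => a i + b i) n = Csum_nat a n + Csum_nat b n.
Proof. induction n; simpl. ring. rewrite IHn. ring. Qed.

Lemma Csum_nat_scal (c : C) (a : nat -> C) (n : nat) :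
  Csum_nat (fun i => c * a i) n = c * Csum_nat a n.
Proof. induction n; simpl. ring. rewrite IHn. ring. Qed.

Lemma Csum_nat_0 (a : nat -> C) (n : nat) :
  (forall i, (i < n)%nat -> a i = 0) -> Csum_nat a n = 0.
Proof. induction n; intros H; simpl. reflexivity. rewrite IHn, H; auto. ring. Qed.

Lemma Csum_nat_S_l (a : nat -> C) (n : nat) :
  Csum_nat a (S n) = a O + Csum_nat (fun i => a (S i)) n.
Proof. induction n. simpl. ring. change (Csum_nat a (S n) + a (S n) = a O + (Csum_nat (fun i => a (S i)) n + a (S n))). rewrite IHn. ring. Qed.

Lemma Csum_nat_split (a : nat -> C) (n m : nat) :
  Csum_nat a (n + m) = Csum_nat a n + Csum_nat (fun i => a (n + i)%nat) m.
Proof.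
  induction m. rewrite Nat.add_0_r. simpl. ring.
  rewrite Nat.add_succ_r. simpl. rewrite IHm. ring.
Qed.

Lemma cser_ext (a b : nat -> C) (l : C) : (forall n, a n = b n) -> cser a l -> cser b l.
Proof. intros E. apply Cconv_ext. intros n. apply Csum_nat_ext. auto. Qed.

Lemma cser_plus (a b : nat -> C) (l m : C) :
  cser a l -> cser b m -> cser (fun n => a n + b n) (l + m).
Proof.
  intros H H'. eapply Cconv_ext. 2: apply (Cconv_plus _ _ _ _ H H').
  intros n. symmetry. apply Csum_nat_plus.
Qed.

Lemma cser_scal (c : C) (a : nat -> C) (l : C) : cser a l -> cser (fun n => c * a n) (c * l).
Proof.
  intros H. eapply Cconv_ext. 2: apply (Cconv_scal c _ _ H).
  intros n. symmetry. apply Csum_nat_scal.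
Qed.

Lemma cser_0 : cser (fun _ => 0) 0.
Proof.
  eapply Cconv_ext. 2: apply Cconv_const. intros n. symmetry. apply Csum_nat_0. reflexivity.
Qed.

Lemma cser_Csum (a : nat -> nat -> C) (l : nat -> C) (k : nat) :
  (forall j, (j < k)%nat -> cser (fun n => a n j) (l j)) ->
  cser (fun n => Csum_nat (a n) k) (Csum_nat l k).
Proof.
  induction k; intros H; simpl. apply cser_0.
  apply cser_plus. apply IHk. auto. apply H. lia.
Qed.

Lemma cser_incr_1 (a : nat -> C) (l : C) : cser (fun n => a (S n)) l <-> cser a (a O + l).
Proof.
  unfold cser. rewrite <- (Cconv_incr_1 (Csum_nat a)). split; intros H.
  - eapply Cconv_ext. 2: apply (Cconv_plus (fun _ => a O) _ (a O) _ (Cconv_const _) H).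
    intros n. symmetry. apply Csum_nat_S_l.
  - apply (Cconv_ext (fun n => - a O + Csum_nat a (S n))).
    intros n. rewrite Csum_nat_S_l. ring.
    replace l with (- a O + (a O + l)) by ring. apply (Cconv_plus (fun _ => - a O)).
    apply Cconv_const. exact H.
Qed.

Lemma Rsum_mono (b : nat -> R) (n m : nat) :
  (forall i, (0 <= b i)%R) -> (n <= m)%nat -> (Rsum b n <= Rsum b m)%R.
Proof. intros H Hnm. induction Hnm. lra. simpl. specialize (H m). lra. Qed.

Lemma Rsum_le (a b : nat -> R) (n : nat) :
  (forall i, (a i <= b i)%R) -> (Rsum a n <= Rsum b n)%R.
Proof. intros H. induction n; simpl. lra. specialize (H n). lra. Qed.

Lemma Rsum_scal (c : R) (a : nat -> R) (n : nat) :
  Rsum (fun i => c * a i)%R n = (c * Rsum a n)%R.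
Proof. induction n; simpl. ring. rewrite IHn. ring. Qed.

Lemma Rsum_plus (a b : nat -> R) (n : nat) :
  Rsum (fun i => a i + b i)%R n = (Rsum a n + Rsum b n)%R.
Proof. induction n; simpl. ring. rewrite IHn. ring. Qed.

Lemma Rsum_geom (n : nat) : (Rsum (fun m => (/ 2) ^ m)%R n <= 2)%R.
Proof.
  assert (H : Rsum (fun m => (/ 2) ^ m)%R n = (2 - 2 * (/ 2) ^ n)%R).
  { induction n; simpl. lra. rewrite IHn. lra. }
  rewrite H. pose proof (pow_lt (/2) n ltac:(lra)). lra.
Qed.

Lemma Cmod_Csum_le (a : nat -> C) (b : nat -> R) (n : nat) :
  (forall i, (Cmod (a i) <= b i)%R) -> (Cmod (Csum_nat a n) <= Rsum b n)%R.
Proof.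
  intros H. induction n; simpl. rewrite Cmod_0. lra.
  eapply Rle_trans. apply Cmod_triangle. specialize (H n). lra.
Qed.

Lemma Cmod_Csum_diff (a : nat -> C) (b : nat -> R) (n m : nat) :
  (forall i, (Cmod (a i) <= b i)%R) -> (n <= m)%nat ->
  (Cmod (Csum_nat a m - Csum_nat a n) <= Rsum b m - Rsum b n)%R.
Proof.
  intros H Hnm. induction Hnm.
  - replace (Csum_nat a n - Csum_nat a n) with (RtoC 0) by ring. rewrite Cmod_0. lra.
  - simpl. replace (Csum_nat a m + a m - Csum_nat a n) with ((Csum_nat a m - Csum_nat a n) + a m) by ring.
    eapply Rle_trans. apply Cmod_triangle. specialize (H m). lra.
Qed.

Lemma Re_minus (x y : C) : Re (x - y) = (Re x - Re y)%R.
Proof. reflexivity. Qed.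

Lemma Im_minus (x y : C) : Im (x - y) = (Im x - Im y)%R.
Proof. reflexivity. Qed.

(** Domination makes the partial sums Cauchy; completeness is then applied to their real and
    imaginary parts. *)
Lemma cser_dominated (a : nat -> C) (b : nat -> R) (s : R) :
  (forall n, (Cmod (a n) <= b n)%R) -> summ b s ->
  exists l, cser a l /\ (Cmod l <= s)%R.
Proof.
  intros Hab [Hb Hs].
  assert (Hcv : { l : R | Un_cv (Rsum b) l }).
  { apply growing_cv.
    - intros n. apply Rsum_mono; auto.
    - exists s. intros x [n Hn]. rewrite Hn. apply Hs. }
  destruct Hcv as [lb Hlb].
  assert (HC : forall eps, (eps > 0)%R -> exists N0, forall n m, (n >= N0)%nat -> (m >= N0)%nat ->
              (Cmod (Csum_nat a n - Csum_nat a m) < eps)%R).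
  { pose proof (CV_Cauchy (Rsum b) (exist _ lb Hlb)) as HCb.
    intros eps He. destruct (HCb eps He) as [N0 HN]. exists N0. intros n m Hn Hm.
    destruct (Nat.le_ge_cases n m) as [E|E].
    - rewrite Cmod_minus_sym. eapply Rle_lt_trans. apply (Cmod_Csum_diff a b n m Hab E).
      specialize (HN m n Hm Hn). unfold Rdist in HN.
      eapply Rle_lt_trans. apply RRle_abs. exact HN.
    - eapply Rle_lt_trans. apply (Cmod_Csum_diff a b m n Hab E).
      specialize (HN n m Hn Hm). unfold Rdist in HN.
      eapply Rle_lt_trans. apply RRle_abs. exact HN. }
  assert (HR : { l : R | Un_cv (fun n => Re (Csum_nat a n)) l }).
  { apply Rcomplete.R_complete. intros eps He. destruct (HC eps He) as [N0 HN]. exists N0.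
    intros n m Hn Hm. unfold Rdist. rewrite <- Re_minus.
    eapply Rle_lt_trans. apply re_le_Cmod. auto. }
  assert (HI : { l : R | Un_cv (fun n => Im (Csum_nat a n)) l }).
  { apply Rcomplete.R_complete. intros eps He. destruct (HC eps He) as [N0 HN]. exists N0.
    intros n m Hn Hm. unfold Rdist. rewrite <- Im_minus.
    eapply Rle_lt_trans. apply im_le_Cmod. auto. }
  destruct HR as [x Hx]. destruct HI as [y Hy].
  assert (Hc : cser a (x, y)).
  { intros eps He. destruct (Hx (eps / 2)%R ltac:(lra)) as [n0 H0].
    destruct (Hy (eps / 2)%R ltac:(lra)) as [n1 H1]. exists (n0 + n1)%nat. intros n Hn.
    specialize (H0 n ltac:(lia)). specialize (H1 n ltac:(lia)).
    eapply Rle_lt_trans. apply Cmod_le_re_im. rewrite Re_minus, Im_minus.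
    unfold Rdist in *. simpl Re at 2. simpl Im at 2.
    unfold Re, Im in *; simpl in *. lra. }
  exists (x, y). split. exact Hc.
  apply (Cconv_bound (Csum_nat a)). exact Hc. exists O. intros n _.
  eapply Rle_trans. apply (Cmod_Csum_le a b n Hab). apply Hs.
Qed.

(** * Bounded Taylor expansions *)

(* On the disc |e| <= rho,  u e = sum_(j < K) p_j e^j + e^K R e  with
   sum_(j < K) |p_j| rho^j + rho^K sup |R| <= B.  For fixed B and all K this
   says that u is a power series of norm at most B; the weighted norm makes
   the class submultiplicative and complete, which replaces Cauchy's theory. *)
Fixpoint Sc (rho : R) (K : nat) (B : R) (p : nat -> C) (u : C -> C) : Prop :=
  match K with
  | O => forall e, (Cmod e <= rho)%R -> (Cmod (u e) <= B)%R
  | S K' => exists v B',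
      Sc rho K' B' (fun j => p (S j)) v /\ (Cmod (p O) + rho * B' <= B)%R /\
      forall e, (Cmod e <= rho)%R -> u e = p O + e * v e
  end.

(** Coefficients of a product of power series. The recursion peels off the leading coefficient of
    the first factor, as the recursion of [Sc] does. *)
Fixpoint conv (p q : nat -> C) (n : nat) : C :=
  match n with
  | O => p O * q O
  | S n' => p O * q (S n') + conv (fun j => p (S j)) q n'
  end.

Lemma Sc_bound (rho : R) (K : nat) (B : R) (p : nat -> C) (u : C -> C) :
  (0 <= rho)%R -> Sc rho K B p u -> forall e, (Cmod e <= rho)%R -> (Cmod (u e) <= B)%R.
Proof.
  intros Hr. revert B p u. induction K; intros B p u H e He.
  - apply H, He.
  - destruct H as [v [B' [Hv [HB Hu]]]]. rewrite Hu by exact He.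
    eapply Rle_trans. apply Cmod_triangle. rewrite Cmod_mult.
    specialize (IHK _ _ _ Hv e He). pose proof (Cmod_ge_0 (v e)). pose proof (Cmod_ge_0 e). nra.
Qed.

Lemma Sc_nonneg (rho : R) (K : nat) (B : R) (p : nat -> C) (u : C -> C) :
  (0 <= rho)%R -> Sc rho K B p u -> (0 <= B)%R.
Proof.
  intros Hr H. eapply Rle_trans. apply (Cmod_ge_0 (u 0)).
  apply (Sc_bound rho K B p u Hr H). rewrite Cmod_0. exact Hr.
Qed.

Lemma Sc_ext (rho : R) (K : nat) (B B' : R) (p p' : nat -> C) (u u' : C -> C) :
  (0 <= rho)%R -> Sc rho K B p u -> (B <= B')%R -> (forall j, (j < K)%nat -> p j = p' j) ->
  (forall e, (Cmod e <= rho)%R -> u e = u' e) -> Sc rho K B' p' u'.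
Proof.
  intros Hr. revert B B' p p' u u'. induction K; intros B B' p p' u u' H HB Hp Hu; simpl in *.
  - intros e He. rewrite <- Hu by exact He. eapply Rle_trans. apply H, He. exact HB.
  - destruct H as [v [B1 [Hv [HB1 Hv']]]]. exists v, B1. split; [|split].
    + apply (IHK B1 B1 (fun j => p (S j)) _ v v); auto. lra. intros j Hj. apply Hp. lia.
    + rewrite <- Hp by lia. lra.
    + intros e He. rewrite <- Hp by lia. rewrite <- Hu by exact He. apply Hv', He.
Qed.

Lemma Sc_le (rho : R) (K : nat) (B B' : R) (p : nat -> C) (u : C -> C) :
  (0 <= rho)%R -> Sc rho K B p u -> (B <= B')%R -> Sc rho K B' p u.
Proof. intros Hr H HB. now apply (Sc_ext rho K B B' p p u u). Qed.

Lemma Sc_pred (rho : R) (K : nat) (B : R) (p : nat -> C) (u : C -> C) :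
  (0 <= rho)%R -> Sc rho (S K) B p u -> Sc rho K B p u.
Proof.
  intros Hr. revert B p u. induction K; intros B p u H.
  - intros e He. apply (Sc_bound rho 1 B p u Hr H e He).
  - destruct H as [v [B' [Hv [HB Hu]]]]. exists v, B'. split; auto.
Qed.

Lemma Sc_shrink (rho rho' : R) (K : nat) (B : R) (p : nat -> C) (u : C -> C) :
  (0 <= rho' <= rho)%R -> Sc rho K B p u -> Sc rho' K B p u.
Proof.
  intros Hr. revert B p u. induction K; intros B p u H; simpl in *.
  - intros e He. apply H. lra.
  - destruct H as [v [B' [Hv [HB Hu]]]]. exists v, B'. split; [auto|split].
    + pose proof (Sc_nonneg rho K B' _ _ ltac:(lra) Hv). nra.
    + intros e He. apply Hu. lra.
Qed.

Lemma Sc_plus (rho : R) (K : nat) (B B' : R) (p p' : nat -> C) (u u' : C -> C) :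
  (0 <= rho)%R -> Sc rho K B p u -> Sc rho K B' p' u' ->
  Sc rho K (B + B') (fun j => p j + p' j) (fun e => u e + u' e).
Proof.
  intros Hr. revert B B' p p' u u'. induction K; intros B B' p p' u u' H H'; simpl in *.
  - intros e He. eapply Rle_trans. apply Cmod_triangle. specialize (H e He). specialize (H' e He). lra.
  - destruct H as [v [B1 [Hv [HB Hu]]]]. destruct H' as [v' [B1' [Hv' [HB' Hu']]]].
    exists (fun e => v e + v' e), (B1 + B1')%R. split; [|split].
    + apply (IHK B1 B1' (fun j => p (S j)) (fun j => p' (S j)) v v'); auto.
    + pose proof (Cmod_triangle (p O) (p' O)). lra.
    + intros e He. rewrite Hu, Hu' by exact He. ring.
Qed.

Lemma Sc_const (rho : R) (K : nat) (c : C) :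
  (0 <= rho)%R -> Sc rho K (Cmod c) (fun j => match j with O => c | _ => 0 end) (fun _ => c).
Proof.
  intros Hr. revert c. destruct K; intros c; simpl. intros; lra.
  exists (fun _ => 0), 0%R. split; [|split].
  - clear. induction K; simpl. intros. rewrite Cmod_0. lra.
    exists (fun _ => 0), 0%R. split; [exact IHK|split]. rewrite Cmod_0. lra. intros. ring.
  - lra.
  - intros. ring.
Qed.

Lemma Sc_scal (rho : R) (K : nat) (c : C) (B : R) (p : nat -> C) (u : C -> C) :
  (0 <= rho)%R -> Sc rho K B p u -> Sc rho K (Cmod c * B) (fun j => c * p j) (fun e => c * u e).
Proof.
  intros Hr. revert B p u. induction K; intros B p u H; simpl in *.
  - intros e He. rewrite Cmod_mult. apply Rmult_le_compat_l. apply Cmod_ge_0. auto.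
  - destruct H as [v [B' [Hv [HB Hu]]]]. exists (fun e => c * v e), (Cmod c * B')%R. split; [|split].
    + apply IHK, Hv.
    + rewrite Cmod_mult. pose proof (Cmod_ge_0 c). nra.
    + intros e He. rewrite Hu by exact He. ring.
Qed.

(** From u u' = p_0 p'_0 + e (p_0 v' + v u'). Leaving u' whole in the last product makes the norms
    multiply; it occurs there at one order less, hence [Sc_pred]. *)
Lemma Sc_mult (rho : R) (K : nat) (B B' : R) (p p' : nat -> C) (u u' : C -> C) :
  (0 <= rho)%R -> Sc rho K B p u -> Sc rho K B' p' u' ->
  Sc rho K (B * B') (conv p p') (fun e => u e * u' e).
Proof.
  intros Hr. revert B B' p p' u u'. induction K; intros B B' p p' u u' H H'.
  - intros e He. rewrite Cmod_mult. apply Rmult_le_compat; try apply Cmod_ge_0; auto.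
  - pose proof (Sc_nonneg _ _ _ _ _ Hr H') as HB'0.
    destruct H as [v [B1 [Hv [HB Hu]]]].
    pose proof (Sc_pred rho K B' p' u' Hr H') as Hpred.
    destruct H' as [v' [B1' [Hv' [HB' Hu']]]].
    exists (fun e => p O * v' e + v e * u' e), (Cmod (p O) * B1' + B1 * B')%R. split; [|split].
    + pose proof (Sc_plus rho K _ _ _ _ _ _ Hr (Sc_scal rho K (p O) _ _ _ Hr Hv') (IHK _ _ _ _ _ _ Hv Hpred)) as HS.
      exact HS.
    + simpl. rewrite Cmod_mult. pose proof (Cmod_ge_0 (p O)).
      apply Rle_trans with ((Cmod (p O) + rho * B1) * B')%R; [|apply Rmult_le_compat_r; lra].
      apply Rle_trans with (Cmod (p O) * (Cmod (p' O) + rho * B1') + rho * B1 * B')%R. right; ring.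
      apply Rle_trans with (Cmod (p O) * B' + rho * B1 * B')%R; [|right; ring].
      apply Rplus_le_compat_r, Rmult_le_compat_l; lra.
    + intros e He. rewrite Hu, Hu' at 1 by exact He. simpl. rewrite (Hu' e He). ring.
Qed.

Lemma Sc_id (rho : R) (K : nat) : (0 <= rho)%R ->
  Sc rho K rho (fun j => match j with 1%nat => 1 | _ => 0 end) (fun e => e).
Proof.
  intros Hr. destruct K; simpl. auto.
  exists (fun _ => 1), 1%R. split; [|split].
  - eapply Sc_ext. exact Hr. apply (Sc_const rho K 1 Hr). rewrite Cmod_1. lra.
    intros [|[|j]] _; reflexivity. reflexivity.
  - rewrite Cmod_0. lra.
  - intros. ring.
Qed.

(** Completeness of the normed class: constant coefficients and remainders are summed separately,
    and the total norm [s] is shared between them. *)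
Lemma Sc_series (rho : R) (K : nat) (b : nat -> R) (p : nat -> nat -> C) (u : nat -> C -> C)
    (s : R) (P : nat -> C) (U : C -> C) :
  (0 < rho)%R -> (forall n, Sc rho K (b n) (p n) (u n)) -> summ b s ->
  (forall j, (j < K)%nat -> cser (fun n => p n j) (P j)) ->
  (forall e, (Cmod e <= rho)%R -> cser (fun n => u n e) (U e)) ->
  Sc rho K s P U.
Proof.
  intros Hr. revert b p u s P U. induction K; intros b p u s P U H Hs HP HU.
  - intros e He. apply (Cconv_bound (Csum_nat (fun n => u n e))). apply HU, He.
    exists O. intros n _. eapply Rle_trans. apply Cmod_Csum_le. intros i. apply (H i e He). apply Hs.
  - simpl in H.
    destruct (choice (fun n (vB : (C -> C) * R) =>
        Sc rho K (snd vB) (fun j => p n (S j)) (fst vB) /\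
        (Cmod (p n O) + rho * snd vB <= b n)%R /\
        forall e, (Cmod e <= rho)%R -> u n e = p n O + e * fst vB e)) as [w Hw].
    { intros n. destruct (H n) as [v [B' HvB]]. exists (v, B'). exact HvB. }
    clear H.
    assert (Hw0 : forall n, (0 <= snd (w n))%R).
    { intros n. destruct (Hw n) as [H1 _]. apply (Sc_nonneg _ _ _ _ _ (Rlt_le _ _ Hr) H1). }
    (* The constant coefficients use up at least |P 0| of the norm [s]; what is left, divided by
       rho, bounds the norms of the remainders. *)
    assert (Hs' : summ (fun n => snd (w n)) ((s - Cmod (P O)) / rho)).
    { split. exact Hw0. intros n.
      apply Rmult_le_reg_l with rho. lra.
      replace (rho * ((s - Cmod (P O)) / rho))%R with (s - Cmod (P O))%R by (field; lra).
      assert (HPO : (Cmod (P O) <= s - rho * Rsum (fun n => snd (w n)) n)%R).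
      { apply (Cconv_bound (Csum_nat (fun n => p n O))). apply HP; lia.
        exists n. intros m Hm. eapply Rle_trans. apply Cmod_Csum_le. intros i; apply Rle_refl.
        pose proof (Rsum_mono (fun n => snd (w n)) n m Hw0 Hm).
        assert (Rsum (fun i => Cmod (p i O)) m + rho * Rsum (fun n => snd (w n)) m <= s)%R.
        { rewrite <- Rsum_scal, <- Rsum_plus. eapply Rle_trans. 2: apply (proj2 Hs m).
          apply Rsum_le. intros i. apply Hw. }
        nra. }
      lra. }
    assert (HV : forall e, exists l, (Cmod e <= rho)%R -> cser (fun n => fst (w n) e) l).
    { intros e. destruct (Rle_dec (Cmod e) rho) as [He|He].
      - destruct (cser_dominated (fun n => fst (w n) e) (fun n => snd (w n)) ((s - Cmod (P O)) / rho)) as [l [Hl _]].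
        + intros n. destruct (Hw n) as [H1 _]. apply (Sc_bound rho K _ _ _ (Rlt_le _ _ Hr) H1 e He).
        + exact Hs'.
        + exists l. auto.
      - exists 0. intros; contradiction. }
    apply choice in HV. destruct HV as [V HV].
    exists V, ((s - Cmod (P O)) / rho)%R. split; [|split].
    + apply (IHK (fun n => snd (w n)) (fun n j => p n (S j)) (fun n => fst (w n))); auto.
      * intros n. apply Hw.
      * intros j Hj. apply HP. lia.
    + right. field. lra.
    + intros e He. apply (cser_unique (fun n => u n e)). apply HU, He.
      apply (cser_ext (fun n => p n O + e * fst (w n) e)).
      * intros n. symmetry. apply (proj2 (proj2 (Hw n)) e He).
      * apply cser_plus. apply HP; lia. apply cser_scal. apply HV, He.
Qed.

(** Cauchy's estimate: the weighted norm contains the term |p_j| rho^j. *)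
Lemma Sc_coef_bound (rho : R) (K : nat) (B : R) (p : nat -> C) (u : C -> C) (j : nat) :
  (0 <= rho)%R -> Sc rho K B p u -> (j < K)%nat -> (Cmod (p j) * rho ^ j <= B)%R.
Proof.
  intros Hr. revert B p u j. induction K; intros B p u j H Hj. lia.
  destruct H as [v [B1 [Hv [HB Hu]]]].
  pose proof (Sc_nonneg _ _ _ _ _ Hr Hv).
  destruct j; simpl. nra.
  assert (Hj' : (j < K)%nat) by lia.
  specialize (IHK _ _ _ j Hv Hj'). pose proof (Cmod_ge_0 (p O)).
  apply Rle_trans with (rho * (Cmod (p (S j)) * rho ^ j))%R. right; ring. nra.
Qed.

(* Z is only required to accumulate at 0, so that it can be a real half-line. *)
Lemma Sc_coef_zero (rho : R) (K : nat) (B : R) (p : nat -> C) (u : C -> C) (Z : C -> Prop) :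
  (0 < rho)%R -> Sc rho K B p u ->
  (forall d, (0 < d)%R -> exists e, Z e /\ (0 < Cmod e < d)%R) ->
  (forall e, Z e -> (0 < Cmod e)%R -> (Cmod e <= rho)%R -> u e = 0) ->
  forall j, (j < K)%nat -> p j = 0.
Proof.
  intros Hr. revert B p u. induction K; intros B p u H HZ Hu0 j Hj. lia.
  destruct H as [v [B1 [Hv [HB Hu]]]].
  assert (Hp0 : p O = 0).
  { apply Cmod_small_eq. intros eps He.
    pose proof (Sc_nonneg _ _ _ _ _ (Rlt_le _ _ Hr) Hv) as HB1.
    destruct (HZ (Rmin rho (eps / (B1 + 1)))%R) as [e [Ze [He0 Hed]]].
    { apply Rmin_pos. exact Hr. apply Rdiv_lt_0_compat; lra. }
    rmin_facts.
    assert (Her : (Cmod e <= rho)%R) by lra.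
    specialize (Hu e Her). rewrite Hu0 in Hu by auto.
    replace (p O - 0) with (- (e * v e)).
    2: { replace (p O - 0) with (p O + e * v e - e * v e) by ring. rewrite <- Hu. ring. }
    rewrite Cmod_opp, Cmod_mult.
    pose proof (Sc_bound _ _ _ _ _ (Rlt_le _ _ Hr) Hv e Her). pose proof (Cmod_ge_0 (v e)).
    apply Rle_trans with (eps / (B1 + 1) * (B1 + 1))%R. nra. right. field. lra. }
  destruct j. exact Hp0.
  apply (IHK B1 (fun j => p (S j)) v Hv HZ).
  - intros e Ze He0 Her. specialize (Hu e Her). rewrite Hu0, Hp0 in Hu by auto.
    apply Cmod_gt_0 in He0. replace (v e) with ((0 + e * v e) / e) by (field; exact He0).
    rewrite <- Hu. field. exact He0.
  - lia.
Qed.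

(** Schwarz-type decay: each vanishing coefficient gains a factor |e| / rho. With [B] fixed and [K]
    growing this yields the identity theorem [entire_zero]. *)
Lemma Sc_zero_coef_bound (rho : R) (K : nat) (B : R) (p : nat -> C) (u : C -> C) (e : C) :
  (0 < rho)%R -> Sc rho K B p u -> (forall j, (j < K)%nat -> p j = 0) ->
  (Cmod e <= rho)%R -> (Cmod (u e) <= (Cmod e / rho) ^ K * B)%R.
Proof.
  intros Hr. revert B p u. induction K; intros B p u H Hp He.
  - simpl. rewrite Rmult_1_l. apply H, He.
  - destruct H as [v [B1 [Hv [HB Hu]]]]. rewrite Hu, Hp by (auto; lia).
    rewrite Hp, Cmod_0 in HB by lia.
    replace (0 + e * v e) with (e * v e) by ring. rewrite Cmod_mult.
    specialize (IHK B1 _ v Hv). simpl.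
    assert (Hp' : forall j, (j < K)%nat -> p (S j) = 0) by (intros; apply Hp; lia).
    specialize (IHK Hp' He). pose proof (Cmod_ge_0 e). pose proof (Cmod_ge_0 (v e)).
    assert (0 <= (Cmod e / rho) ^ K)%R by (apply pow_le, Rdiv_le_0_compat; lra).
    apply Rle_trans with (Cmod e * ((Cmod e / rho) ^ K * B1))%R. nra.
    apply Rle_trans with ((Cmod e / rho) * (Cmod e / rho) ^ K * (rho * B1))%R.
    right. field. lra.
    apply Rmult_le_compat_l. apply Rmult_le_pos; [apply Rdiv_le_0_compat; lra|auto]. lra.
Qed.

Lemma Sc_sub (rho : R) (K : nat) (B B' : R) (p p' : nat -> C) (u u' : C -> C) :
  (0 <= rho)%R -> Sc rho K B p u -> Sc rho K B' p' u' ->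
  Sc rho K (B + B') (fun j => p j - p' j) (fun e => u e - u' e).
Proof.
  intros Hr H H'. eapply Sc_ext. exact Hr.
  apply (Sc_plus rho K _ _ _ _ _ _ Hr H (Sc_scal rho K (-(1)) _ _ _ Hr H')).
  rewrite Cmod_m1. lra. intros; cbv beta; ring. intros; cbv beta; ring.
Qed.

Lemma RtoC_neq (x y : R) : x <> y -> RtoC x <> RtoC y.
Proof. intros H E. apply H, RtoC_inj, E. Qed.

(** * Complex derivatives *)

(** Increment form with the modulus, so that the estimates become real inequalities;
    [cder_is_derive] leads back to the library derivative. *)
Definition cder (f : C -> C) (z d : C) : Prop :=
  forall eps, (0 < eps)%R -> exists del, (0 < del)%R /\
    forall h, (Cmod h < del)%R -> (Cmod (f (z + h)%C - f z - d * h) <= eps * Cmod h)%R.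

Lemma cder_is_derive (f : C -> C) (z d : C) :
  cder f z d -> @is_derive C_AbsRing C_NormedModule f z d.
Proof.
  intros H. split.
  - apply is_linear_scal_l.
  - intros x Hx.
    assert (E : z = x) by (apply (is_filter_lim_locally_unique (V := AbsRing_NormedModule C_AbsRing)); exact Hx).
    subst x. intros eps.
    destruct (H eps (cond_pos eps)) as [del [Hdel Hd]].
    exists (mkposreal del Hdel). intros y Hy.
    assert (Hy' : (Cmod (y - z) < del)%R) by exact Hy.
    assert (E1 : forall a b : C, a + (b - a) = b) by (intros; ring).
    assert (E2 : forall a b c e k : C, a + - b + - ((c + - e) * k) = a - b - k * (c - e)) by (intros; ring).
    specialize (Hd (y - z) Hy'). rewrite E1 in Hd.
    rewrite <- E2 in Hd. exact Hd.
Qed.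

Lemma cder_ext_loc (f g : C -> C) (z d : C) :
  (exists r, (0 < r)%R /\ forall h, (Cmod h < r)%R -> f (z + h)%C = g (z + h)%C) ->
  cder f z d -> cder g z d.
Proof.
  intros [r [Hr E]] H eps He. destruct (H eps He) as [del [Hdel Hd]].
  exists (Rmin r del). split. apply Rmin_pos; assumption.
  intros h Hh. rmin_facts.
  rewrite <- E by lra. specialize (E 0). replace (z + 0) with z in E by ring.
  rewrite <- E by (rewrite Cmod_0; lra). apply Hd. lra.
Qed.

Lemma cder_const (c z : C) : cder (fun _ => c) z 0.
Proof.
  intros eps He. exists 1%R. split. lra. intros h _. replace (c - c - 0 * h) with (RtoC 0) by ring.
  rewrite Cmod_0. pose proof (Cmod_ge_0 h). nra.
Qed.

Lemma cder_id (z : C) : cder (fun x => x) z 1.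
Proof.
  intros eps He. exists 1%R. split. lra. intros h _. replace (z + h - z - 1 * h) with (RtoC 0) by ring.
  rewrite Cmod_0. pose proof (Cmod_ge_0 h). nra.
Qed.

Lemma cder_plus (f g : C -> C) (z d d' : C) :
  cder f z d -> cder g z d' -> cder (fun x => f x + g x) z (d + d').
Proof.
  intros H H' eps He.
  destruct (H (eps / 2)%R ltac:(lra)) as [d1 [Hd1 K1]].
  destruct (H' (eps / 2)%R ltac:(lra)) as [d2 [Hd2 K2]].
  exists (Rmin d1 d2). split. apply Rmin_pos; assumption.
  intros h Hh. rmin_facts.
  specialize (K1 h ltac:(lra)). specialize (K2 h ltac:(lra)).
  replace (f (z + h)%C + g (z + h)%C - (f z + g z) - (d + d') * h) with
    ((f (z + h)%C - f z - d * h) + (g (z + h)%C - g z - d' * h)) by ring.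
  eapply Rle_trans. apply Cmod_triangle. lra.
Qed.

Lemma cder_lip (f : C -> C) (z d : C) : cder f z d ->
  exists del, (0 < del)%R /\ forall h, (Cmod h < del)%R -> (Cmod (f (z + h)%C - f z) <= (Cmod d + 1) * Cmod h)%R.
Proof.
  intros H. destruct (H 1%R ltac:(lra)) as [del [Hdel Hd]]. exists del. split; [exact Hdel|].
  intros h Hh. specialize (Hd h Hh).
  replace (f (z + h)%C - f z) with ((f (z + h)%C - f z - d * h) + d * h) by ring.
  eapply Rle_trans. apply Cmod_triangle. rewrite Cmod_mult. lra.
Qed.

Lemma cder_mult (f g : C -> C) (z d d' : C) :
  cder f z d -> cder g z d' -> cder (fun x => f x * g x) z (d * g z + f z * d').
Proof.
  intros H H' eps He.
  destruct (cder_lip g z d' H') as [d0 [Hd0 K0]].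
  pose proof (Cmod_ge_0 (g z)). pose proof (Cmod_ge_0 (f z)).
  pose proof (Cmod_ge_0 d). pose proof (Cmod_ge_0 d').
  (* [A] collects the factors that multiply the two first-order errors, [M] the one in the quadratic
     term d h (g(z+h) - g(z)); each group receives eps / 2. *)
  set (A := (Cmod (g z) + Cmod (f z) + Cmod d' + 2)%R).
  set (M := (Cmod d * (Cmod d' + 1) + 1)%R).
  assert (HA : (0 < A)%R) by (unfold A; lra).
  assert (HM : (0 < M)%R) by (unfold M; nra).
  assert (He1 : (0 < eps / (2 * A))%R) by (apply Rdiv_lt_0_compat; lra).
  assert (He2 : (0 < eps / (2 * M))%R) by (apply Rdiv_lt_0_compat; lra).
  destruct (H _ He1) as [d1 [Hd1 K1]].
  destruct (H' _ He1) as [d2 [Hd2 K2]].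
  exists (Rmin (Rmin d1 d2) (Rmin (Rmin d0 1) (eps / (2 * M)))). split. repeat apply Rmin_pos; lra.
  intros h Hh.
  rmin_facts.
  specialize (K0 h ltac:(lra)). specialize (K1 h ltac:(lra)). specialize (K2 h ltac:(lra)).
  replace (f (z + h)%C * g (z + h)%C - f z * g z - (d * g z + f z * d') * h) with
    ((f (z + h)%C - f z - d * h) * (g z + (g (z + h)%C - g z)) +
      (f z * (g (z + h)%C - g z - d' * h) + d * h * (g (z + h)%C - g z))) by ring.
  eapply Rle_trans. apply Cmod_triangle.
  eapply Rle_trans. apply Rplus_le_compat_l, Cmod_triangle.
  rewrite !Cmod_mult.
  pose proof (Cmod_triangle (g z) (g (z + h)%C - g z)).
  pose proof (Cmod_ge_0 h).
  set (X := Cmod (f (z + h)%C - f z - d * h)) in *.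
  set (Y := Cmod (g (z + h)%C - g z - d' * h)) in *.
  set (W := Cmod (g (z + h)%C - g z)) in *.
  set (V := Cmod (g z + (g (z + h)%C - g z))) in *.
  assert (HW : (W <= Cmod d' + 1)%R) by nra.
  assert (0 <= X)%R by apply Cmod_ge_0. assert (0 <= Y)%R by apply Cmod_ge_0.
  assert (0 <= W)%R by apply Cmod_ge_0.
  assert (T1 : (X * V <= eps / (2 * A) * Cmod h * (Cmod (g z) + Cmod d' + 1))%R).
  { apply Rmult_le_compat; try assumption. apply Cmod_ge_0. lra. }
  assert (T2 : (Cmod (f z) * Y <= eps / (2 * A) * Cmod h * Cmod (f z))%R) by nra.
  assert (T3 : (Cmod d * Cmod h * W <= Cmod h * (eps / (2 * M) * M))%R).
  { apply Rle_trans with (Cmod h * (Cmod d * ((Cmod d' + 1) * Cmod h)))%R.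
    - replace (Cmod d * Cmod h * W)%R with (Cmod h * (Cmod d * W))%R by ring.
      apply Rmult_le_compat_l. lra. apply Rmult_le_compat_l; lra.
    - apply Rmult_le_compat_l. lra.
      replace (Cmod d * ((Cmod d' + 1) * Cmod h))%R with (Cmod h * (Cmod d * (Cmod d' + 1)))%R by ring.
      apply Rmult_le_compat; try lra. nra. unfold M. lra. }
  replace (eps / (2 * M) * M)%R with (eps / 2)%R in T3 by (field; lra).
  assert (T4 : (eps / (2 * A) * Cmod h * (Cmod (g z) + Cmod d' + 1) + eps / (2 * A) * Cmod h * Cmod (f z) <= eps / (2 * A) * Cmod h * A)%R).
  { rewrite <- Rmult_plus_distr_l. apply Rmult_le_compat_l. nra. unfold A. lra. }
  replace (eps / (2 * A) * Cmod h * A)%R with (eps / 2 * Cmod h)%R in T4 by (field; lra).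
  lra.
Qed.

Lemma cder_comp (f g : C -> C) (z d d' : C) :
  cder f (g z) d -> cder g z d' -> cder (fun x => f (g x)) z (d * d').
Proof.
  intros H H' eps He.
  destruct (cder_lip g z d' H') as [d0 [Hd0 K0]].
  pose proof (Cmod_ge_0 d). pose proof (Cmod_ge_0 d').
  assert (He1 : (0 < eps / (2 * (Cmod d' + 1)))%R) by (apply Rdiv_lt_0_compat; lra).
  assert (He2 : (0 < eps / (2 * (Cmod d + 1)))%R) by (apply Rdiv_lt_0_compat; lra).
  destruct (H _ He1) as [d1 [Hd1 K1]].
  destruct (H' _ He2) as [d2 [Hd2 K2]].
  assert (Hd3 : (0 < d1 / (Cmod d' + 1))%R) by (apply Rdiv_lt_0_compat; lra).
  exists (Rmin d0 (Rmin d2 (d1 / (Cmod d' + 1)))). split. repeat apply Rmin_pos; lra.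
  intros h Hh.
  rmin_facts.
  specialize (K0 h ltac:(lra)). specialize (K2 h ltac:(lra)).
  set (k := g (z + h)%C - g z) in *.
  assert (Hk : (Cmod k < d1)%R).
  { eapply Rle_lt_trans. apply K0. apply Rlt_le_trans with ((Cmod d' + 1) * (d1 / (Cmod d' + 1)))%R.
    apply Rmult_lt_compat_l; lra. right. field. lra. }
  specialize (K1 k Hk). replace (g z + k) with (g (z + h)%C) in K1 by (unfold k; ring).
  replace (f (g (z + h)%C) - f (g z) - d * d' * h) with
    ((f (g (z + h)%C) - f (g z) - d * k) + d * (k - d' * h)) by ring.
  eapply Rle_trans. apply Cmod_triangle. rewrite Cmod_mult.
  assert (T1 : (eps / (2 * (Cmod d' + 1)) * Cmod k <= eps / (2 * (Cmod d' + 1)) * ((Cmod d' + 1) * Cmod h))%R)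
    by (apply Rmult_le_compat_l; lra).
  replace (eps / (2 * (Cmod d' + 1)) * ((Cmod d' + 1) * Cmod h))%R with (eps / 2 * Cmod h)%R in T1 by (field; lra).
  pose proof (Cmod_ge_0 h).
  assert (T2 : (Cmod d * Cmod (k - d' * h) <= (Cmod d + 1) * (eps / (2 * (Cmod d + 1)) * Cmod h))%R).
  { apply Rmult_le_compat; try lra. apply Cmod_ge_0. }
  replace ((Cmod d + 1) * (eps / (2 * (Cmod d + 1)) * Cmod h))%R with (eps / 2 * Cmod h)%R in T2 by (field; lra).
  lra.
Qed.

Lemma cder_scal (c : C) (f : C -> C) (z d : C) : cder f z d -> cder (fun x => c * f x) z (c * d).
Proof.
  intros H. replace (c * d) with (0 * f z + c * d) by ring.
  apply (cder_mult (fun _ => c)). apply cder_const. exact H.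
Qed.

Lemma cder_pow (n : nat) (z : C) : cder (fun x => x ^ S n) z (INR (S n) * z ^ n).
Proof.
  induction n.
  - replace (INR 1 * z ^ 0) with (1 * z ^ 0 + z * 0) by (simpl; ring).
    apply (cder_mult (fun x => x) (fun x => x ^ 0)). apply cder_id. exact (cder_const 1 z).
  - replace (INR (S (S n)) * z ^ S n) with (1 * z ^ S n + z * (INR (S n) * z ^ n)).
    apply (cder_mult (fun x => x) (fun x => x ^ S n)). apply cder_id. exact IHn.
    rewrite (RtoC_INR_S (S n)). simpl. ring.
Qed.

Lemma cder_Csum (f : nat -> C -> C) (d : nat -> C) (z : C) (n : nat) :
  (forall i, (i < n)%nat -> cder (f i) z (d i)) ->
  cder (fun x => Csum_nat (fun i => f i x) n) z (Csum_nat d n).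
Proof.
  induction n; intros H; simpl. apply cder_const.
  apply (cder_plus (fun x => Csum_nat (fun i => f i x) n)). apply IHn. auto. apply H. lia.
Qed.

Lemma cder_unique (f : C -> C) (z d d' : C) : cder f z d -> cder f z d' -> d = d'.
Proof.
  intros H H'. apply Cmod_small_eq. intros eps He.
  destruct (H (eps / 2)%R ltac:(lra)) as [d1 [Hd1 K1]].
  destruct (H' (eps / 2)%R ltac:(lra)) as [d2 [Hd2 K2]].
  set (h := RtoC (Rmin d1 d2 / 2)). pose proof (Rmin_pos d1 d2 Hd1 Hd2).
  assert (Hh : Cmod h = (Rmin d1 d2 / 2)%R) by (unfold h; rewrite Cmod_R; apply Rabs_right; lra).
  rmin_facts.
  specialize (K1 h ltac:(lra)). specialize (K2 h ltac:(lra)).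
  apply Rmult_le_reg_r with (Cmod h). lra.
  rewrite <- Cmod_mult.
  replace ((d - d') * h) with ((f (z + h)%C - f z - d' * h) - (f (z + h)%C - f z - d * h)) by ring.
  eapply Rle_trans. apply Cmod_triangle_minus. lra.
Qed.

Lemma Sc_cder (rho B : R) (p : nat -> C) (f : C -> C) (z : C) :
  (0 < rho)%R -> Sc rho 2 B p (fun e => f (z + e)) -> f z = p O /\ cder f z (p 1%nat).
Proof.
  intros Hr [v [B1 [[w [B2 [Hw [HB2 Hv]]]] [HB1 Hf]]]].
  assert (Hf0 : f z = p O).
  { specialize (Hf 0). replace (z + 0) with z in Hf by ring. rewrite Hf. ring. rewrite Cmod_0. lra. }
  split. exact Hf0. intros eps He.
  assert (HB0 : (0 <= B2)%R) by (eapply Rle_trans; [apply (Cmod_ge_0 (w 0))| apply Hw; rewrite Cmod_0; lra]).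
  exists (Rmin rho (eps / (B2 + 1))). split. apply Rmin_pos. lra. apply Rdiv_lt_0_compat; lra.
  intros h Hh. rmin_facts.
  rewrite Hf, Hf0, Hv by lra.
  replace (p O + h * (p 1%nat + h * w h) - p O - p 1%nat * h) with (h * w h * h) by ring.
  rewrite !Cmod_mult. apply Rmult_le_compat_r. apply Cmod_ge_0.
  pose proof (Hw h ltac:(lra)). pose proof (Cmod_ge_0 h). pose proof (Cmod_ge_0 (w h)).
  apply Rle_trans with (eps / (B2 + 1) * (B2 + 1))%R. nra. right. field. lra.
Qed.

Lemma coef_series (rho : R) (K : nat) (b : nat -> R) (s : R) (p : nat -> nat -> C) (u : nat -> C -> C) :
  (0 < rho)%R -> (forall n, Sc rho K (b n) (p n) (u n)) -> summ b s ->
  exists P, forall j, (j < K)%nat -> cser (fun n => p n j) (P j).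
Proof.
  intros Hr Hp Hs.
  assert (HP : forall j, exists l, (j < K)%nat -> cser (fun n => p n j) l).
  { intros j. destruct (lt_dec j K) as [Hj|Hj]; [|exists 0; tauto].
    destruct (cser_dominated (fun n => p n j) (fun n => / rho ^ j * b n)%R (/ rho ^ j * s)%R) as [l [Hl _]].
    - intros n. pose proof (Sc_coef_bound rho K _ _ _ j (Rlt_le _ _ Hr) (Hp n) Hj).
      pose proof (pow_lt rho j Hr). apply Rmult_le_reg_r with (rho ^ j)%R. lra.
      replace (/ rho ^ j * b n * rho ^ j)%R with (b n) by (field; lra). exact H.
    - pose proof (Rinv_0_lt_compat _ (pow_lt rho j Hr)). destruct Hs as [Hs1 Hs2]. split.
      + intros n. specialize (Hs1 n). nra.
      + intros n. rewrite Rsum_scal. specialize (Hs2 n). nra.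
    - exists l. auto. }
  apply choice in HP. exact HP.
Qed.

(** The derivative is the coefficient of e in an expansion to order 2, and the coefficients of a
    dominated series add up to those of the sum. *)
Lemma cder_series (f : nat -> C -> C) (F : C -> C) (z : C) (d : nat -> C) (rho : R)
    (b : nat -> R) (s : R) :
  (0 < rho)%R -> (forall n, exists p, Sc rho 2 (b n) p (fun e => f n (z + e))) -> summ b s ->
  (forall n, cder (f n) z (d n)) ->
  (forall e, (Cmod e <= rho)%R -> cser (fun n => f n (z + e)) (F (z + e))) ->
  exists D, cser d D /\ cder F z D.
Proof.
  intros Hr Hp Hs Hd HF. apply choice in Hp. destruct Hp as [p Hp].
  destruct (coef_series rho 2 b s p (fun n e => f n (z + e)) Hr Hp Hs) as [P HP].
  assert (HS : Sc rho 2 s P (fun e => F (z + e))).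
  { apply (Sc_series rho 2 b p (fun n e => f n (z + e)) s P); auto. }
  destruct (Sc_cder rho s P F z Hr HS) as [_ HD].
  exists (P 1%nat). split; [|exact HD].
  apply (cser_ext (fun n => p n 1%nat)). 2: apply HP; lia.
  intros n. destruct (Sc_cder rho _ _ _ z Hr (Hp n)) as [_ Hn].
  apply (cder_unique (f n) z). exact Hn. apply Hd.
Qed.

(** On the segment from 0 to z the real functions g (f (t z)), with g the real or the imaginary
    part, have zero derivative because g is 1-Lipschitz. *)
Lemma cder_0_const (f : C -> C) : (forall z, cder f z 0) -> forall z, f z = f 0.
Proof.
  intros H z.
  assert (Hr : forall g : C -> R, (forall x y, (Rabs (g x - g y) <= Cmod (x - y))%R) ->
             g (f z) = g (f 0)).
  { intros g Hg.
    assert (Hd : forall t, derivable_pt_lim (fun t : R => g (f (RtoC t * z))) t 0).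
    { intros t eps He. destruct (H (RtoC t * z) (eps / (2 * (Cmod z + 1)))%R) as [del [Hdel Hd]].
      { apply Rdiv_lt_0_compat. exact He. pose proof (Cmod_ge_0 z). lra. }
      pose proof (Cmod_ge_0 z) as Hz.
      assert (Hd' : (0 < del / (Cmod z + 1))%R) by (apply Rdiv_lt_0_compat; lra).
      exists (mkposreal _ Hd'). intros h Hh0 Hh. simpl in Hh.
      specialize (Hd (RtoC h * z)). rewrite Cmod_mult, Cmod_R in Hd.
      assert (Hh' : (Rabs h * Cmod z < del)%R).
      { apply Rle_lt_trans with (Rabs h * (Cmod z + 1))%R. apply Rmult_le_compat_l. apply Rabs_pos. lra.
        apply Rlt_le_trans with (del / (Cmod z + 1) * (Cmod z + 1))%R.
        apply Rmult_lt_compat_r; lra. right. field. lra. }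
      specialize (Hd Hh').
      replace (f (t * z + h * z) - f (t * z) - 0 * (h * z)) with (f (t * z + h * z) - f (t * z)) in Hd by ring.
      replace (RtoC (t + h) * z) with (t * z + h * z) by (rewrite RtoC_plus; ring).
      specialize (Hg (f (t * z + h * z)) (f (t * z))).
      rewrite Rminus_0_r. unfold Rdiv. rewrite Rabs_mult, Rabs_inv.
      assert (Hah : (0 < Rabs h)%R) by (apply Rabs_pos_lt; exact Hh0).
      apply Rle_lt_trans with (eps / (2 * (Cmod z + 1)) * (Rabs h * Cmod z) * / Rabs h)%R.
      - apply Rmult_le_compat_r. left. apply Rinv_0_lt_compat. exact Hah. lra.
      - replace (eps / (2 * (Cmod z + 1)) * (Rabs h * Cmod z) * / Rabs h)%R with
          (eps / (2 * (Cmod z + 1)) * Cmod z)%R by (field; lra).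
        apply Rlt_le_trans with (eps / (2 * (Cmod z + 1)) * (2 * (Cmod z + 1)))%R.
        apply Rmult_lt_compat_l. apply Rdiv_lt_0_compat; lra. lra. right. field. lra. }
    pose (pr := fun t => exist (fun l => derivable_pt_abs (fun t : R => g (f (RtoC t * z))) t l) 0%R (Hd t) : derivable_pt (fun t : R => g (f (RtoC t * z))) t).
    assert (Hc : constant (fun t : R => g (f (RtoC t * z)))).
    { apply (null_derivative_1 _ pr). intros t. reflexivity. }
    specialize (Hc 1%R 0%R). cbv beta in Hc.
    replace (RtoC 1 * z) with z in Hc by ring. replace (RtoC 0 * z) with (RtoC 0) in Hc by ring. exact Hc. }
  pose proof (Hr Re (fun x y => re_le_Cmod (x - y))) as H1.
  pose proof (Hr Im (fun x y => im_le_Cmod (x - y))) as H2.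
  destruct (f z), (f 0). simpl in H1, H2. f_equal; assumption.
Qed.

(** * The complex exponential *)

Lemma Cexp_plus (a b : C) : Cexp (a + b) = Cexp a * Cexp b.
Proof.
  unfold Cexp. destruct a as [a1 a2], b as [b1 b2]. unfold Cplus, Cmult, Re, Im; simpl.
  rewrite exp_plus, cos_plus, sin_plus. f_equal; ring.
Qed.

Lemma Cexp_0 : Cexp 0 = 1.
Proof. unfold Cexp. simpl. rewrite exp_0, cos_0, sin_0. unfold RtoC. f_equal; ring. Qed.

Lemma Cexp_opp_l (a : C) : Cexp (- a) * Cexp a = 1.
Proof. rewrite <- Cexp_plus. replace (- a + a) with (RtoC 0) by ring. apply Cexp_0. Qed.

Lemma Cexp_neq_0 (a : C) : Cexp a <> 0.
Proof. intros H. pose proof (Cexp_opp_l a). rewrite H in H0. rewrite Cmult_0_r in H0.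
  apply (f_equal fst) in H0. simpl in H0. lra. Qed.

Lemma Cexp_opp (a : C) : Cexp (- a) = / Cexp a.
Proof.
  pose proof (Cexp_neq_0 a). pose proof (Cexp_opp_l a).
  replace (Cexp (- a)) with (Cexp (- a) * Cexp a * / Cexp a) by (field; exact H).
  rewrite H0. ring.
Qed.

Lemma Cmod_Cexp (a : C) : Cmod (Cexp a) = exp (Re a).
Proof.
  unfold Cmod, Cexp; simpl.
  replace (exp (Re a) * cos (Im a) * (exp (Re a) * cos (Im a) * 1) + exp (Re a) * sin (Im a) * (exp (Re a) * sin (Im a) * 1))%R
    with (exp (Re a) * exp (Re a) * (Rsqr (sin (Im a)) + Rsqr (cos (Im a))))%R by (unfold Rsqr; ring).
  rewrite sin2_cos2, Rmult_1_r. apply sqrt_square. left. apply exp_pos.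
Qed.

Lemma Cexp_RtoC (x : R) : Cexp x = exp x.
Proof. unfold Cexp, RtoC; simpl. rewrite cos_0, sin_0. f_equal; ring. Qed.

Lemma Cexp_cder_0 : cder Cexp 0 1.
Proof.
  intros eps He.
  (* The real part of the error is at most 3 e |h| and the imaginary part at most 4 e |h|, so eps /
     10 leaves room; e <= 1/2 keeps exp (Re h) below 2. *)
  set (e := Rmin (eps / 10) (/ 2)%R).
  assert (He0 : (0 < e)%R) by (apply Rmin_pos; lra).
  assert (He1 : (e <= eps / 10)%R) by apply Rmin_l.
  assert (He2 : (e <= / 2)%R) by apply Rmin_r.
  pose proof (derivable_pt_lim_exp 0) as Dexp. rewrite exp_0 in Dexp.
  pose proof (derivable_pt_lim_sin 0) as Dsin. rewrite cos_0 in Dsin.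
  pose proof (derivable_pt_lim_cos 0) as Dcos. rewrite sin_0, Ropp_0 in Dcos.
  assert (HD : forall f l, derivable_pt_lim f 0 l -> exists del, (0 < del)%R /\
             forall x, (Rabs x < del)%R -> (Rabs (f x - f 0%R - l * x) <= e * Rabs x)%R).
  { intros f l D. destruct (D e He0) as [del Hdel]. exists del. split. apply cond_pos.
    intros x Hx. destruct (Req_dec x 0) as [E|E].
    - subst x. replace (f 0%R - f 0%R - l * 0)%R with 0%R by ring. rewrite Rabs_R0. lra.
    - specialize (Hdel x E Hx). rewrite Rplus_0_l in Hdel.
      replace (f x - f 0%R - l * x)%R with (((f x - f 0%R) / x - l) * x)%R by (field; exact E).
      rewrite Rabs_mult. apply Rmult_le_compat_r. apply Rabs_pos. lra. }
  destruct (HD _ _ Dexp) as [d1 [Hd1 K1]].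
  destruct (HD _ _ Dsin) as [d2 [Hd2 K2]].
  destruct (HD _ _ Dcos) as [d3 [Hd3 K3]].
  exists (Rmin (Rmin d1 d2) (Rmin d3 e)). split. repeat apply Rmin_pos; lra.
  intros h Hh.
  rmin_facts.
  pose proof (re_le_Cmod h) as Hre. pose proof (im_le_Cmod h) as Him.
  specialize (K1 (Re h) ltac:(lra)). specialize (K2 (Im h) ltac:(lra)). specialize (K3 (Im h) ltac:(lra)).
  rewrite exp_0 in K1. rewrite sin_0 in K2. rewrite cos_0 in K3.
  replace (0 + h) with h by ring. rewrite Cexp_0.
  eapply Rle_trans. apply Cmod_le_re_im.
  replace (Re (Cexp h - 1 - 1 * h)) with ((exp (Re h) - 1 - 1 * Re h) + exp (Re h) * (cos (Im h) - 1 - 0 * Im h))%R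
    by (destruct h; unfold Cexp, Re, Im; simpl; ring).
  replace (Im (Cexp h - 1 - 1 * h)) with (exp (Re h) * (sin (Im h) - 0 - 1 * Im h) + Im h * ((exp (Re h) - 1 - 1 * Re h) + Re h))%R
    by (destruct h; unfold Cexp, Re, Im; simpl; ring).
  set (X := (exp (Re h) - 1 - 1 * Re h)%R) in *.
  set (Y := (cos (Im h) - 1 - 0 * Im h)%R) in *.
  set (W := (sin (Im h) - 0 - 1 * Im h)%R) in *.
  set (m := Cmod h) in *.
  assert (Hm : (0 <= m)%R) by apply Cmod_ge_0.
  pose proof (Rabs_pos (Re h)). pose proof (Rabs_pos (Im h)).
  assert (HX : (Rabs X <= e * m)%R) by (eapply Rle_trans; [exact K1|apply Rmult_le_compat_l; lra]).
  assert (HY : (Rabs Y <= e * m)%R) by (eapply Rle_trans; [exact K3|apply Rmult_le_compat_l; lra]).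
  assert (HW : (Rabs W <= e * m)%R) by (eapply Rle_trans; [exact K2|apply Rmult_le_compat_l; lra]).
  assert (HE : (exp (Re h) <= 2)%R).
  { assert (exp (Re h) = X + 1 + Re h)%R by (unfold X; ring).
    pose proof (RRle_abs X). pose proof (RRle_abs (Re h)). nra. }
  pose proof (exp_pos (Re h)).
  assert (T1 : (Rabs (X + exp (Re h) * Y) <= 3 * (e * m))%R).
  { eapply Rle_trans. apply Rabs_triang. rewrite Rabs_mult, (Rabs_right (exp (Re h))) by lra.
    pose proof (Rabs_pos Y). nra. }
  assert (T2 : (Rabs (exp (Re h) * W + Im h * (X + Re h)) <= 4 * (e * m))%R).
  { eapply Rle_trans. apply Rabs_triang. rewrite !Rabs_mult, (Rabs_right (exp (Re h))) by lra.
    pose proof (Rabs_triang X (Re h)). pose proof (Rabs_pos W). pose proof (Rabs_pos (X + Re h)).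
    assert (Rabs (X + Re h) <= 2 * m)%R by nra.
    assert (Rabs (Im h) <= e)%R by lra. nra. }
  nra.
Qed.

Lemma Cexp_cder (z : C) : cder Cexp z (Cexp z).
Proof.
  intros eps He.
  assert (Hz : (0 < Cmod (Cexp z))%R) by (apply Cmod_gt_0, Cexp_neq_0).
  destruct (Cexp_cder_0 (eps / Cmod (Cexp z))%R) as [del [Hdel H]]. apply Rdiv_lt_0_compat; lra.
  exists del. split. exact Hdel. intros h Hh. specialize (H h Hh).
  replace (0 + h) with h in H by ring. rewrite Cexp_0 in H. rewrite Cexp_plus.
  replace (Cexp z * Cexp h - Cexp z - Cexp z * h) with (Cexp z * (Cexp h - 1 - 1 * h)) by ring.
  rewrite Cmod_mult. eapply Rle_trans. apply Rmult_le_compat_l. lra. apply H. right. field. lra.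
Qed.

Lemma INR_fact_neq_0' (n : nat) : RtoC (INR (fact n)) <> 0.
Proof. intros H. apply RtoC_inj in H. exact (INR_fact_neq_0 n H). Qed.

Lemma Rsum_exp (x : R) (n : nat) : (0 <= x)%R -> (Rsum (fun j => x ^ j / INR (fact j))%R n <= exp x)%R.
Proof.
  intros Hx.
  assert (Hpos : forall j, (0 <= x ^ j / INR (fact j))%R).
  { intros j. apply Rdiv_le_0_compat. apply pow_le, Hx. apply INR_fact_lt_0. }
  destruct n. simpl. left. apply exp_pos.
  assert (H : Un_cv (fun m => sum_f_R0 (fun j => / INR (fact j) * x ^ j)%R m) (exp x)).
  { unfold exp. destruct (exist_exp x) as [l Hl]. simpl. exact Hl. }
  assert (E : forall m, Rsum (fun j => x ^ j / INR (fact j))%R (S m) = sum_f_R0 (fun j => / INR (fact j) * x ^ j)%R m).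
  { induction m. simpl. field. rewrite tech5, <- IHm. unfold Rdiv.
    rewrite (Rmult_comm (/ INR (fact (S m)))). reflexivity. }
  apply Rnot_lt_le. intros Hlt.
  destruct (H (Rsum (fun j => x ^ j / INR (fact j))%R (S n) - exp x)%R) as [n0 H0]. lra.
  specialize (H0 (n0 + n)%nat ltac:(lia)). rewrite <- E in H0. unfold Rdist in H0.
  pose proof (Rsum_mono _ (S n) (S (n0 + n)) Hpos ltac:(lia)).
  apply Rabs_def2 in H0. lra.
Qed.

Lemma summ_exp (x : R) : (0 <= x)%R -> summ (fun j => x ^ j / INR (fact j))%R (exp x).
Proof.
  intros Hx. split.
  - intros j. apply Rdiv_le_0_compat. apply pow_le, Hx. apply INR_fact_lt_0.
  - intros n. apply Rsum_exp, Hx.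
Qed.

Lemma Sc_pow (rho : R) (K j : nat) (B : R) (p : nat -> C) (u : C -> C) :
  (0 <= rho)%R -> Sc rho K B p u -> exists p', Sc rho K (B ^ j) p' (fun e => u e ^ j).
Proof.
  intros Hr H. induction j.
  - eexists. eapply Sc_ext. exact Hr. apply (Sc_const rho K 1 Hr). rewrite Cmod_1. simpl. lra.
    reflexivity. reflexivity.
  - destruct IHj as [p' H']. eexists. apply (Sc_mult rho K _ _ _ _ _ _ Hr H H').
Qed.

Lemma Sc_lin (rho : R) (K : nat) (z : C) : (0 <= rho)%R ->
  Sc rho K (Cmod z + rho) (fun j => match j with O => z | 1%nat => 1 | _ => 0 end) (fun e => z + e).
Proof.
  intros Hr. eapply Sc_ext. exact Hr. apply (Sc_plus rho K _ _ _ _ _ _ Hr (Sc_const rho K z Hr) (Sc_id rho K Hr)).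
  lra. intros [|[|j]] _; ring. reflexivity.
Qed.

Lemma cser_exp_ex (z : C) : exists l, cser (fun j => z ^ j / INR (fact j)) l.
Proof.
  destruct (cser_dominated (fun j => z ^ j / INR (fact j)) (fun j => Cmod z ^ j / INR (fact j))%R (exp (Cmod z))) as [l [Hl _]].
  - intros n. rewrite Cmod_div, Cmod_pow, Cmod_INR. lra. apply INR_fact_neq_0'.
  - apply summ_exp, Cmod_ge_0.
  - exists l. exact Hl.
Qed.

(** [Cexp] is built from the real exp, cos and sin, so its power series has to be recovered: the sum
    E satisfies E' = E, hence E(z) Cexp(-z) is constant, and it equals 1 at 0. *)
Lemma cser_exp (z : C) : cser (fun j => z ^ j / INR (fact j)) (Cexp z).
Proof.
  destruct (choice (fun z l => cser (fun j => z ^ j / INR (fact j)) l) cser_exp_ex) as [E HE].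
  assert (HD : forall z, cder E z (E z)).
  { intros w.
    destruct (cder_series (fun j x => x ^ j / INR (fact j)) E w
       (fun j => match j with O => 0 | S j' => w ^ j' / INR (fact j') end) 1
       (fun j => (Cmod w + 1) ^ j / INR (fact j))%R (exp (Cmod w + 1))) as [D [HD1 HD2]].
    - lra.
    - intros n. destruct (Sc_pow 1 2 n _ _ _ ltac:(lra) (Sc_lin 1 2 w ltac:(lra))) as [p' Hp'].
      eexists. eapply Sc_ext. 2: apply (Sc_scal 1 2 (/ INR (fact n)) _ _ _ ltac:(lra) Hp'). lra.
      rewrite Cmod_inv, Cmod_INR by apply INR_fact_neq_0'. right. unfold Rdiv. ring.
      reflexivity. intros e _. cbv beta. unfold Cdiv. ring.
    - apply summ_exp. pose proof (Cmod_ge_0 w). lra.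
    - intros [|n].
      + simpl. apply (cder_ext_loc (fun _ => 1)). exists 1%R. split. lra. intros. field. apply cder_const.
      + apply (cder_ext_loc (fun x => / INR (fact (S n)) * x ^ S n)).
        exists 1%R. split. lra. intros. unfold Cdiv. ring.
        replace (w ^ n / INR (fact n)) with (/ INR (fact (S n)) * (INR (S n) * w ^ n)).
        apply cder_scal, cder_pow.
        rewrite fact_simpl, mult_INR, RtoC_mult. field. split. apply INR_fact_neq_0'.
        apply RtoC_neq, not_0_INR. lia.
    - intros e _. apply HE.
    - replace (E w) with D. exact HD2. apply (cser_unique (fun j => w ^ j / INR (fact j))). 2: apply HE.
      apply (cser_incr_1 (fun j => match j with O => 0 | S j' => w ^ j' / INR (fact j') end) D).
      replace (0 + D) with D by ring. exact HD1. }
  assert (HG : forall z, cder (fun x => E x * Cexp (- (1) * x)) z 0).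
  { intros w. replace (RtoC 0) with (E w * Cexp (- (1) * w) + E w * (Cexp (- (1) * w) * (- (1) * 1))) by ring.
    apply (cder_mult E (fun x => Cexp (- (1) * x))). apply HD. apply (cder_comp Cexp (fun x => - (1) * x)). apply Cexp_cder.
    apply (cder_scal (- (1)) (fun x => x)), cder_id. }
  pose proof (cder_0_const _ HG z) as H. cbv beta in H.
  assert (HE0 : E 0 = 1).
  { apply (cser_unique (fun j => 0 ^ j / INR (fact j))). apply HE.
    replace (RtoC 1) with (0 ^ 0 / INR (fact 0) + 0) by (simpl; field).
    apply (cser_incr_1 (fun j => 0 ^ j / INR (fact j))).
    apply (cser_ext (fun _ => 0)). intros n. simpl. unfold Cdiv. ring. apply cser_0. }
  rewrite HE0 in H. replace (- (1) * 0) with (RtoC 0) in H by ring. rewrite Cexp_0 in H.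
  replace (- (1) * z) with (- z) in H by ring. rewrite Cexp_opp in H.
  replace (Cexp z) with (E z). apply HE.
  pose proof (Cexp_neq_0 z).
  replace (E z) with (E z * / Cexp z * Cexp z) by (field; auto). rewrite H. ring.
Qed.

Lemma Sc_series_ex (rho : R) (K : nat) (b : nat -> R) (u : nat -> C -> C) (s : R) (U : C -> C) :
  (0 < rho)%R -> (forall n, exists p, Sc rho K (b n) p (u n)) -> summ b s ->
  (forall e, (Cmod e <= rho)%R -> cser (fun n => u n e) (U e)) ->
  exists P, Sc rho K s P U.
Proof.
  intros Hr Hp Hs HU. apply choice in Hp. destruct Hp as [p Hp].
  destruct (coef_series rho K b s p u Hr Hp Hs) as [P HP].
  exists P. apply (Sc_series rho K b p u s P U); auto.
Qed.

(** The quotient v is the sum of u^j / (j+2)!, dominated by the exponential series of [B]. The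
    explicit second-order remainder is what shows the cancellation in [gauss_incr]. *)
Lemma Sc_exp_quot (rho : R) (K : nat) (B : R) (p : nat -> C) (u : C -> C) :
  (0 < rho)%R -> Sc rho K B p u ->
  exists p' v, Sc rho K (exp B) p' v /\
    forall e, (Cmod e <= rho)%R -> Cexp (u e) = 1 + u e + u e * u e * v e.
Proof.
  intros Hr H.
  pose proof (Sc_nonneg _ _ _ _ _ (Rlt_le _ _ Hr) H) as HB.
  assert (Hle : forall n, (0 < INR (fact n) <= INR (fact (S (S n))))%R).
  { intros n. split. apply INR_fact_lt_0. apply le_INR. apply fact_le. lia. }
  assert (Hex : forall e, exists l, (Cmod e <= rho)%R -> cser (fun j => u e ^ j / INR (fact (S (S j)))) l).
  { intros e. destruct (Rle_dec (Cmod e) rho) as [He|He]; [|exists 0; tauto].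
    destruct (cser_dominated (fun j => u e ^ j / INR (fact (S (S j)))) (fun j => B ^ j / INR (fact j))%R (exp B)) as [l [Hl _]].
    - intros n. rewrite Cmod_div, Cmod_pow, Cmod_INR by apply INR_fact_neq_0'.
      specialize (Hle n). unfold Rdiv. apply Rmult_le_compat. apply pow_le, Cmod_ge_0.
      left; apply Rinv_0_lt_compat; lra. apply pow_incr. split. apply Cmod_ge_0.
      apply (Sc_bound _ _ _ _ _ (Rlt_le _ _ Hr) H e He). apply Rinv_le_contravar; lra.
    - apply summ_exp, HB.
    - exists l. auto. }
  apply choice in Hex. destruct Hex as [v Hv].
  destruct (Sc_series_ex rho K (fun j => B ^ j / INR (fact j))%R (fun j e => u e ^ j / INR (fact (S (S j)))) (exp B) v) as [P HP].
  - exact Hr.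
  - intros j. destruct (Sc_pow rho K j _ _ _ (Rlt_le _ _ Hr) H) as [p' Hp'].
    eexists. eapply Sc_ext. 2: apply (Sc_scal rho K (/ INR (fact (S (S j)))) _ _ _ (Rlt_le _ _ Hr) Hp'). lra.
    rewrite Cmod_inv, Cmod_INR by apply INR_fact_neq_0'. rewrite Rmult_comm. unfold Rdiv.
    apply Rmult_le_compat_l. apply pow_le, HB. specialize (Hle j). apply Rinv_le_contravar; lra.
    reflexivity. intros e _. cbv beta. unfold Cdiv. ring.
  - apply summ_exp, HB.
  - exact Hv.
  - exists P, v. split. exact HP. intros e He.
    apply (cser_unique (fun j => u e ^ j / INR (fact j))). apply cser_exp.
    replace (1 + u e + u e * u e * v e) with (u e ^ 0 / INR (fact 0) + (u e ^ 1 / INR (fact 1) + u e * u e * v e)).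
    2: { simpl. field. }
    apply (cser_incr_1 (fun j => u e ^ j / INR (fact j))).
    apply (cser_incr_1 (fun j => u e ^ S j / INR (fact (S j)))).
    apply (cser_ext (fun j => u e * u e * (u e ^ j / INR (fact (S (S j)))))).
    + intros j. rewrite !Cpow_S. unfold Cdiv. ring.
    + apply cser_scal, Hv, He.
Qed.

Lemma Sc_exp (rho : R) (K : nat) (B : R) (p : nat -> C) (u : C -> C) :
  (0 < rho)%R -> Sc rho K B p u -> exists p', Sc rho K (exp B) p' (fun e => Cexp (u e)).
Proof.
  intros Hr H.
  pose proof (Sc_nonneg _ _ _ _ _ (Rlt_le _ _ Hr) H) as HB.
  apply (Sc_series_ex rho K (fun j => B ^ j / INR (fact j))%R (fun j e => u e ^ j / INR (fact j))).
  - exact Hr.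
  - intros j. destruct (Sc_pow rho K j _ _ _ (Rlt_le _ _ Hr) H) as [p' Hp'].
    eexists. eapply Sc_ext. 2: apply (Sc_scal rho K (/ INR (fact j)) _ _ _ (Rlt_le _ _ Hr) Hp'). lra.
    rewrite Cmod_inv, Cmod_INR by apply INR_fact_neq_0'. right. unfold Rdiv. ring.
    reflexivity. intros e _. cbv beta. unfold Cdiv. ring.
  - apply summ_exp, HB.
  - intros e _. apply cser_exp.
Qed.

(** * The reciprocal Gamma function *)

Definition gauss (n : nat) (z : C) : C :=
  Cprod_nat (fun i => z + INR i) (S (S n)) /
    (INR (fact (S n)) * Cexp (z * ln (INR (S n)))).

Definition gauss_log (n : nat) : R := (ln (INR (S n)) - ln (INR (S (S n))))%R.

(** This is [gauss (S n) z / gauss n z - 1] where the quotient makes sense. The first-order terms z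
    / (n+2) and z log((n+1)/(n+2)) nearly cancel, leaving O(1/n^2). *)
Definition gauss_incr (n : nat) (z : C) : C :=
  (1 + z * (/ INR (S (S n)))%R) * Cexp (z * gauss_log n) - 1.

(** Equal to 1 / ((n+1)(n+2)): a majorant of order 1/n^2 whose sum telescopes to at most 1. *)
Definition tele (n : nat) : R := (/ INR (S n) - / INR (S (S n)))%R.

Lemma INR_S_pos (n : nat) : (0 < INR (S n))%R.
Proof. apply lt_0_INR. lia. Qed.

Lemma RtoC_INR_S_neq_0 (n : nat) : RtoC (INR (S n)) <> 0.
Proof. apply RtoC_neq. pose proof (INR_S_pos n). lra. Qed.

Lemma exp_le_mono (x y : R) : (x <= y)%R -> (exp x <= exp y)%R.
Proof. intros [H|H]. left. now apply exp_increasing. subst. lra. Qed.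

Lemma gauss_S (n : nat) (z : C) : gauss (S n) z = gauss n z * (1 + gauss_incr n z).
Proof.
  unfold gauss, gauss_incr, gauss_log.
  change (Cprod_nat (fun i : nat => z + INR i) (S (S (S n)))) with
    (Cprod_nat (fun i : nat => z + INR i) (S (S n)) * (z + INR (S (S n)))).
  rewrite (fact_simpl (S n)), mult_INR, RtoC_mult, RtoC_minus.
  replace (z * (ln (INR (S n)) - ln (INR (S (S n))))) with
    (z * ln (INR (S n)) + - (z * ln (INR (S (S n))))) by ring.
  rewrite Cexp_plus, Cexp_opp, RtoC_inv by (apply not_0_INR; lia). field.
  repeat split; try apply Cexp_neq_0; try apply INR_fact_neq_0'; apply RtoC_INR_S_neq_0.
Qed.

Lemma tele_pos (n : nat) : (0 <= tele n)%R.
Proof.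
  unfold tele. pose proof (INR_S_pos n). rewrite (S_INR (S n)).
  assert (/ (INR (S n) + 1) <= / INR (S n))%R by (apply Rinv_le_contravar; lra). lra.
Qed.

Lemma Rsum_tele (n : nat) : Rsum tele n = (1 - / INR (S n))%R.
Proof. induction n. simpl. field. change (Rsum tele n + tele n = 1 - / INR (S (S n)))%R. rewrite IHn. unfold tele. ring. Qed.

Lemma ln_le_minus_1 (y : R) : (0 < y)%R -> (ln y <= y - 1)%R.
Proof.
  intros Hy. destruct (Req_dec y 1) as [E|E].
  - subst. rewrite ln_1. lra.
  - assert (Hl : ln y <> 0%R) by (intros H; apply E; rewrite <- (exp_ln y Hy), H; apply exp_0).
    pose proof (exp_ineq1 (ln y) Hl). rewrite exp_ln in H by exact Hy. lra.
Qed.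

Lemma gauss_log_bounds (n : nat) :
  (- / INR (S n) <= gauss_log n <= - / INR (S (S n)))%R.
Proof.
  unfold gauss_log. pose proof (INR_S_pos n). pose proof (INR_S_pos (S n)).
  pose proof (ln_le_minus_1 (INR (S n) / INR (S (S n))) ltac:(apply Rdiv_lt_0_compat; lra)) as A1.
  pose proof (ln_le_minus_1 (INR (S (S n)) / INR (S n)) ltac:(apply Rdiv_lt_0_compat; lra)) as A2.
  unfold Rdiv in A1, A2.
  rewrite ln_mult, ln_Rinv in A1 by (try apply Rinv_0_lt_compat; lra).
  rewrite ln_mult, ln_Rinv in A2 by (try apply Rinv_0_lt_compat; lra).
  assert (E1 : (INR (S n) * / INR (S (S n)) - 1 = - / INR (S (S n)))%R) by (rewrite (S_INR (S n)) in *; field; lra).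
  assert (E2 : (INR (S (S n)) * / INR (S n) - 1 = / INR (S n))%R) by (rewrite (S_INR (S n)) in *; field; lra).
  lra.
Qed.

Lemma gauss_log_small (n : nat) :
  (Rabs (gauss_log n) <= 1)%R /\ (Rabs (gauss_log n + / INR (S (S n))) <= tele n)%R /\
  (Rabs (gauss_log n) * / INR (S (S n)) <= tele n)%R /\
  (Rabs (gauss_log n) * Rabs (gauss_log n) <= 2 * tele n)%R.
Proof.
  pose proof (gauss_log_bounds n) as [H1 H2].
  pose proof (INR_S_pos n) as P1. pose proof (INR_S_pos (S n)) as P2.
  assert (I2 : (0 < / INR (S (S n)))%R) by (apply Rinv_0_lt_compat; lra).
  assert (I1 : (0 < / INR (S n) <= 1)%R).
  { split. apply Rinv_0_lt_compat; lra. rewrite <- Rinv_1. apply Rinv_le_contravar. lra.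
    rewrite S_INR. pose proof (pos_INR n). lra. }
  assert (E : tele n = (/ INR (S n) * / INR (S (S n)))%R).
  { unfold tele. rewrite (S_INR (S n)) in *. field. lra. }
  assert (H3 : (/ INR (S n) <= 2 * / INR (S (S n)))%R).
  { apply Rmult_le_reg_l with (INR (S n) * INR (S (S n)))%R. nra.
    replace (INR (S n) * INR (S (S n)) * / INR (S n))%R with (INR (S (S n))) by (field; lra).
    replace (INR (S n) * INR (S (S n)) * (2 * / INR (S (S n))))%R with (2 * INR (S n))%R by (field; lra).
    rewrite !S_INR. pose proof (pos_INR n). lra. }
  rewrite (Rabs_left1 (gauss_log n)) by lra.
  split; [lra|]. split; [|split].
  - unfold tele. rewrite Rabs_left1 by lra. lra.
  - rewrite E. apply Rmult_le_compat_r; lra.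
  - rewrite E. apply Rle_trans with (/ INR (S n) * / INR (S n))%R. apply Rmult_le_compat; lra. nra.
Qed.

(** With x = 1/(n+2), l = [gauss_log n] and e^(lz) = 1 + lz + (lz)^2 v, the increment equals (l+x) z
    + l x z^2 + l^2 (1+xz) z^2 v. The three summands here bound these terms in units of [tele n],
    for z of norm [B]; the 2 comes from l^2 <= 2 [tele n]. *)
Definition gauss_const (B : R) : R := (B + B * B + 2 * ((1 + B) * (B * B) * exp B))%R.

Lemma gauss_const_pos (B : R) : (0 <= B)%R -> (0 <= gauss_const B)%R.
Proof. intros H. unfold gauss_const. pose proof (exp_pos B). assert (0 <= (1 + B) * (B * B) * exp B)%R by (repeat apply Rmult_le_pos; lra). nra. Qed.

Lemma Sc_gauss_incr (rho : R) (K : nat) (z : C) (n : nat) : (0 < rho)%R ->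
  exists p, Sc rho K (gauss_const (Cmod z + rho) * tele n) p (fun e => gauss_incr n (z + e)).
Proof.
  intros Hr. set (B := (Cmod z + rho)%R).
  assert (HB : (0 <= B)%R) by (unfold B; pose proof (Cmod_ge_0 z); lra).
  pose proof (Sc_lin rho K z (Rlt_le _ _ Hr)) as Hz. fold B in Hz.
  destruct (gauss_log_small n) as [L1 [L2 [L3 L4]]].
  set (l := gauss_log n) in *. set (x := (/ INR (S (S n)))%R) in *.
  assert (Hx : (0 <= x <= 1)%R).
  { unfold x. split. left; apply Rinv_0_lt_compat, INR_S_pos. rewrite <- Rinv_1. apply Rinv_le_contravar. lra.
    rewrite !S_INR. pose proof (pos_INR n). lra. }
  pose proof (tele_pos n) as Ht.
  assert (Hr' := Rlt_le _ _ Hr).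
  pose proof (Sc_scal rho K l _ _ _ Hr' Hz) as Hlz. rewrite Cmod_R in Hlz.
  assert (Hlz' := Sc_le _ _ _ B _ _ Hr' Hlz ltac:(pose proof (Rabs_pos l); nra)).
  destruct (Sc_exp_quot rho K B _ _ Hr Hlz') as [p' [v [Hv Hexp]]].
  pose proof (Sc_mult rho K _ _ _ _ _ _ Hr' Hz Hz) as Hzz.
  pose proof (Sc_plus rho K _ _ _ _ _ _ Hr' (Sc_const rho K 1 Hr') (Sc_scal rho K x _ _ _ Hr' Hz)) as Hxz.
  pose proof (Sc_mult rho K _ _ _ _ _ _ Hr' (Sc_mult rho K _ _ _ _ _ _ Hr' Hxz Hzz) Hv) as Hrem.
  eexists. eapply Sc_ext. exact Hr'.
  - apply (Sc_plus rho K _ _ _ _ _ _ Hr'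
      (Sc_plus rho K _ _ _ _ _ _ Hr' (Sc_scal rho K (l + x) _ _ _ Hr' Hz)
        (Sc_scal rho K (l * x) _ _ _ Hr' Hzz)) (Sc_scal rho K (l * l) _ _ _ Hr' Hrem)).
  - rewrite <- RtoC_plus, <- !RtoC_mult, !Cmod_R, !Rabs_mult, Rabs_R1.
    rewrite (Rabs_right x) by lra.
    unfold gauss_const.
    replace ((B + B * B + 2 * ((1 + B) * (B * B) * exp B)) * tele n)%R with
      (tele n * B + tele n * (B * B) + 2 * tele n * ((1 + B) * (B * B) * exp B))%R by ring.
    apply Rplus_le_compat. apply Rplus_le_compat.
    + apply Rmult_le_compat_r; assumption.
    + apply Rmult_le_compat_r. apply Rmult_le_pos; lra. exact L3.
    + pose proof (exp_pos B). assert (0 <= x * B <= B)%R by nra. pose proof (Rabs_pos l).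
      apply Rmult_le_compat.
      apply Rmult_le_pos; lra. repeat apply Rmult_le_pos; lra. exact L4.
      apply Rmult_le_compat_r. lra. apply Rmult_le_compat_r. apply Rmult_le_pos; lra. lra.
  - reflexivity.
  - intros e He. unfold gauss_incr. fold l x.
    specialize (Hexp e He). cbv beta in Hexp. rewrite (Cmult_comm (z + e) l), Hexp. ring.
Qed.

Lemma gauss_0 (z : C) : gauss 0 z = z * (z + 1).
Proof.
  unfold gauss. simpl. rewrite ln_1. replace (z * 0) with (RtoC 0) by ring. rewrite Cexp_0. field.
Qed.

(** Uniform in [n]: the initial factor z (z + 1) has norm at most B (B + 1), and the product of the
    factors 1 + A [tele m] is at most exp of A times a sum bounded by 1. *)
Lemma Sc_gauss (rho : R) (K : nat) (z : C) (n : nat) : (0 < rho)%R ->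
  exists p, Sc rho K ((Cmod z + rho) * (Cmod z + rho + 1) * exp (gauss_const (Cmod z + rho))) p
    (fun e => gauss n (z + e)).
Proof.
  intros Hr. assert (Hr' := Rlt_le _ _ Hr).
  set (B := (Cmod z + rho)%R). assert (HB : (0 <= B)%R) by (unfold B; pose proof (Cmod_ge_0 z); lra).
  pose proof (gauss_const_pos B HB) as HA.
  assert (H : exists p, Sc rho K (B * (B + 1) * exp (gauss_const B * Rsum tele n)) p (fun e => gauss n (z + e))).
  { induction n.
    - pose proof (Sc_lin rho K z Hr') as Hz. fold B in Hz.
      eexists. eapply Sc_ext. exact Hr'.
      apply (Sc_mult rho K _ _ _ _ _ _ Hr' Hz (Sc_plus rho K _ _ _ _ _ _ Hr' Hz (Sc_const rho K 1 Hr'))).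
      rewrite Cmod_1. simpl. rewrite Rmult_0_r, exp_0. lra. reflexivity.
      intros e _. cbv beta. rewrite gauss_0. ring.
    - destruct IHn as [p Hp]. destruct (Sc_gauss_incr rho K z n Hr) as [p' Hp']. fold B in Hp'.
      eexists. eapply Sc_ext. exact Hr'.
      apply (Sc_mult rho K _ _ _ _ _ _ Hr' Hp (Sc_plus rho K _ _ _ _ _ _ Hr' (Sc_const rho K 1 Hr') Hp')).
      2: reflexivity. 2: intros e _; rewrite gauss_S; reflexivity.
      rewrite Cmod_1. simpl. rewrite (Rmult_plus_distr_l (gauss_const B)), exp_plus, <- Rmult_assoc.
      apply Rmult_le_compat_l. pose proof (exp_pos (gauss_const B * Rsum tele n)). repeat apply Rmult_le_pos; lra.
      pose proof (tele_pos n).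
      destruct (Req_dec (gauss_const B * tele n) 0) as [E|E].
      rewrite E, exp_0; lra. left. apply exp_ineq1, E. }
  destruct H as [p Hp]. exists p. eapply Sc_le. exact Hr'. exact Hp.
  apply Rmult_le_compat_l. nra. apply exp_le_mono. rewrite Rsum_tele.
  assert (0 < / INR (S n))%R by apply Rinv_0_lt_compat, INR_S_pos. nra.
Qed.

(** Rewrites the infinite product as a series, the form to which [Sc_series_ex] applies. *)
Lemma gauss_Csum (n : nat) (z : C) :
  gauss n z = gauss 0 z + Csum_nat (fun m => gauss m z * gauss_incr m z) n.
Proof. induction n; simpl Csum_nat. ring. rewrite gauss_S, IHn at 1. rewrite Cplus_assoc, <- IHn. ring. Qed.

Definition gauss_bound (B : R) : R := (B * (B + 1) * exp (gauss_const B))%R.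

Lemma Sc_gauss_term (rho : R) (K : nat) (z : C) (n : nat) : (0 < rho)%R ->
  exists p, Sc rho K (gauss_bound (Cmod z + rho) * gauss_const (Cmod z + rho) * tele n) p
    (fun e => gauss n (z + e) * gauss_incr n (z + e)).
Proof.
  intros Hr. assert (Hr' := Rlt_le _ _ Hr).
  destruct (Sc_gauss rho K z n Hr) as [p Hp]. destruct (Sc_gauss_incr rho K z n Hr) as [p' Hp'].
  eexists. eapply Sc_ext. exact Hr'. apply (Sc_mult rho K _ _ _ _ _ _ Hr' Hp Hp').
  right. unfold gauss_bound. ring. reflexivity. reflexivity.
Qed.

Lemma summ_tele (A : R) : (0 <= A)%R -> summ (fun n => A * tele n)%R A.
Proof.
  intros HA. split. intros n. pose proof (tele_pos n). nra.
  intros n. rewrite Rsum_scal, Rsum_tele. assert (0 < / INR (S n))%R by apply Rinv_0_lt_compat, INR_S_pos. nra.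
Qed.

Lemma gauss_bound_pos (B : R) : (0 <= B)%R -> (0 <= gauss_bound B)%R.
Proof. intros H. unfold gauss_bound. pose proof (exp_pos (gauss_const B)). repeat apply Rmult_le_pos; lra. Qed.

Lemma rGamma_series (z : C) :
  cser (fun m => gauss m z * gauss_incr m z) (rGamma z - gauss 0 z) /\
  Cconv (fun n => gauss n z) (rGamma z).
Proof.
  set (B := (Cmod z + 1)%R). assert (HB : (0 <= B)%R) by (unfold B; pose proof (Cmod_ge_0 z); lra).
  destruct (cser_dominated (fun m => gauss m z * gauss_incr m z)
     (fun m => gauss_bound B * gauss_const B * tele m)%R (gauss_bound B * gauss_const B)%R) as [l [Hl _]].
  - intros n. destruct (Sc_gauss_term 1 0 z n ltac:(lra)) as [p Hp].
    specialize (Hp 0). cbv beta in Hp. replace (z + 0) with z in Hp by ring. apply Hp. rewrite Cmod_0. lra.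
  - apply summ_tele, Rmult_le_pos. apply gauss_bound_pos, HB. apply gauss_const_pos, HB.
  - assert (Hc : Cconv (fun n => gauss n z) (gauss 0 z + l)).
    { eapply Cconv_ext. intros n. symmetry. apply gauss_Csum.
      apply (Cconv_plus (fun _ => gauss 0 z)). apply Cconv_const. exact Hl. }
    assert (E : rGamma z = gauss 0 z + l) by (apply (Clim_seq_unique _ _ Hc)).
    rewrite E. split. replace (gauss 0 z + l - gauss 0 z) with l by ring. exact Hl. exact Hc.
Qed.

Lemma rGamma_conv (z : C) : Cconv (fun n => gauss n z) (rGamma z).
Proof. apply rGamma_series. Qed.

Lemma Sc_rGamma (K : nat) (z : C) : exists B p, Sc 1 K B p (fun e => rGamma (z + e)).
Proof.
  set (B := (Cmod z + 1)%R). assert (HB : (0 <= B)%R) by (unfold B; pose proof (Cmod_ge_0 z); lra).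
  destruct (Sc_gauss 1 K z 0 ltac:(lra)) as [p0 Hp0].
  destruct (Sc_series_ex 1 K (fun m => gauss_bound B * gauss_const B * tele m)%R
     (fun m e => gauss m (z + e) * gauss_incr m (z + e)) (gauss_bound B * gauss_const B)%R
     (fun e => rGamma (z + e) - gauss 0 (z + e))) as [P HP].
  - lra.
  - intros n. apply (Sc_gauss_term 1 K z n). lra.
  - apply summ_tele, Rmult_le_pos. apply gauss_bound_pos, HB. apply gauss_const_pos, HB.
  - intros e _. apply rGamma_series.
  - eexists. eexists. eapply Sc_ext. 2: apply (Sc_plus 1 K _ _ _ _ _ _ ltac:(lra) HP Hp0). lra.
    apply Rle_refl. reflexivity. intros e _. cbv beta. ring.
Qed.

Lemma Cconv_inv_INR : Cconv (fun n => (/ INR (S n))%R) 0.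
Proof.
  intros eps He.
  destruct (archimed_cor1 eps He) as [n0 [H0 H1]]. exists n0. intros n Hn.
  replace ((/ INR (S n))%R - 0) with (RtoC (/ INR (S n))) by ring.
  rewrite Cmod_R, Rabs_right.
  - eapply Rle_lt_trans. 2: exact H0. apply Rinv_le_contravar. apply lt_0_INR; lia. apply le_INR; lia.
  - apply Rle_ge; left; apply Rinv_0_lt_compat, INR_S_pos.
Qed.

(** The functional equation already holds for Gauss' products up to the factor 1 + (z + 1)/(n + 1),
    which tends to 1. *)
Lemma rGamma_S (z : C) : rGamma z = z * rGamma (z + 1).
Proof.
  apply (Cconv_unique (fun n => z * gauss n (z + 1))).
  2: apply Cconv_scal, rGamma_conv.
  assert (E : forall n, gauss n z * (1 + (z + 1) * (/ INR (S n))%R) = z * gauss n (z + 1)).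
  { intros n. unfold gauss.
    replace ((z + 1) * ln (INR (S n))) with (z * ln (INR (S n)) + ln (INR (S n))) by ring.
    rewrite Cexp_plus, Cexp_RtoC, exp_ln, RtoC_inv by (apply INR_S_pos || (apply not_0_INR; lia)).
    assert (P : forall m, Cprod_nat (fun i => z + INR i) m * (z + INR m) = z * Cprod_nat (fun i => z + 1 + INR i) m).
    { induction m. simpl. ring. simpl Cprod_nat. rewrite (RtoC_INR_S m).
      transitivity ((Cprod_nat (fun i => z + INR i) m * (z + INR m)) * (z + (INR m + 1))). ring.
      rewrite IHm. ring. }
    specialize (P (S (S n))). rewrite (RtoC_INR_S (S n)) in P.
    set (X := Cprod_nat (fun i => z + INR i) (S (S n))) in *.
    set (Y := Cprod_nat (fun i => z + 1 + INR i) (S (S n))) in *.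
    assert (HE := Cexp_neq_0 (z * ln (INR (S n)))). assert (HF := INR_fact_neq_0' (S n)). assert (HN := RtoC_INR_S_neq_0 n).
    transitivity (X * (z + (INR (S n) + 1)) / (INR (fact (S n)) * (Cexp (z * ln (INR (S n))) * INR (S n)))).
    field. auto. rewrite P. field. auto. }
  apply (Cconv_ext _ _ _ E).
  replace (rGamma z) with (rGamma z * (1 + (z + 1) * 0)) by ring.
  apply Cconv_mult. apply rGamma_conv.
  apply (Cconv_plus (fun _ => 1)). apply Cconv_const.
  apply Cconv_scal, Cconv_inv_INR.
Qed.

Lemma rGamma_1 : rGamma 1 = 1.
Proof.
  apply (Cconv_unique (fun n => gauss n 1)). apply rGamma_conv.
  assert (E : forall n, 1 + (/ INR (S n))%R = gauss n 1).
  { intros n. unfold gauss. replace (1 * ln (INR (S n))) with (RtoC (ln (INR (S n)))) by ring.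
    rewrite Cexp_RtoC, exp_ln, RtoC_inv by (apply INR_S_pos || (apply not_0_INR; lia)).
    assert (P : forall m, Cprod_nat (fun i => 1 + INR i) m = INR (fact m)).
    { induction m. reflexivity. simpl Cprod_nat. rewrite IHm, fact_simpl, mult_INR, RtoC_mult, RtoC_INR_S. ring. }
    rewrite P, (fact_simpl (S n)), mult_INR, RtoC_mult, (RtoC_INR_S (S n)).
    assert (HF := INR_fact_neq_0' (S n)). assert (HN := RtoC_INR_S_neq_0 n). field. auto. }
  apply (Cconv_ext _ _ _ E).
  assert (H := Cconv_plus _ _ _ _ (Cconv_const 1) Cconv_inv_INR).
  replace (1 + 0) with (RtoC 1) in H by ring. exact H.
Qed.

(** No finite product vanishes, and from an index n0 with A/(n0 + 1) <= 1/2 on the remaining factors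
    cannot reduce the modulus below half of its value at n0. *)
Lemma rGamma_neq_0 (z : C) : (forall n : nat, z <> - INR n) -> rGamma z <> 0.
Proof.
  intros Hz. set (B := (Cmod z + 1)%R). assert (HB : (0 <= B)%R) by (unfold B; pose proof (Cmod_ge_0 z); lra).
  set (A := gauss_const B). assert (HA : (0 <= A)%R) by (apply gauss_const_pos, HB).
  assert (Hi : forall n, (Cmod (gauss_incr n z) <= A * tele n)%R).
  { intros n. destruct (Sc_gauss_incr 1 0 z n ltac:(lra)) as [p Hp].
    specialize (Hp 0). cbv beta in Hp. replace (z + 0) with z in Hp by ring. apply Hp. rewrite Cmod_0. lra. }
  assert (Hg : forall n, gauss n z <> 0).
  { intros n. unfold gauss. unfold Cdiv. apply Cmult_neq_0.
    - generalize (S (S n)). intros m. induction m; simpl. apply RtoC_neq; lra. apply Cmult_neq_0. exact IHm.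
      intros H. apply (Hz m). replace z with (z + INR m - INR m) by ring. rewrite H. ring.
    - apply Cmod_gt_0. rewrite Cmod_inv. apply Rinv_0_lt_compat. apply Cmod_gt_0.
      all: apply Cmult_neq_0; [apply INR_fact_neq_0' | apply Cexp_neq_0]. }
  destruct (archimed_cor1 (/ (2 * (A + 1)))) as [n0 [H0 H1]]. apply Rinv_0_lt_compat; lra.
  assert (Hn0 : (A * / INR (S n0) <= / 2)%R).
  { apply Rle_trans with ((A + 1) * / (2 * (A + 1)))%R. 2: right; field; lra.
    apply Rmult_le_compat. exact HA. left; apply Rinv_0_lt_compat, INR_S_pos. lra.
    apply Rle_trans with (/ INR n0)%R. 2: lra. apply Rinv_le_contravar. apply lt_0_INR; lia. apply le_INR; lia. }
  (* Induction through (1 - x)(1 - y) >= 1 - x - y for x, y >= 0; the subtracted terms A [tele m]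
     telescope. *)
  assert (Hlow : forall n, (n0 <= n)%nat -> (Cmod (gauss n0 z) * (1 - A * (/ INR (S n0) - / INR (S n))) <= Cmod (gauss n z))%R).
  { intros n Hn. induction Hn.
    - right. ring.
    - rewrite gauss_S, Cmod_mult. specialize (Hi m).
      assert (Hm : (1 - A * tele m <= Cmod (1 + gauss_incr m z))%R).
      { pose proof (Cmod_minus_ge 1 (gauss_incr m z)). rewrite Cmod_1 in H. lra. }
      assert (Hmono : (/ INR (S m) <= / INR (S n0))%R) by (apply Rinv_le_contravar; [apply INR_S_pos|apply le_INR; lia]).
      assert (Hm0 : (0 < / INR (S m))%R) by apply Rinv_0_lt_compat, INR_S_pos.
      assert (Ht := tele_pos m).
      assert (Ht2 : (A * tele m <= 1 / 2)%R).
      { apply Rle_trans with (A * / INR (S n0))%R; [|lra]. apply Rmult_le_compat_l. exact HA.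
        unfold tele. assert (0 < / INR (S (S m)))%R by apply Rinv_0_lt_compat, INR_S_pos. lra. }
      assert (Hgap : (0 <= A * (/ INR (S n0) - / INR (S m)) <= 1 / 2)%R).
      { split. apply Rmult_le_pos; lra. apply Rle_trans with (A * / INR (S n0))%R; [|lra]. apply Rmult_le_compat_l; lra. }
      pose proof (Cmod_ge_0 (gauss n0 z)) as Hc.
      apply Rle_trans with (Cmod (gauss n0 z) * (1 - A * (/ INR (S n0) - / INR (S m))) * (1 - A * tele m))%R.
      + rewrite Rmult_assoc. apply Rmult_le_compat_l. exact Hc.
        replace (/ INR (S n0) - / INR (S (S m)))%R with ((/ INR (S n0) - / INR (S m)) + tele m)%R by (unfold tele; ring).
        rewrite Rmult_plus_distr_l.
        assert (0 <= A * tele m)%R by (apply Rmult_le_pos; assumption).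
        revert Hgap. generalize (A * (/ INR (S n0) - / INR (S m)))%R. intros. nra.
      + apply Rmult_le_compat; try lra. apply Rmult_le_pos; lra. }
  intros Hr.
  assert (Hg0 : (0 < Cmod (gauss n0 z))%R) by apply Cmod_gt_0, Hg.
  destruct (rGamma_conv z (Cmod (gauss n0 z) / 2)%R ltac:(lra)) as [n1 H2].
  specialize (H2 (n0 + n1)%nat ltac:(lia)). rewrite Hr in H2.
  replace (gauss (n0 + n1) z - 0) with (gauss (n0 + n1) z) in H2 by ring.
  specialize (Hlow (n0 + n1)%nat ltac:(lia)).
  assert (0 < / INR (S (n0 + n1)))%R by apply Rinv_0_lt_compat, INR_S_pos.
  assert (A * (/ INR (S n0) - / INR (S (n0 + n1))) <= 1 / 2)%R.
  { apply Rle_trans with (A * / INR (S n0))%R; [|lra]. apply Rmult_le_compat_l; lra. }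
  nra.
Qed.

(** * Residues *)

Definition ex_cder (f : C -> C) (z : C) : Prop := exists d, cder f z d.

Lemma ex_cder_mult (f g : C -> C) (z : C) :
  ex_cder f z -> ex_cder g z -> ex_cder (fun x => f x * g x) z.
Proof. intros [d H] [d' H']. eexists. apply cder_mult; eassumption. Qed.

Lemma ex_cder_plus (f g : C -> C) (z : C) :
  ex_cder f z -> ex_cder g z -> ex_cder (fun x => f x + g x) z.
Proof. intros [d H] [d' H']. eexists. apply cder_plus; eassumption. Qed.

Lemma ex_cder_comp (f g : C -> C) (z : C) :
  ex_cder f (g z) -> ex_cder g z -> ex_cder (fun x => f (g x)) z.
Proof. intros [d H] [d' H']. eexists. apply cder_comp; eassumption. Qed.

Lemma ex_cder_const (c z : C) : ex_cder (fun _ => c) z.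
Proof. exists 0. apply cder_const. Qed.

Lemma ex_cder_id (z : C) : ex_cder (fun x => x) z.
Proof. exists 1. apply cder_id. Qed.

Lemma ex_cder_Cexp (z : C) : ex_cder Cexp z.
Proof. eexists. apply Cexp_cder. Qed.

Lemma ex_cder_pow (n : nat) (z : C) : ex_cder (fun x => x ^ n) z.
Proof. destruct n. apply (ex_cder_const 1). eexists. apply cder_pow. Qed.

Lemma cder_inv (z : C) : z <> 0 -> cder Cinv z (- / (z * z)).
Proof.
  intros Hz eps He. assert (Hm : (0 < Cmod z)%R) by (apply Cmod_gt_0, Hz).
  set (A := (2 / (Cmod z * Cmod z * Cmod z))%R).
  assert (HA : (0 < A)%R) by (apply Rdiv_lt_0_compat; [lra|repeat apply Rmult_lt_0_compat; lra]).
  exists (Rmin (Cmod z / 2) (eps / A)). split. apply Rmin_pos. lra. apply Rdiv_lt_0_compat; lra.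
  intros h Hh. rmin_facts.
  pose proof (Cmod_minus_ge z h) as H1.
  assert (Hzh : z + h <> 0) by (apply Cmod_gt_0; lra).
  replace (/ (z + h) - / z - - / (z * z) * h) with (h * / (z * z * (z + h)) * h) by (field; auto).
  rewrite !Cmod_mult. apply Rmult_le_compat_r. apply Cmod_ge_0.
  rewrite Cmod_inv, !Cmod_mult by (repeat apply Cmult_neq_0; auto).
  apply Rle_trans with (eps / A * A)%R; [|right; field; lra].
  apply Rmult_le_compat. apply Cmod_ge_0. left. apply Rinv_0_lt_compat. repeat apply Rmult_lt_0_compat; lra.
  lra. unfold A.
  replace (2 / (Cmod z * Cmod z * Cmod z))%R with (/ (Cmod z * Cmod z * (Cmod z / 2)))%R by (field; lra).
  apply Rinv_le_contravar. repeat apply Rmult_lt_0_compat; lra.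
  apply Rmult_le_compat_l. nra. lra.
Qed.

Lemma ex_cder_inv (f : C -> C) (z : C) : ex_cder f z -> f z <> 0 -> ex_cder (fun x => / f x) z.
Proof. intros H Hf. apply (ex_cder_comp Cinv f). eexists. apply cder_inv, Hf. exact H. Qed.

Lemma ex_cder_rGamma (z : C) : ex_cder rGamma z.
Proof. destruct (Sc_rGamma 2 z) as [B [p H]]. exists (p 1%nat). apply (Sc_cder 1 B p). lra. exact H. Qed.

Lemma ex_cder_continuous_Ci (F : C -> C) (t : R) :
  ex_cder F (Ci * t) -> @continuous R_UniformSpace C_UniformSpace (fun s => F (Ci * s)) t.
Proof.
  intros [d H]. apply (filterlim_Cmod (@locally R_UniformSpace t)). intros eps He.
  destruct (cder_lip F _ d H) as [del [Hdel Hl]].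
  pose proof (Cmod_ge_0 d).
  assert (Hp : (0 < Rmin del (eps / (Cmod d + 1)))%R) by (apply Rmin_pos; [lra|apply Rdiv_lt_0_compat; lra]).
  exists (mkposreal _ Hp). intros s Hs.
  assert (Hs' : (Rabs (s - t) < Rmin del (eps / (Cmod d + 1)))%R) by exact Hs.
  rmin_facts.
  specialize (Hl (Ci * RtoC (s - t))). rewrite Cmod_mult, Cmod_Ci, Cmod_R, Rmult_1_l in Hl.
  replace (Ci * t + Ci * (s - t)%R) with (Ci * s) in Hl by (rewrite RtoC_minus; ring).
  eapply Rle_lt_trans. apply Hl. lra.
  apply Rlt_le_trans with ((Cmod d + 1) * (eps / (Cmod d + 1)))%R. apply Rmult_lt_compat_l; lra.
  right. field. lra.
Qed.

Lemma is_RInt_trig (A B : R) (k : nat) :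
  is_RInt (fun t => A * cos (INR (S k) * t) + B * sin (INR (S k) * t))%R 0 (2 * PI) 0.
Proof.
  pose proof (INR_S_pos k) as Hk.
  set (F := fun t => ((A * sin (INR (S k) * t) - B * cos (INR (S k) * t)) / INR (S k))%R).
  assert (E : 0%R = minus (F (2 * PI)%R) (F 0%R)).
  { unfold minus, plus, opp; simpl. unfold F.
    replace (INR (S k) * (2 * PI))%R with (0 + 2 * INR (S k) * PI)%R by ring.
    rewrite sin_period, cos_period, Rmult_0_r. ring. }
  assert (H : is_RInt (fun t => A * cos (INR (S k) * t) + B * sin (INR (S k) * t))%R 0 (2 * PI) (minus (F (2 * PI)%R) (F 0%R))).
  { apply (is_RInt_derive F).
    - intros x _. unfold F. clear E. revert Hk. generalize (INR (S k)). intros w Hw. auto_derive. exact I. field. lra.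
    - intros x _. apply (ex_derive_continuous (fun t => (A * cos (INR (S k) * t) + B * sin (INR (S k) * t))%R)). auto_derive. exact I. }
  rewrite <- E in H. exact H.
Qed.

Definition circ (r t : R) : C := r * Cexp (Ci * t).

Lemma circ_neq_0 (r t : R) : (0 < r)%R -> circ r t <> 0.
Proof. intros H. apply Cmult_neq_0. apply RtoC_neq; lra. apply Cexp_neq_0. Qed.

Lemma Cmod_circ (r t : R) : (0 < r)%R -> Cmod (circ r t) = r.
Proof.
  intros H. unfold circ. rewrite Cmod_mult, Cmod_R, Cmod_Cexp.
  replace (Re (Ci * t)) with 0%R by (unfold Ci, Re; simpl; ring).
  rewrite exp_0, Rabs_right; lra.
Qed.

Lemma Cexp_Ci (t : R) : Cexp (Ci * t) = (cos t, sin t).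
Proof.
  unfold Cexp, Ci, Re, Im; simpl. rewrite !Rmult_0_l, !Rmult_1_l, Rminus_0_r, Rplus_0_l, exp_0, !Rmult_1_l.
  reflexivity.
Qed.

Lemma Cexp_pow (z : C) (k : nat) : Cexp z ^ k = Cexp (INR k * z).
Proof.
  induction k. simpl. rewrite Cmult_0_l, Cexp_0. reflexivity.
  rewrite Cpow_S, IHk, <- Cexp_plus. f_equal. rewrite RtoC_INR_S. ring.
Qed.

Lemma is_RInt_C_ext (f g : R -> C) (a b : R) (I : C) :
  (forall t, f t = g t) -> is_RInt (V := C_R_NormedModule) f a b I ->
  is_RInt (V := C_R_NormedModule) g a b I.
Proof. intros E. apply (is_RInt_ext (V := C_R_NormedModule)). intros t _. apply E. Qed.

(** On the circle the integrand is c r^(-k) e^(-ikt), whose mean is nonzero only for k = 0. *)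
Lemma is_RInt_circ_pow (c : C) (r : R) (k : nat) : (0 < r)%R ->
  is_RInt (V := C_R_NormedModule) (fun t => c * / circ r t ^ S k * circ r t) 0 (2 * PI)
    (match k with O => RtoC (2 * PI) * c | _ => RtoC 0 end : C).
Proof.
  intros Hr.
  apply (is_RInt_C_ext (fun t => (c * / RtoC r ^ k) * / Cexp (INR k * (Ci * t)))).
  { intros t. rewrite <- Cexp_pow. unfold circ. rewrite Cpow_S, Cpow_mult_l. field.
    repeat split; try apply Cpow_nz; try apply Cexp_neq_0; apply RtoC_neq; lra. }
  destruct k.
  - replace ((2 * PI)%R * c) with (scal (V := C_R_NormedModule) (2 * PI - 0)%R c).
    2: { destruct c. unfold scal; simpl. unfold prod_scal, scal; simpl. unfold mult; simpl. unfold Cmult, RtoC; simpl. f_equal; ring. }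
    apply (is_RInt_C_ext (fun t => c)).
    { intros t. simpl. rewrite Cmult_0_l, Cexp_0. field. }
    apply (is_RInt_const (V := C_R_NormedModule)).
  - set (d := c * / RtoC r ^ S k).
    apply (is_RInt_C_ext (fun t =>
       ((fst d * cos (INR (S k) * t) + snd d * sin (INR (S k) * t))%R,
        (snd d * cos (INR (S k) * t) + (- fst d) * sin (INR (S k) * t))%R) : C)).
    { intros t. rewrite <- Cexp_opp.
      replace (- (INR (S k) * (Ci * t))) with (Ci * RtoC (- (INR (S k) * t))).
      2: { rewrite RtoC_opp, RtoC_mult. ring. }
      rewrite Cexp_Ci, cos_neg, sin_neg. destruct d as [d1 d2]. unfold Cmult; cbn [fst snd]. f_equal; ring. }
    apply (is_RInt_fct_extend_pair (U := R_NormedModule) (V := R_NormedModule) _ 0 (2 * PI) 0%R 0%R); cbn [fst snd]; apply is_RInt_trig.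
Qed.

(** Induction on the order of the pole. Subtracting the leading polar term lowers the order by one,
    and that term integrates to 0 unless the order is 1; once the singularity is gone, length times
    supremum bounds the integral by a multiple of r. *)
Lemma circle_estimate (a : C) (rho r : R) (k : nat) (B : R) (p : nat -> C) (P f : C -> C) :
  (0 < r <= rho)%R -> Sc rho k B p P ->
  (forall e, (0 < Cmod e <= rho)%R -> f (a + e) = P e / e ^ k /\ ex_cder f (a + e)) ->
  exists I : C, is_RInt (V := C_R_NormedModule) (fun t => f (a + circ r t) * circ r t) 0 (2 * PI) I /\
    (Cmod (I - (2 * PI)%R * match k with O => 0 | S k' => p k' end) <= 2 * PI * (r * (B / rho ^ k)))%R.
Proof.
  intros Hr. revert B p P f. induction k; intros B p P f HS Hf.
  - assert (Hex : ex_RInt (V := C_R_CompleteNormedModule) (fun t => f (a + circ r t) * circ r t) 0 (2 * PI)).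
    { apply (ex_RInt_continuous (V := C_R_CompleteNormedModule)). intros t _.
      apply (ex_cder_continuous_Ci (fun x => f (a + r * Cexp x) * (r * Cexp x))).
      assert (Hc : ex_cder (fun x => r * Cexp x) (Ci * t)).
      { apply (ex_cder_mult (fun _ => RtoC r)). apply ex_cder_const. apply ex_cder_Cexp. }
      apply (ex_cder_mult (fun x => f (a + r * Cexp x))); [|exact Hc].
      apply (ex_cder_comp f (fun x => a + r * Cexp x)).
      - apply (Hf (circ r t)). rewrite Cmod_circ; lra.
      - apply (ex_cder_plus (fun _ => a)). apply ex_cder_const. exact Hc. }
    assert (HexC : exists I : C, is_RInt (V := C_R_NormedModule) (fun t => f (a + circ r t) * circ r t) 0 (2 * PI) I)
      by (destruct Hex as [I HI]; exists I; exact HI).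
    destruct HexC as [I HI]. exists I. split. exact HI.
    replace (I - (2 * PI)%R * 0) with I by ring.
    rewrite Cmod_norm. replace (2 * PI * (r * (B / rho ^ 0)))%R with ((2 * PI - 0) * (r * B))%R by (simpl; field).
    apply (norm_RInt_le_const (V := C_R_NormedModule) (fun t => f (a + circ r t) * circ r t) 0 (2 * PI) I (r * B)).
    + pose proof PI_RGT_0. lra.
    + intros t _.
      assert (Hm : (Cmod (f (a + circ r t)%C * circ r t) <= r * B)%R).
      { rewrite Cmod_mult, (Cmod_circ r t) by lra.
        rewrite (proj1 (Hf (circ r t) ltac:(rewrite Cmod_circ; lra))).
        simpl. replace (P (circ r t) / 1) with (P (circ r t)) by field.
        rewrite Rmult_comm. apply Rmult_le_compat_l. lra. apply HS. rewrite Cmod_circ; lra. }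
      rewrite Cmod_norm in Hm. exact Hm.
    + exact HI.
  - destruct HS as [v [B1 [Hv [HB HP]]]].
    destruct (IHk B1 (fun j => p (S j)) v (fun w => f w + (- p O) * / (w - a) ^ S k) Hv) as [I [HI Hest]].
    { intros e He. assert (He0 : e <> 0) by (apply Cmod_gt_0; lra). destruct (Hf e He) as [E D]. split.
      - rewrite E, HP by lra. replace (a + e - a) with e by ring. rewrite !Cpow_S. field. split. apply Cpow_nz, He0. exact He0.
      - apply ex_cder_plus. exact D. apply (ex_cder_mult (fun _ => - p O)). apply ex_cder_const.
        apply (ex_cder_inv (fun w => (w - a) ^ S k)).
        + apply (ex_cder_comp (fun x => x ^ S k) (fun w => w - a)). apply ex_cder_pow.
          apply (ex_cder_plus (fun w => w) (fun _ => - a)). apply ex_cder_id. apply ex_cder_const.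
        + replace (a + e - a) with e by ring. apply Cpow_nz, He0. }
    pose proof (is_RInt_plus (V := C_R_NormedModule) _ _ _ _ _ _ HI (is_RInt_circ_pow (p O) r k (proj1 Hr))) as HJ.
    exists (I + match k with O => RtoC (2 * PI) * p O | S _ => RtoC 0 end). split.
    + eapply is_RInt_C_ext. 2: exact HJ.
      intros t. assert (circ r t <> 0) by (apply circ_neq_0; lra).
      change (@plus C_R_NormedModule) with Cplus. cbv beta.
      replace (a + circ r t - a) with (circ r t) by ring. ring.
    + change (@plus C_R_NormedModule) with Cplus.
      replace (I + match k with O => (2 * PI)%R * p O | S _ => 0 end - (2 * PI)%R * p k)
        with (I - (2 * PI)%R * match k with O => 0 | S k' => p (S k') end).
      2: { destruct k; unfold Cminus; ring. }
      eapply Rle_trans. exact Hest.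
      apply Rmult_le_compat_l. pose proof PI_RGT_0; lra.
      apply Rmult_le_compat_l. lra.
      pose proof (Cmod_ge_0 (p O)).
      pose proof (pow_lt rho k ltac:(lra)) as Hpk.
      replace (B / rho ^ S k)%R with ((B / rho) * / rho ^ k)%R by (simpl; field; lra).
      unfold Rdiv at 1. apply Rmult_le_compat_r. left; apply Rinv_0_lt_compat; lra.
      apply Rmult_le_reg_l with rho. lra. replace (rho * (B / rho))%R with B by (field; lra). lra.
Qed.

(** [Sc] with unspecified radius and norm: only the jet of order [K] matters for residues and for
    identities between coefficients. *)
Definition germ (K : nat) (p : nat -> C) (u : C -> C) : Prop :=
  exists rho B, (0 < rho)%R /\ Sc rho K B p u.

Lemma Clim_right0_unique (F : R -> C) (l : C) :
  filterlim F (at_right 0) (@locally C_UniformSpace l) -> Clim_right0 F = l.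
Proof.
  intros H.
  assert (H' : filterlim F (at_right 0) (@locally C_UniformSpace (Clim_right0 F))).
  { unfold Clim_right0. apply (epsilon_spec (inhabits (RtoC 0)) (fun l => filterlim F (at_right 0) (@locally C_UniformSpace l))).
    exists l. exact H. }
  apply Cmod_small_eq. intros eps He.
  rewrite (filterlim_Cmod (at_right 0)) in H. rewrite (filterlim_Cmod (at_right 0)) in H'.
  specialize (H (eps / 2)%R ltac:(lra)). specialize (H' (eps / 2)%R ltac:(lra)).
  destruct (filter_ex _ (filter_and _ _ H H')) as [r [A1 A2]].
  replace (Clim_right0 F - l) with ((F r - l) - (F r - Clim_right0 F)) by ring.
  eapply Rle_trans. apply Cmod_triangle_minus. lra.
Qed.

(** The normalized circle integral differs from the coefficient of 1/e by O(r), so the limit r -> 0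
    in [residue] singles that coefficient out. *)
Lemma residue_coef (f : C -> C) (a : C) (k : nat) (p : nat -> C) (P : C -> C) :
  germ k p P ->
  (exists del, (0 < del)%R /\ forall e, (0 < Cmod e < del)%R -> f (a + e) = P e / e ^ k /\ ex_cder f (a + e)) ->
  residue f a = match k with O => 0 | S k' => p k' end.
Proof.
  intros [rho0 [B [Hr0 HS0]]] [del [Hdel Hf]].
  set (rho := Rmin rho0 (del / 2)). assert (Hr : (0 < rho)%R) by (apply Rmin_pos; lra).
  assert (Hr1 : (rho <= rho0)%R) by apply Rmin_l. assert (Hr2 : (rho <= del / 2)%R) by apply Rmin_r.
  assert (HS : Sc rho k B p P) by (apply (Sc_shrink rho0); [lra|exact HS0]).
  set (c := match k with O => RtoC 0 | S k' => p k' end).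
  assert (Hest : forall r, (0 < r <= rho)%R -> (Cmod (circle_integral f a r - c) <= r * (B / rho ^ k))%R).
  { intros r Hrr. destruct (circle_estimate a rho r k B p P f Hrr HS) as [I [HI HE]].
    { intros e He. apply Hf. lra. }
    unfold circle_integral.
    assert (E : RInt (V := C_R_CompleteNormedModule)
      (fun t : R => f (a + r * Cexp (Ci * t)) * (r * Cexp (Ci * t))) 0 (2 * PI) = I).
    { apply (is_RInt_unique (V := C_R_CompleteNormedModule)). exact HI. }
    rewrite E. fold c in HE. pose proof PI_RGT_0.
    apply Rmult_le_reg_l with (2 * PI)%R. lra.
    replace (2 * PI * Cmod (/ (2 * PI) * I - c))%R with (Cmod (I - (2 * PI)%R * c)). exact HE.
    replace (I - (2 * PI)%R * c) with ((2 * PI)%R * (/ (2 * PI) * I - c)).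
    rewrite Cmod_mult, Cmod_R, Rabs_right by lra. reflexivity.
    rewrite RtoC_mult. field. apply RtoC_neq. lra. }
  apply Clim_right0_unique. apply (filterlim_Cmod (at_right 0)). intros eps He.
  assert (HB : (0 <= B / rho ^ k)%R).
  { apply Rdiv_le_0_compat. apply (Sc_nonneg _ _ _ _ _ (Rlt_le _ _ Hr) HS). apply pow_lt, Hr. }
  assert (Hp : (0 < Rmin rho (eps / (B / rho ^ k + 1)))%R) by (apply Rmin_pos; [lra|apply Rdiv_lt_0_compat; lra]).
  exists (mkposreal _ Hp). intros r Hb Hr0'.
  assert (Hb' : (Rabs (r - 0) < Rmin rho (eps / (B / rho ^ k + 1)))%R) by exact Hb.
  rewrite Rminus_0_r, Rabs_right in Hb' by lra.
  rmin_facts.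
  eapply Rle_lt_trans. apply Hest. lra.
  apply Rle_lt_trans with (r * (B / rho ^ k + 1))%R. nra.
  apply Rlt_le_trans with (eps / (B / rho ^ k + 1) * (B / rho ^ k + 1))%R.
  apply Rmult_lt_compat_r; lra. revert HB. generalize (B / rho ^ k)%R. intros M HM. right. field. lra.
Qed.

(** * Jets *)

Lemma germ_plus (K : nat) (p p' : nat -> C) (u u' : C -> C) :
  germ K p u -> germ K p' u' -> germ K (fun j => p j + p' j) (fun e => u e + u' e).
Proof.
  intros [r [B [Hr H]]] [r' [B' [Hr' H']]].
  exists (Rmin r r'), (B + B')%R. assert (Hm := Rmin_pos _ _ Hr Hr'). split. exact Hm.
  apply Sc_plus. lra.
  apply (Sc_shrink r). split. lra. apply Rmin_l. exact H.
  apply (Sc_shrink r'). split. lra. apply Rmin_r. exact H'.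
Qed.

Lemma germ_mult (K : nat) (p p' : nat -> C) (u u' : C -> C) :
  germ K p u -> germ K p' u' -> germ K (conv p p') (fun e => u e * u' e).
Proof.
  intros [r [B [Hr H]]] [r' [B' [Hr' H']]].
  exists (Rmin r r'), (B * B')%R. assert (Hm := Rmin_pos _ _ Hr Hr'). split. exact Hm.
  apply Sc_mult. lra.
  apply (Sc_shrink r). split. lra. apply Rmin_l. exact H.
  apply (Sc_shrink r'). split. lra. apply Rmin_r. exact H'.
Qed.

Lemma germ_scal (K : nat) (c : C) (p : nat -> C) (u : C -> C) :
  germ K p u -> germ K (fun j => c * p j) (fun e => c * u e).
Proof. intros [r [B [Hr H]]]. exists r, (Cmod c * B)%R. split. exact Hr. apply Sc_scal. lra. exact H. Qed.

Definition cst (c : C) : nat -> C := fun j => match j with O => c | _ => 0 end.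

Lemma germ_const (K : nat) (c : C) : germ K (cst c) (fun _ => c).
Proof. exists 1%R, (Cmod c). split. lra. apply Sc_const. lra. Qed.

Lemma germ_ext (K : nat) (p p' : nat -> C) (u u' : C -> C) :
  germ K p u -> (forall j, (j < K)%nat -> p j = p' j) ->
  (exists d, (0 < d)%R /\ forall e, (Cmod e < d)%R -> u e = u' e) -> germ K p' u'.
Proof.
  intros [r [B [Hr H]]] Hp [d [Hd Hu]].
  exists (Rmin r (d / 2)), B. assert (Hm := Rmin_pos r (d / 2) Hr ltac:(lra)). split. exact Hm.
  apply (Sc_ext _ _ B B p p' u u'). lra. apply (Sc_shrink r). split. lra. apply Rmin_l. exact H. lra. exact Hp.
  intros e He. apply Hu. rmin_facts. lra.
Qed.

Lemma germ_pred (K : nat) (p : nat -> C) (u : C -> C) : germ (S K) p u -> germ K p u.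
Proof. intros [r [B [Hr H]]]. exists r, B. split. exact Hr. apply Sc_pred. lra. exact H. Qed.

Lemma germ_coef0 (K : nat) (p : nat -> C) (u : C -> C) : germ (S K) p u -> u 0 = p O.
Proof.
  intros [r [B [Hr [v [B' [_ [_ H]]]]]]]. rewrite H. ring. rewrite Cmod_0. lra.
Qed.

(** The comparison is made on a punctured disc: the functions compared, such as e^k [Phi], are given
    by their formula only off the centre. *)
Lemma germ_unique (K : nat) (p p' : nat -> C) (u u' : C -> C) :
  germ K p u -> germ K p' u' ->
  (exists d, (0 < d)%R /\ forall e, (0 < Cmod e < d)%R -> u e = u' e) ->
  forall j, (j < K)%nat -> p j = p' j.
Proof.
  intros [r [B [Hr H]]] [r' [B' [Hr' H']]] [d [Hd Hu]] j Hj.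
  set (s := Rmin (Rmin r r') (d / 2)).
  assert (Hs : (0 < s)%R) by (repeat apply Rmin_pos; lra).
  assert (Hs1 : (s <= Rmin r r')%R) by apply Rmin_l.
  assert (Hs2 : (s <= d / 2)%R) by apply Rmin_r.
  rmin_facts.
  assert (HS : Sc s K (B + B') (fun j => p j - p' j) (fun e => u e - u' e)).
  { apply Sc_sub. lra. apply (Sc_shrink r); [lra|exact H]. apply (Sc_shrink r'); [lra|exact H']. }
  pose proof (Sc_coef_zero s K _ _ _ (fun _ => True) Hs HS) as HZ.
  assert (E : p j - p' j = 0).
  { apply HZ; try exact Hj.
    - intros e He. exists (RtoC (e / 2)). split. exact I. rewrite Cmod_R, Rabs_right; lra.
    - intros e _ He1 He2. rewrite Hu by lra. ring. }
  replace (p j) with (p j - p' j + p' j) by ring. rewrite E. ring.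
Qed.

Lemma germ_lower_bound (K : nat) (p : nat -> C) (u : C -> C) :
  germ (S K) p u -> p O <> 0 ->
  exists d, (0 < d)%R /\ forall e, (Cmod e <= d)%R -> (Cmod (p O) / 2 <= Cmod (u e))%R.
Proof.
  intros [r [B [Hr [v [B' [Hv [_ Hu]]]]]]] Hp.
  pose proof (Sc_nonneg _ _ _ _ _ (Rlt_le _ _ Hr) Hv) as HB'.
  assert (Hm : (0 < Cmod (p O))%R) by apply Cmod_gt_0, Hp.
  exists (Rmin r (Cmod (p O) / (2 * (B' + 1)))). split. apply Rmin_pos; [lra|apply Rdiv_lt_0_compat; lra].
  intros e He. rmin_facts.
  assert (Hs : (Cmod e * (B' + 1) <= Cmod (p O) / 2)%R).
  { apply Rle_trans with (Cmod (p O) / (2 * (B' + 1)) * (B' + 1))%R. apply Rmult_le_compat_r; lra. right. field. lra. }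
  rewrite Hu by lra. pose proof (Cmod_minus_ge (p O) (e * v e)) as H1. rewrite Cmod_mult in H1.
  pose proof (Sc_bound _ _ _ _ _ (Rlt_le _ _ Hr) Hv e ltac:(lra)).
  pose proof (Cmod_ge_0 e). pose proof (Cmod_ge_0 (v e)). nra.
Qed.

(** From 1/u = 1/p_0 + e (-1/p_0) v (1/u): the jet of 1/u of order J + 1 is obtained from that of
    order J, starting from the boundedness of 1/u near 0. *)
Lemma germ_inv (K : nat) (p : nat -> C) (u : C -> C) :
  germ (S K) p u -> p O <> 0 -> exists q, q O = / p O /\ germ (S K) q (fun e => / u e).
Proof.
  intros Hu Hp.
  destruct (germ_lower_bound K p u Hu Hp) as [d [Hd Hlow]].
  assert (Hm : (0 < Cmod (p O))%R) by apply Cmod_gt_0, Hp.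
  assert (Hnz : forall e, (Cmod e <= d)%R -> u e <> 0).
  { intros e He. apply Cmod_gt_0. specialize (Hlow e He). lra. }
  assert (HJ : forall J, (J <= S K)%nat -> exists q, q O = / p O /\ germ J q (fun e => / u e)).
  { induction J; intros HJ.
    - exists (cst (/ p O)). split. reflexivity. exists d, (/ (Cmod (p O) / 2))%R. split. exact Hd.
      intros e He. rewrite Cmod_inv by apply Hnz, He. apply Rinv_le_contravar. lra. apply Hlow, He.
    - destruct (IHJ ltac:(lia)) as [q [_ Hq]].
      assert (Hu' : germ (S J) p u).
      { assert (H : forall i, germ (i + S J) p u -> germ (S J) p u) by (induction i; auto using germ_pred).
        apply (H (K - J)%nat). replace (K - J + S J)%nat with (S K) by lia. exact Hu. }
      destruct Hu' as [r [B [Hr [v [B' [Hv [_ Hv']]]]]]].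
      assert (Hgv : germ J (fun j => p (S j)) v) by (exists r, B'; auto).
      destruct (germ_scal _ (- / p O) _ _ (germ_mult _ _ _ _ _ Hgv Hq)) as [r1 [B1 [Hr1 Hw]]].
      exists (fun j => match j with O => / p O | S j' => - / p O * conv (fun j => p (S j)) q j' end).
      split. reflexivity.
      exists (Rmin (Rmin r r1) d). eexists. split. repeat apply Rmin_pos; lra.
      exists (fun e => - / p O * (v e * / u e)), B1. split; [|split; [apply Rle_refl|]].
      + apply (Sc_shrink r1). split. repeat apply Rmin_glb; lra.
        apply Rle_trans with (Rmin r r1). apply Rmin_l. apply Rmin_r. exact Hw.
      + intros e He. rmin_facts. assert (Hn : u e <> 0) by (apply Hnz; lra).
        rewrite Hv' in Hn |- * by lra. field. split; assumption. }
  apply HJ. lia.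
Qed.

Lemma Sc_opp (rho : R) (K : nat) (B : R) (p : nat -> C) (u : C -> C) :
  (0 <= rho)%R -> Sc rho K B p u -> Sc rho K B (fun j => (- (1)) ^ j * p j) (fun e => u (- e)).
Proof.
  intros Hr. revert B p u. induction K; intros B p u H; simpl in *.
  - intros e He. apply H. rewrite Cmod_opp. exact He.
  - destruct H as [v [B' [Hv [HB Hu]]]].
    exists (fun e => - (1) * v (- e)), B'. split; [|split].
    + eapply Sc_ext. exact Hr. apply (Sc_scal rho K (- (1)) _ _ _ Hr (IHK _ _ _ Hv)).
      rewrite Cmod_m1. lra. intros j _. cbv beta. ring. reflexivity.
    + replace (1 * p O) with (p O) by ring. exact HB.
    + intros e He. rewrite Hu by (rewrite Cmod_opp; exact He). ring.
Qed.

Lemma germ_opp (K : nat) (p : nat -> C) (u : C -> C) :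
  germ K p u -> germ K (fun j => (- (1)) ^ j * p j) (fun e => u (- e)).
Proof. intros [r [B [Hr H]]]. exists r, B. split. exact Hr. apply Sc_opp. lra. exact H. Qed.

Lemma germ_rGamma (K : nat) (z : C) :
  exists p, p O = rGamma z /\ germ (S K) p (fun e => rGamma (z + e)).
Proof.
  destruct (Sc_rGamma (S K) z) as [B [p H]].
  assert (Hg : germ (S K) p (fun e => rGamma (z + e))) by (exists 1%R, B; split; [lra|exact H]).
  exists p. split; [|exact Hg]. rewrite <- (germ_coef0 _ _ _ Hg). f_equal. ring.
Qed.

Lemma germ_rGamma_opp (K : nat) (z : C) :
  exists p, p O = rGamma z /\ germ (S K) p (fun e => rGamma (z - e)).
Proof.
  destruct (germ_rGamma K z) as [p [Hp0 Hp]]. eexists. split; [|apply (germ_opp _ _ _ Hp)].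
  simpl. rewrite Hp0. ring.
Qed.

Lemma Sc_shift (rho : R) (K : nat) (B : R) (p : nat -> C) (u : C -> C) :
  Sc rho K B p u ->
  Sc rho (S K) (rho * B) (fun j => match j with O => 0 | S j' => p j' end) (fun e => e * u e).
Proof.
  intros H. exists u, B. split. exact H. split. rewrite Cmod_0. lra. intros. ring.
Qed.

(** Multiplication by b + e, read on Taylor coefficients. *)
Definition pop (b : C) (p : nat -> C) : nat -> C :=
  fun j => b * p j + match j with O => 0 | S j' => p j' end.

Lemma germ_pop (K : nat) (b : C) (p : nat -> C) (u : C -> C) :
  germ K p u -> germ K (pop b p) (fun e => (b + e) * u e).
Proof.
  intros H.
  assert (H' : germ K (fun j => match j with O => 0 | S j' => p j' end) (fun e => e * u e)).
  { apply germ_pred. destruct H as [r [B [Hr H]]]. exists r, (r * B)%R. split. exact Hr. apply Sc_shift, H. }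
  eapply germ_ext. apply (germ_plus _ _ _ _ _ (germ_scal K b _ _ H) H'). reflexivity.
  exists 1%R. split. lra. intros. cbv beta. ring.
Qed.

Definition popl (l : list C) (w : C) (p : nat -> C) : nat -> C :=
  fold_right (fun c acc => pop (w - c) acc) p l.

Lemma germ_popl (K : nat) (l : list C) (w : C) (p : nat -> C) (u : C -> C) :
  germ K p u -> germ K (popl l w p) (fun e => Cprod_list (fun c => w + e - c) l * u e).
Proof.
  intros H. induction l; simpl.
  - eapply germ_ext. exact H. reflexivity. exists 1%R. split. lra. intros. ring.
  - eapply germ_ext. apply (germ_pop K (w - a) _ _ IHl). reflexivity. exists 1%R. split. lra. intros. cbv beta. unfold Cminus. ring.
Qed.

(** Applied to a product without a pole, this gives the vanishing that starts the recurrence of the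
    residues. *)
Lemma germ_zero_pow (K k : nat) (p : nat -> C) (u : C -> C) :
  (K <= k)%nat -> germ K p u -> germ K (fun _ => 0) (fun e => e ^ k * u e).
Proof.
  intros HKk [r [B [Hr H]]].
  pose proof (Sc_bound _ _ _ _ _ (Rlt_le _ _ Hr) H) as Hb. clear H.
  assert (Hb' : exists M, forall e, (Cmod e <= r)%R -> (Cmod (e ^ (k - K) * u e) <= M)%R).
  { exists (r ^ (k - K) * B)%R. intros e He. rewrite Cmod_mult, Cmod_pow.
    apply Rmult_le_compat; auto. apply pow_le, Cmod_ge_0. apply Cmod_ge_0. apply pow_incr. split. apply Cmod_ge_0. exact He. }
  destruct Hb' as [M HM].
  assert (HS : forall J w, (forall e, (Cmod e <= r)%R -> (Cmod (w e) <= M)%R) ->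
      exists B', Sc r J B' (fun _ => 0) (fun e => e ^ J * w e)).
  { induction J; intros w Hw.
    - exists M. intros e He. simpl. replace (1 * w e) with (w e) by ring. auto.
    - destruct (IHJ w Hw) as [B' HB']. exists (r * B')%R. exists (fun e => e ^ J * w e), B'.
      split. exact HB'. split. rewrite Cmod_0. lra. intros. simpl. ring. }
  destruct (HS K (fun e => e ^ (k - K) * u e) HM) as [B' HB'].
  exists r, B'. split. exact Hr. eapply Sc_ext. lra. exact HB'. lra. reflexivity.
  intros e _. cbv beta. replace k with (K + (k - K))%nat at 2 by lia. rewrite Cpow_add_r. ring.
Qed.

Lemma Sc_monomial (rho : R) (K n : nat) (c : C) : (0 <= rho)%R ->
  Sc rho K (Cmod c * rho ^ n) (fun j => if Nat.eqb j n then c else 0) (fun e => c * e ^ n).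
Proof.
  intros Hr. revert n. induction K; intros n.
  - intros e He. rewrite Cmod_mult, Cmod_pow. apply Rmult_le_compat_l. apply Cmod_ge_0.
    apply pow_incr. split. apply Cmod_ge_0. exact He.
  - destruct n.
    + eapply Sc_ext. exact Hr. apply (Sc_const rho (S K) c Hr). simpl; lra.
      intros [|j] _; reflexivity. intros e _. simpl. ring.
    + exists (fun e => c * e ^ n), (Cmod c * rho ^ n)%R. split; [|split].
      * exact (IHK n).
      * simpl. rewrite Cmod_0. right. ring.
      * intros e _. simpl. ring.
Qed.

Lemma cser_single (a : nat -> C) (k : nat) : cser (fun n => if Nat.eqb k n then a n else 0) (a k).
Proof.
  intros eps He. exists (S k). intros n Hn.
  assert (E : Csum_nat (fun n => if Nat.eqb k n then a n else 0) n = a k).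
  { replace n with (k + (1 + (n - S k)))%nat by lia. rewrite !Csum_nat_split. simpl.
    rewrite Nat.add_0_r, Nat.eqb_refl, !Csum_nat_0. ring.
    - intros i Hi. replace (k =? k + S i) with false. reflexivity. symmetry. apply Nat.eqb_neq. lia.
    - intros i Hi. replace (k =? i) with false. reflexivity. symmetry. apply Nat.eqb_neq. lia. }
  rewrite E. replace (a k - a k) with (RtoC 0) by ring. rewrite Cmod_0. exact He.
Qed.

Lemma germ_exp (K : nat) (l : C) : germ K (fun j => l ^ j / INR (fact j)) (fun e => Cexp (e * l)).
Proof.
  exists 1%R, (exp (Cmod l)). split. lra.
  apply (Sc_series 1 K (fun n => Cmod l ^ n / INR (fact n))%R
    (fun n j => if Nat.eqb j n then l ^ n / INR (fact n) else 0) (fun n e => (l ^ n / INR (fact n)) * e ^ n)).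
  - lra.
  - intros n. eapply Sc_le. lra. apply Sc_monomial. lra.
    rewrite pow1, Cmod_div, Cmod_pow, Cmod_INR by apply INR_fact_neq_0'. lra.
  - apply summ_exp, Cmod_ge_0.
  - intros j _. apply (cser_single (fun n => l ^ n / INR (fact n))).
  - intros e _. apply (cser_ext (fun n => (e * l) ^ n / INR (fact n))).
    intros n. rewrite Cpow_mult_l. unfold Cdiv. ring. apply cser_exp.
Qed.

Lemma conv_Csum (p q : nat -> C) (n : nat) :
  conv p q n = Csum_nat (fun j => p (n - j)%nat * q j) (S n).
Proof.
  revert p. induction n; intros p. simpl. ring.
  simpl conv. rewrite IHn.
  change (Csum_nat (fun j => p (S n - j)%nat * q j) (S (S n))) with
    (Csum_nat (fun j => p (S n - j)%nat * q j) (S n) + p (S n - S n)%nat * q (S n)).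
  rewrite Nat.sub_diag, Cplus_comm. f_equal. apply Csum_nat_ext. intros i Hi.
  replace (S n - i)%nat with (S (n - i)) by lia. reflexivity.
Qed.

(** * Local expansion of the Meijer integrand *)

Lemma Cinv_invol (z : C) : / / z = z.
Proof.
  destruct (Ceq_dec z 0) as [E|E].
  - subst. unfold Cinv, RtoC; simpl. f_equal; unfold Rdiv; ring.
  - field. exact E.
Qed.

Lemma rGamma_shift (z : C) (n : nat) : rGamma z = Cprod_nat (fun i => z + INR i) n * rGamma (z + INR n).
Proof.
  induction n. simpl. replace (z + 0) with z by ring. ring.
  simpl Cprod_nat. rewrite IHn, (rGamma_S (z + INR n)), RtoC_INR_S, Cplus_assoc. ring.
Qed.

Lemma germ_Cprod_nat (K : nat) (z : C) (n : nat) :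
  exists p, p O = Cprod_nat (fun i => z + INR i) n /\
    germ (S K) p (fun e => Cprod_nat (fun i => z - e + INR i) n).
Proof.
  induction n.
  - exists (cst 1). split. reflexivity. exact (germ_const (S K) 1).
  - destruct IHn as [p [Hp0 Hp]].
    pose proof (germ_opp _ _ _ (germ_pop (S K) (z + INR n) _ _ (germ_const (S K) 1))) as Hl.
    eexists. split; [|eapply germ_ext; [apply (germ_mult _ _ _ _ _ Hp Hl)|reflexivity|]].
    + simpl. rewrite Hp0. unfold pop, cst. ring.
    + exists 1%R. split. lra. intros e _. simpl. f_equal. ring.
Qed.

(** Shifting n + 1 times, 1/Gamma(-n-e) is the product of -n-e+i over i < n, times -e, times
    1/Gamma(1-e). Dividing out -e leaves a nonvanishing analytic function whose inverse is
    expanded. *)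
Lemma germ_Gamma_pole (K n : nat) :
  exists q g, germ (S K) q g /\ q O <> 0 /\ (n = O -> q O = - (1)) /\
    (exists d, (0 < d)%R /\ forall e, (0 < Cmod e < d)%R -> e * Gamma (- INR n - e) = g e).
Proof.
  destruct (germ_Cprod_nat K (- INR n) n) as [p [Hp0 Hp]].
  destruct (germ_rGamma_opp K 1) as [p1 [Hp10 Hp1]]. rewrite rGamma_1 in Hp10.
  pose proof (germ_mult _ _ _ _ _ Hp Hp1) as Hm.
  assert (Hnz : p O <> 0).
  { rewrite Hp0. assert (H : forall k, (k <= n)%nat -> Cprod_nat (fun i => - INR n + INR i) k <> 0).
    { induction k; intros Hk; simpl. apply RtoC_neq; lra. apply Cmult_neq_0. apply IHk. lia.
      rewrite <- RtoC_opp, <- RtoC_plus. apply RtoC_neq. assert (INR k < INR n)%R by (apply lt_INR; lia). lra. }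
    apply H. lia. }
  destruct (germ_inv K _ _ Hm) as [q [Hq0 Hq]].
  { simpl. rewrite Hp10. replace (p O * 1) with (p O) by ring. exact Hnz. }
  simpl in Hq0. rewrite Hp10 in Hq0.
  exists (fun j => - (1) * q j), (fun e => - (1) * / (Cprod_nat (fun i : nat => - INR n - e + INR i) n * rGamma (1 - e))).
  split. apply (germ_scal (S K) (- (1)) _ _ Hq). split; [|split].
  - rewrite Hq0. replace (p O * 1) with (p O) by ring. apply Cmult_neq_0.
    rewrite <- RtoC_opp. apply RtoC_neq. lra.
    apply Cmod_gt_0. rewrite Cmod_inv by exact Hnz. apply Rinv_0_lt_compat, Cmod_gt_0, Hnz.
  - intros ->. rewrite Hq0, Hp0. simpl. field.
  - exists 1%R. split. lra. intros e He. assert (He0 : e <> 0) by (apply Cmod_gt_0; lra).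
    unfold Gamma. rewrite (rGamma_shift (- INR n - e) (S n)). simpl Cprod_nat.
    replace (- INR n - e + INR n) with (- e) by ring.
    replace (- INR n - e + INR (S n)) with (1 - e) by (rewrite RtoC_INR_S; ring).
    assert (H1 : rGamma (1 - e) <> 0).
    { apply rGamma_neq_0. intros k E.
      assert (Ee : e = RtoC (1 + INR k)) by (rewrite RtoC_plus; replace e with (1 - (1 - e)) by ring; rewrite E; ring).
      rewrite Ee, Cmod_R, Rabs_right in He; pose proof (pos_INR k); lra. }
    assert (H2 : Cprod_nat (fun i : nat => - INR n - e + INR i) n <> 0).
    { assert (H : forall k, (k <= n)%nat -> Cprod_nat (fun i => - INR n - e + INR i) k <> 0).
      { induction k; intros Hk; simpl. apply RtoC_neq; lra. apply Cmult_neq_0. apply IHk. lia.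
        intros E. assert (Ee : e = RtoC (INR k - INR n)).
        { rewrite RtoC_minus. replace e with (INR k - INR n - (- INR n - e + INR k)) by ring. rewrite E. ring. }
        rewrite Ee, Cmod_R in He. assert (INR k + 1 <= INR n)%R by (rewrite <- S_INR; apply le_INR; lia).
        rewrite Rabs_left in He; lra. }
      apply H. lia. }
    field. auto.
Qed.

Lemma germ_Gamma_regular (K n : nat) :
  exists q, germ (S K) q (fun e => Gamma (INR (S n) - e)).
Proof.
  destruct (germ_rGamma_opp K (INR (S n))) as [p [Hp0 Hp]].
  destruct (germ_inv K _ _ Hp) as [q [_ Hq]].
  - rewrite Hp0. apply rGamma_neq_0. intros k E. rewrite <- RtoC_opp in E. apply RtoC_inj in E.
    pose proof (INR_S_pos n). pose proof (pos_INR k). lra.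
  - exists q. exact Hq.
Qed.

Definition Phi (a b : list C) (w : C) : C :=
  Cprod_list (fun c => Gamma (c - w)) a * Cprod_list (fun c => rGamma (1 - c + w)) b.

Lemma germ_rGamma_list (K : nat) (b : list C) (al : C) :
  exists q, q O = Cprod_list (fun c => rGamma (1 - c + al)) b /\
    germ (S K) q (fun e => Cprod_list (fun c => rGamma (1 - c + (al + e))) b).
Proof.
  induction b as [|c b [q [Hq0 Hq]]]; simpl.
  - exists (cst 1). split. reflexivity. exact (germ_const (S K) 1).
  - destruct (germ_rGamma K (1 - c + al)) as [p [Hp0 Hp]].
    eexists. split; [|eapply germ_ext; [apply (germ_mult _ _ _ _ _ Hp Hq)|reflexivity|]].
    + simpl. rewrite Hp0, Hq0. reflexivity.
    + exists 1%R. split. lra. intros e _. cbv beta. rewrite <- Cplus_assoc. reflexivity.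
Qed.

(** Every factor is multiplied by e, even one that is regular, so the common order is the length of
    the list at each point al + m. The leading coefficient is certified nonzero when all the factors
    have a pole. *)
Lemma germ_Gamma_list (K : nat) (a : list C) (al : C) :
  (forall c, In c a -> exists k : Z, c - al = IZR k) ->
  exists q g, germ (S K) q g /\
    ((forall c, In c a -> exists n : nat, c - al = - INR n) -> q O <> 0) /\
    ((forall c, In c a -> c = al) -> q O = (- (1)) ^ length a) /\
    (exists d, (0 < d)%R /\ forall e, (0 < Cmod e < d)%R ->
       e ^ length a * Cprod_list (fun c => Gamma (c - (al + e))) a = g e).
Proof.
  induction a as [|c a IH]; intros Ha; simpl.
  - exists (cst 1), (fun _ => 1). split. apply germ_const. split. intros _. apply RtoC_neq; lra.
    split. reflexivity. exists 1%R. split. lra. intros. ring.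
  - destruct IH as [q [g [Hg [Hq [Hq1 [d [Hd Hdg]]]]]]]. { intros; apply Ha; right; assumption. }
    destruct (Ha c (or_introl eq_refl)) as [k Hk].
    assert (Hc : exists q1 g1, germ (S K) q1 g1 /\
       ((exists n : nat, c - al = - INR n) -> q1 O <> 0) /\ (c = al -> q1 O = - (1)) /\
       (exists d, (0 < d)%R /\ forall e, (0 < Cmod e < d)%R -> e * Gamma (c - (al + e)) = g1 e)).
    { destruct (Z_le_gt_dec k 0) as [Hk0|Hk0].
      - destruct (germ_Gamma_pole K (Z.to_nat (- k))) as [q1 [g1 [Hg1 [Hnz [H1 [d1 [Hd1 He1]]]]]]].
        assert (Ek : c - al = - INR (Z.to_nat (- k))).
        { rewrite Hk, INR_IZR_INZ, Z2Nat.id, opp_IZR, RtoC_opp by lia. ring. }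
        exists q1, g1. split. exact Hg1. split. auto. split.
        + intros ->. apply H1. replace (al - al) with (RtoC 0) in Hk by ring. apply RtoC_inj in Hk.
          apply eq_IZR in Hk. subst k. reflexivity.
        + exists d1. split. exact Hd1. intros e He. rewrite <- He1 by exact He. rewrite <- Ek. do 2 f_equal. ring.
      - destruct (germ_Gamma_regular K (Z.to_nat (k - 1))) as [q1 Hg1].
        pose proof (germ_pop _ 0 _ _ Hg1) as Hg2.
        assert (Ek : c - al = INR (S (Z.to_nat (k - 1)))).
        { rewrite Hk, INR_IZR_INZ. do 2 f_equal. lia. }
        eexists. eexists. split. exact Hg2. split; [|split].
        + intros [n Hn]. rewrite Hk, <- RtoC_opp in Hn. apply RtoC_inj in Hn.
          pose proof (pos_INR n). assert (1 <= IZR k)%R by (apply IZR_le; lia). lra.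
        + intros ->. replace (al - al) with (RtoC 0) in Hk by ring. apply RtoC_inj in Hk. apply eq_IZR in Hk. lia.
        + exists 1%R. split. lra. intros e _. cbv beta. rewrite <- Ek. replace (c - (al + e)) with (c - al - e) by ring. ring. }
    destruct Hc as [q1 [g1 [Hg1 [Hn1 [Hm1 [d1 [Hd1 Hdg1]]]]]]].
    exists (conv q1 q), (fun e => g1 e * g e). split. apply (germ_mult _ _ _ _ _ Hg1 Hg). split; [|split].
    + intros H. simpl. apply Cmult_neq_0. apply Hn1. apply H. left; reflexivity. apply Hq. intros; apply H; right; assumption.
    + intros H. simpl. rewrite Hm1, Hq1. reflexivity. intros; apply H; right; assumption. apply H. left; reflexivity.
    + exists (Rmin d d1). split. apply Rmin_pos; assumption. intros e He.
      rmin_facts.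
      rewrite <- Hdg, <- Hdg1 by lra. ring.
Qed.

Lemma germ_Gamma_list_regular (K : nat) (a : list C) (al : C) :
  (forall c, In c a -> exists n : nat, c - al = INR (S n)) ->
  exists q, germ (S K) q (fun e => Cprod_list (fun c => Gamma (c - (al + e))) a).
Proof.
  induction a as [|c a IH]; intros Ha; simpl.
  - exists (cst 1). exact (germ_const (S K) 1).
  - destruct IH as [q Hq]. { intros; apply Ha; right; assumption. }
    destruct (Ha c (or_introl eq_refl)) as [n Hn].
    destruct (germ_Gamma_regular K n) as [q1 Hg1].
    eexists. eapply germ_ext. apply (germ_mult _ _ _ _ _ Hg1 Hq). reflexivity.
    exists 1%R. split. lra. intros e _. cbv beta. rewrite <- Hn. do 2 f_equal. ring.
Qed.

Lemma Phi_germ (K : nat) (a b : list C) (al : C) :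
  (forall c, In c a -> exists k : Z, c - al = IZR k) ->
  exists q g, germ (S K) q g /\
    ((forall c, In c a -> exists n : nat, c - al = - INR n) ->
     Cprod_list (fun c => rGamma (1 - c + al)) b <> 0 -> q O <> 0) /\
    ((forall c, In c a -> c = al) -> q O = (- (1)) ^ length a * Cprod_list (fun c => rGamma (1 - c + al)) b) /\
    (exists d, (0 < d)%R /\ forall e, (0 < Cmod e < d)%R -> e ^ length a * Phi a b (al + e) = g e).
Proof.
  intros Ha. destruct (germ_Gamma_list K a al Ha) as [q [g [Hg [Hq [Hq1 [d [Hd Hdg]]]]]]].
  destruct (germ_rGamma_list K b al) as [q2 [Hq20 Hq2]].
  eexists. eexists. split. apply (germ_mult _ _ _ _ _ Hg Hq2). split; [|split].
  - intros H1 H2. simpl. rewrite Hq20. apply Cmult_neq_0. apply Hq, H1. exact H2.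
  - intros H1. simpl. rewrite Hq20, Hq1 by exact H1. reflexivity.
  - exists d. split. exact Hd. intros e He. cbv beta. rewrite <- Hdg by exact He. unfold Phi. ring.
Qed.

(** A pole of a factor at al + e would force e to be an integer, which 0 < |e| < 1 excludes. *)
Lemma not_pole (c al e : C) (k : Z) (n : nat) :
  c - al = IZR k -> (0 < Cmod e < 1)%R -> c - (al + e) <> - INR n.
Proof.
  intros Hk He E.
  assert (Ee : e = IZR (k + Z.of_nat n)).
  { rewrite plus_IZR, <- INR_IZR_INZ, RtoC_plus, <- Hk. replace e with (c - al - (c - (al + e))) by ring. rewrite E. ring. }
  rewrite Ee, Cmod_R in He. destruct (Z.eq_dec (k + Z.of_nat n) 0) as [E0|E0].
  - rewrite E0, Rabs_R0 in He. lra.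
  - rewrite <- abs_IZR in He. assert (1 <= IZR (Z.abs (k + Z.of_nat n)))%R by (apply IZR_le; lia). lra.
Qed.

Lemma ex_cder_Phi (a b : list C) (w : C) :
  (forall c, In c a -> forall n : nat, c - w <> - INR n) -> ex_cder (Phi a b) w.
Proof.
  intros Ha. apply (ex_cder_mult (fun w => Cprod_list (fun c => Gamma (c - w)) a)).
  - induction a as [|c a IH]; simpl. apply (ex_cder_const 1).
    apply (ex_cder_mult (fun w => Gamma (c - w))). 2: apply IH; intros; apply Ha; right; assumption.
    apply (ex_cder_inv (fun w => rGamma (c - w))). 2: apply rGamma_neq_0, Ha; left; reflexivity.
    apply (ex_cder_comp rGamma (fun w => c - w)). apply ex_cder_rGamma.
    apply (ex_cder_plus (fun _ => c)). apply ex_cder_const.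
    exists (- (1) * 1). apply (cder_ext_loc (fun w => - (1) * w)). exists 1%R. split. lra. intros. ring.
    apply (cder_scal (- (1)) (fun x => x)), cder_id.
  - clear Ha. induction b as [|c b IH]; simpl. apply (ex_cder_const 1).
    apply (ex_cder_mult (fun w => rGamma (1 - c + w))). 2: apply IH.
    apply (ex_cder_comp rGamma (fun w => 1 - c + w)). apply ex_cder_rGamma.
    apply (ex_cder_plus (fun _ => 1 - c)). apply ex_cder_const. apply ex_cder_id.
Qed.

(** * The functional equation and the residue coefficients *)

Lemma Cprod_list_app (f : C -> C) (a b : list C) :
  Cprod_list f (a ++ b) = Cprod_list f a * Cprod_list f b.
Proof. induction a; simpl. ring. rewrite IHa. ring. Qed.

(** Gamma(c - w + 1) = (c - w) Gamma(c - w) contributes -(w - c) for each c in the first group, and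
    1/Gamma contributes w - c for each c in the second; the sign thus depends on the length of [a]
    alone. *)
Lemma Phi_shift (a b : list C) (w : C) :
  (forall c, In c a -> forall n : nat, c - w <> - INR n) ->
  Phi a b (w - 1) = (- (1)) ^ length a * Cprod_list (fun c => w - c) (a ++ b) * Phi a b w.
Proof.
  intros Ha. unfold Phi. rewrite Cprod_list_app.
  assert (H1 : Cprod_list (fun c => Gamma (c - (w - 1))) a =
     (- (1)) ^ length a * Cprod_list (fun c => w - c) a * Cprod_list (fun c => Gamma (c - w)) a).
  { induction a as [|c a IH]; simpl. ring. rewrite IH by (intros; apply Ha; right; assumption).
    assert (E : Gamma (c - (w - 1)) = - (w - c) * Gamma (c - w)).
    { unfold Gamma. assert (Hnz : rGamma (c - w) <> 0) by (apply rGamma_neq_0, Ha; left; reflexivity).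
      pose proof (rGamma_S (c - w)) as Hs. replace (c - (w - 1)) with (c - w + 1) by ring.
      rewrite Hs in Hnz |- *.
      assert (H1 : c - w <> 0) by (intros E; apply Hnz; rewrite E; ring).
      assert (H2 : rGamma (c - w + 1) <> 0) by (intros E; apply Hnz; rewrite E; ring).
      field. auto. }
    rewrite E. ring. }
  assert (H2 : Cprod_list (fun c => rGamma (1 - c + (w - 1))) b =
     Cprod_list (fun c => w - c) b * Cprod_list (fun c => rGamma (1 - c + w)) b).
  { clear. induction b as [|c b IH]; simpl. ring. rewrite IH.
    replace (1 - c + (w - 1)) with (w - c) by ring. rewrite (rGamma_S (w - c)).
    replace (w - c + 1) with (1 - c + w) by ring. ring. }
  rewrite H1, H2. ring.
Qed.

(** The operator d/du + b, acting on the coefficients of a sum of q_j u^j / j!. *)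
Definition op (b : C) (q : nat -> C) : nat -> C := fun j => b * q j + q (S j).

Definition opl (l : list C) (w : C) (q : nat -> C) : nat -> C :=
  fold_right (fun c acc => op (w - c) acc) q l.

(** The residue is the coefficient of e^(k-1) in (sum p_i e^i) e^(eu), that is the sum of p_(k-1-j)
    u^j / j!: Taylor coefficients reappear in reverse order as coefficients in u. *)
Definition jrev (k : nat) (p : nat -> C) : nat -> C :=
  fun j => if Nat.ltb j k then p (k - 1 - j)%nat else 0.

Lemma jrev_ext (k : nat) (p p' : nat -> C) :
  (forall j, (j < k)%nat -> p j = p' j) -> jrev k p = jrev k p'.
Proof.
  intros H. apply functional_extensionality. intros j. unfold jrev.
  destruct (Nat.ltb_spec j k). apply H. lia. reflexivity.
Qed.

(** Reversal turns multiplication by e, which raises the index, into d/du, which lowers it; so the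
    factors w + e - c become the operators d/du + w - c. *)
Lemma jrev_popl (k : nat) (l : list C) (w : C) (p : nat -> C) :
  jrev k (popl l w p) = opl l w (jrev k p).
Proof.
  induction l; simpl. reflexivity. rewrite <- IHl. generalize (popl l w p). clear. intros p.
  apply functional_extensionality. intros j. unfold jrev, op, pop.
  destruct (Nat.ltb_spec j k); destruct (Nat.ltb_spec (S j) k); try lia.
  - replace (k - 1 - j)%nat with (S (k - 1 - S j)) by lia. reflexivity.
  - replace (k - 1 - j)%nat with O by lia. reflexivity.
  - ring.
Qed.

(* The poles are al + m, al being the leftmost parameter of the first group; q m j
   is the coefficient of (log x)^j / j! in x^(- al - m) times the residue at al + m. *)
Lemma meijer_coefficients (a b : list C) (al : C) :
  a <> nil -> (forall c, In c a -> exists n : nat, c - al = INR n) ->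
  exists q : nat -> nat -> C,
    (forall m j, (length a <= j)%nat -> q m j = 0) /\
    (forall m, opl (a ++ b) (al + INR (S m)) (q (S m)) = fun j => (- (1)) ^ length a * q m j) /\
    (opl (a ++ b) al (q O) = fun _ => 0) /\
    (forall m, (forall c, In c a -> exists n : nat, c - (al + INR m) = - INR n) ->
       Cprod_list (fun c => rGamma (1 - c + (al + INR m))) b <> 0 -> q m (length a - 1)%nat <> 0) /\
    ((forall c, In c a -> c = al) ->
       q O (length a - 1)%nat = (- (1)) ^ length a * Cprod_list (fun c => rGamma (1 - c + al)) b) /\
    (forall L x m, residue (meijer_integrand L a b x) (al + INR m) =
       Cexp ((al + INR m) * L x) * Csum_nat (fun j => q m j * (L x ^ j / INR (fact j))) (length a)).
Proof.
  intros Hne Ha.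
  destruct (length a) as [|K] eqn:Ek. { destruct a; [contradiction|discriminate]. }
  set (k := S K) in *.
  assert (HaZ : forall w : Z, forall c, In c a -> exists z : Z, c - (al + IZR w) = IZR z).
  { intros w c Hc. destruct (Ha c Hc) as [n Hn]. exists (Z.of_nat n - w)%Z.
    rewrite minus_IZR, <- INR_IZR_INZ, RtoC_minus, <- Hn. ring. }
  assert (HaN : forall m : nat, forall c, In c a -> exists z : Z, c - (al + INR m) = IZR z).
  { intros m c Hc. rewrite INR_IZR_INZ. apply (HaZ (Z.of_nat m) c Hc). }
  assert (Hex : forall m : nat, exists q g, germ k q g /\
    ((forall c, In c a -> exists n : nat, c - (al + INR m) = - INR n) ->
     Cprod_list (fun c => rGamma (1 - c + (al + INR m))) b <> 0 -> q O <> 0) /\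
    ((forall c, In c a -> c = al + INR m) -> q O = (- (1)) ^ k * Cprod_list (fun c => rGamma (1 - c + (al + INR m))) b) /\
    (exists d, (0 < d)%R /\ forall e, (0 < Cmod e < d)%R -> e ^ k * Phi a b (al + INR m + e) = g e)).
  { intros m. destruct (Phi_germ K a b (al + INR m) (HaN m)) as [q [g H]]. rewrite Ek in H. exists q, g. exact H. }
  apply choice in Hex. destruct Hex as [p Hex]. apply choice in Hex. destruct Hex as [g Hg].
  assert (Hpole : forall (w : Z) c, In c a -> forall e, (0 < Cmod e < 1)%R -> forall n : nat, c - (al + IZR w + e) <> - INR n).
  { intros w c Hc e He n. destruct (HaZ w c Hc) as [z Hz]. apply (not_pole c (al + IZR w) e z n Hz He). }
  assert (Hm1 : forall e, (0 < Cmod e < 1)%R -> forall m : nat,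
     Phi a b (al + INR m - 1 + e) = (- (1)) ^ k * Cprod_list (fun c => al + INR m + e - c) (a ++ b) * Phi a b (al + INR m + e)).
  { intros e He m. rewrite <- Ek, <- Phi_shift. f_equal. ring.
    intros c Hc n. rewrite INR_IZR_INZ. apply (Hpole (Z.of_nat m) c Hc e He). }
  assert (Hsq : forall c : C, (- (1)) ^ k * ((- (1)) ^ k * c) = c).
  { intros c. rewrite Cmult_assoc, <- Cpow_mult_l. replace (- (1) * - (1)) with (RtoC 1) by ring. rewrite Cpow_1_l. ring. }
  exists (fun m => jrev k (p m)). split; [|split; [|split; [|split; [|split]]]].
  - intros m j Hj. unfold jrev. destruct (Nat.ltb_spec j k); [lia|reflexivity].
  - intros m. rewrite <- jrev_popl.
    destruct (Hg (S m)) as [Hg1 [_ [_ [d1 [Hd1 He1]]]]]. destruct (Hg m) as [Hg2 [_ [_ [d2 [Hd2 He2]]]]].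
    pose proof (germ_popl k (a ++ b) (al + INR (S m)) _ _ Hg1) as Hpl.
    pose proof (germ_scal k ((- (1)) ^ k) _ _ Hg2) as Hsc.
    transitivity (jrev k (fun j => (- (1)) ^ k * p m j)).
    2: { apply functional_extensionality. intros j. unfold jrev. destruct (Nat.ltb j k); ring. }
    (* Both jets belong to the same function near al + m, written once through [Phi] at al + m + 1 +
       e by the functional equation and once directly. *)
    apply jrev_ext. apply (germ_unique k _ _ _ _ Hpl Hsc).
    exists (Rmin 1 (Rmin d1 d2)). split. repeat apply Rmin_pos; lra. intros e He.
    rmin_facts.
    rewrite <- He1, <- He2 by lra.
    replace (al + INR m + e) with (al + INR (S m) - 1 + e) by (rewrite RtoC_INR_S; ring).
    rewrite Hm1 by lra. rewrite !Cmult_assoc, (Cmult_comm _ (e ^ k)).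
    set (X := Cprod_list _ _). set (Y := Phi a b _).
    transitivity ((- (1)) ^ k * ((- (1)) ^ k * (e ^ k * X * Y))). symmetry; apply Hsq. ring.
  - rewrite <- jrev_popl.
    destruct (Hg O) as [Hg1 [_ [_ [d1 [Hd1 He1]]]]].
    pose proof (germ_popl k (a ++ b) al _ _ Hg1) as Hpl.
    (* At al - 1 no Gamma factor has a pole, so after multiplication by e^k the jet of order k
       vanishes. *)
    destruct (germ_Gamma_list_regular K a (al - 1)) as [qr Hqr].
    { intros c Hc. destruct (Ha c Hc) as [n Hn]. exists n. rewrite RtoC_INR_S, <- Hn. ring. }
    destruct (germ_rGamma_list K b (al - 1)) as [qb [_ Hqb]].
    pose proof (germ_scal k ((- (1)) ^ k) _ _ (germ_zero_pow k k _ _ (le_n k) (germ_mult _ _ _ _ _ Hqr Hqb))) as Hz.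
    transitivity (jrev k (fun j => (- (1)) ^ k * 0)).
    2: { apply functional_extensionality. intros j. unfold jrev. destruct (Nat.ltb j k); ring. }
    apply jrev_ext. apply (germ_unique k _ _ _ _ Hpl Hz).
    exists (Rmin 1 d1). split. apply Rmin_pos; lra. intros e He.
    rmin_facts.
    rewrite <- He1 by lra.
    specialize (Hm1 e ltac:(lra) O). simpl INR in Hm1. simpl INR.
    replace (al + 0 - 1 + e) with (al - 1 + e) in Hm1 by ring. replace (al + 0) with al in * by ring.
    change (Cprod_list (fun c : C => Gamma (c - (al - 1 + e))) a * Cprod_list (fun c : C => rGamma (1 - c + (al - 1 + e))) b)
      with (Phi a b (al - 1 + e)).
    rewrite Hm1. set (X := Cprod_list _ _). set (Y := Phi a b _).
    transitivity ((- (1)) ^ k * ((- (1)) ^ k * (e ^ k * X * Y))). rewrite Hsq. ring. ring.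
  - intros m H1 H2. destruct (Hg m) as [_ [H3 _]]. unfold jrev.
    destruct (Nat.ltb_spec (k - 1) k); [|unfold k in *; lia]. rewrite Nat.sub_diag. apply H3; assumption.
  - intros H1. destruct (Hg O) as [_ [_ [H3 _]]]. unfold jrev.
    destruct (Nat.ltb_spec (k - 1) k); [|unfold k in *; lia]. rewrite Nat.sub_diag.
    simpl INR in H3. replace (al + 0) with al in H3 by ring. apply H3, H1.
  - intros L x m. destruct (Hg m) as [Hg1 [_ [_ [d1 [Hd1 He1]]]]].
    set (l := L x).
    (* Near the pole x^w is x^(al+m) e^(e log x); the second factor brings in the powers of the
       logarithm. *)
    pose proof (germ_scal k (Cexp ((al + INR m) * l)) _ _ (germ_mult _ _ _ _ _ Hg1 (germ_exp k l))) as Hr.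
    rewrite (residue_coef (meijer_integrand L a b x) (al + INR m) k _ _ Hr).
    + unfold k at 1. cbv beta iota. f_equal. rewrite conv_Csum. apply Csum_nat_ext. intros j Hj.
      f_equal. unfold jrev. destruct (Nat.ltb_spec j k); [|unfold k in *; lia]. f_equal. unfold k. lia.
    + exists (Rmin 1 d1). split. apply Rmin_pos; lra. intros e He.
      rmin_facts.
      assert (He0 : e <> 0) by (apply Cmod_gt_0; lra).
      split.
      * rewrite <- He1 by lra. unfold meijer_integrand, Cpowb.
        fold l. replace ((al + INR m + e) * l) with ((al + INR m) * l + e * l) by ring. rewrite Cexp_plus.
        unfold Phi. field. apply Cpow_nz, He0.
      * unfold meijer_integrand, Cpowb. apply (ex_cder_mult (Phi a b)).
        -- apply ex_cder_Phi. intros c Hc n. rewrite INR_IZR_INZ. apply (Hpole (Z.of_nat m) c Hc e). lra.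
        -- apply (ex_cder_comp Cexp (fun w => w * L x)). apply ex_cder_Cexp.
           apply (ex_cder_mult (fun w => w)). apply ex_cder_id. apply ex_cder_const.
Qed.

(** * Logarithmic series *)

Definition Hterm (al : C) (k : nat) (q : nat -> nat -> C) (m : nat) (u : C) : C :=
  Cexp ((al + INR m) * u) * Csum_nat (fun j => q m j * (u ^ j / INR (fact j))) k.

(* sum_m x^(al + m) sum_(j < k) q_(m,j) (log x)^j / j! in the variable u = log x,
   for which x d/dx becomes d/du. *)
Definition Hser (al : C) (k : nat) (q : nat -> nat -> C) (u : C) : C :=
  Cseries (fun m => Hterm al k q m u).

(** Decay in [m] faster than any geometric sequence, uniformly in [j]; the series in powers of e^u
    then converges for every u. *)
Definition Ent (q : nat -> nat -> C) : Prop :=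
  forall r, (0 < r)%R -> exists M, forall m j, (Cmod (q m j) * r ^ m <= M)%R.

Definition supp (k : nat) (q : nat -> C) : Prop := forall j, (k <= j)%nat -> q j = 0.

Lemma Sc_Csum (rho : R) (K k : nat) (b : nat -> R) (p : nat -> nat -> C) (u : nat -> C -> C) :
  (0 <= rho)%R -> (forall j, Sc rho K (b j) (p j) (u j)) ->
  exists P, Sc rho K (Rsum b k) P (fun e => Csum_nat (fun j => u j e) k).
Proof.
  intros Hr H. induction k as [|k [P HP]]; simpl.
  - eexists. eapply Sc_ext. exact Hr. apply (Sc_const rho K 0 Hr). rewrite Cmod_0; lra. reflexivity. reflexivity.
  - eexists. apply (Sc_plus rho K _ _ _ _ _ _ Hr HP (H k)).
Qed.

Lemma Sc_Hterm (al : C) (k : nat) (q : nat -> nat -> C) (m K : nat) (rho Q : R) (u0 : C) :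
  (0 < rho)%R -> (forall j, (Cmod (q m j) <= Q)%R) ->
  exists p, Sc rho K (exp (Cmod al * (Cmod u0 + rho)) * exp (Cmod u0 + rho) ^ m * (Q * exp (Cmod u0 + rho))) p
    (fun e => Hterm al k q m (u0 + e)).
Proof.
  intros Hr HQ. assert (Hr' := Rlt_le _ _ Hr). set (B := (Cmod u0 + rho)%R).
  assert (HB : (0 <= B)%R) by (unfold B; pose proof (Cmod_ge_0 u0); lra).
  assert (HQ0 : (0 <= Q)%R) by (eapply Rle_trans; [apply Cmod_ge_0|apply (HQ O)]).
  pose proof (Sc_lin rho K u0 Hr') as Hu. fold B in Hu.
  destruct (Sc_exp rho K _ _ _ Hr (Sc_scal rho K (al + INR m) _ _ _ Hr' Hu)) as [p1 Hp1].
  assert (Hj : forall j, exists p, Sc rho K (Q * (B ^ j / INR (fact j))) p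
      (fun e => q m j * ((u0 + e) ^ j / INR (fact j)))).
  { intros j. destruct (Sc_pow rho K j _ _ _ Hr' Hu) as [p' Hp'].
    eexists. eapply Sc_ext. exact Hr'. apply (Sc_scal rho K (q m j * / INR (fact j)) _ _ _ Hr' Hp').
    2: reflexivity. 2: intros e _; cbv beta; unfold Cdiv; ring.
    rewrite Cmod_mult, Cmod_inv, Cmod_INR by apply INR_fact_neq_0'.
    unfold Rdiv. rewrite (Rmult_comm (B ^ j)), <- Rmult_assoc.
    apply Rmult_le_compat_r. apply pow_le, HB. apply Rmult_le_compat_r.
    left; apply Rinv_0_lt_compat, INR_fact_lt_0. apply HQ. }
  apply choice in Hj. destruct Hj as [pj Hj].
  destruct (Sc_Csum rho K k _ _ _ Hr' Hj) as [p2 Hp2].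
  eexists. eapply Sc_ext. exact Hr'. apply (Sc_mult rho K _ _ _ _ _ _ Hr' Hp1 Hp2).
  2: reflexivity. 2: reflexivity.
  rewrite Rsum_scal. apply Rmult_le_compat.
  - left; apply exp_pos.
  - apply Rmult_le_pos. exact HQ0. apply (Rsum_mono (fun j => B ^ j / INR (fact j))%R 0 k). apply (summ_exp B HB). lia.
  - rewrite <- (Rpower_pow m) by apply exp_pos. unfold Rpower. rewrite ln_exp, <- exp_plus.
    apply exp_le_mono. rewrite <- Rmult_plus_distr_r. apply Rmult_le_compat_r. exact HB.
    eapply Rle_trans. apply Cmod_triangle. rewrite Cmod_INR. lra.
  - apply Rmult_le_compat_l. exact HQ0. apply Rsum_exp, HB.
Qed.

Lemma Sc_Hterm_geom (al : C) (k : nat) (q : nat -> nat -> C) (rho : R) (u0 : C) :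
  (0 < rho)%R -> Ent q ->
  exists A, (0 <= A)%R /\ forall K m, exists p, Sc rho K (A * (/ 2) ^ m) p (fun e => Hterm al k q m (u0 + e)).
Proof.
  intros Hr HE. set (E := exp (Cmod u0 + rho)).
  assert (HEp : (0 < E)%R) by apply exp_pos.
  (* E bounds the norm of e^u on the disc; decay at rate 2 E against growth E^m leaves (1/2)^m. *)
  destruct (HE (2 * E)%R ltac:(lra)) as [M HM].
  assert (HM0 : (0 <= M)%R).
  { eapply Rle_trans. 2: apply (HM O O). apply Rmult_le_pos. apply Cmod_ge_0. apply pow_le. lra. }
  exists (exp (Cmod al * (Cmod u0 + rho)) * (M * E))%R. split.
  { repeat apply Rmult_le_pos; try lra. left; apply exp_pos. }
  intros K m.
  destruct (Sc_Hterm al k q m K rho (M / (2 * E) ^ m) u0 Hr) as [p Hp].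
  { intros j. assert (Hp := pow_lt (2 * E) m ltac:(lra)).
    apply Rmult_le_reg_r with ((2 * E) ^ m)%R. exact Hp.
    replace (M / (2 * E) ^ m * (2 * E) ^ m)%R with M by (field; lra). apply HM. }
  fold E in Hp. exists p. eapply Sc_le. lra. exact Hp. right.
  rewrite Rpow_mult_distr, pow_inv. field.
  split; apply pow_nonzero; lra.
Qed.

Lemma summ_geom (A : R) : (0 <= A)%R -> summ (fun m => A * (/ 2) ^ m)%R (A * 2).
Proof.
  intros HA. split. intros n. apply Rmult_le_pos. exact HA. apply pow_le. lra.
  intros n. rewrite Rsum_scal. apply Rmult_le_compat_l. exact HA. apply Rsum_geom.
Qed.

Lemma Hser_cser (al : C) (k : nat) (q : nat -> nat -> C) (u : C) :
  Ent q -> cser (fun m => Hterm al k q m u) (Hser al k q u).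
Proof.
  intros HE. destruct (Sc_Hterm_geom al k q 1 u ltac:(lra) HE) as [A [HA H]].
  destruct (cser_dominated (fun m => Hterm al k q m u) (fun m => A * (/ 2) ^ m)%R (A * 2)) as [l [Hl _]].
  - intros m. destruct (H O m) as [p Hp]. specialize (Hp 0). cbv beta in Hp. replace (u + 0) with u in Hp by ring.
    apply Hp. rewrite Cmod_0. lra.
  - apply summ_geom, HA.
  - unfold Hser. rewrite (Cseries_unique _ l Hl). exact Hl.
Qed.

Lemma Sc_Hser (al : C) (k : nat) (q : nat -> nat -> C) (u0 : C) (rho : R) :
  (0 < rho)%R -> Ent q -> exists B, forall K, exists p, Sc rho K B p (fun e => Hser al k q (u0 + e)).
Proof.
  intros Hr HE. destruct (Sc_Hterm_geom al k q rho u0 Hr HE) as [A [HA H]].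
  exists (A * 2)%R. intros K.
  apply (Sc_series_ex rho K (fun m => A * (/ 2) ^ m)%R (fun m e => Hterm al k q m (u0 + e))).
  exact Hr. intros m; apply H. apply summ_geom, HA. intros e _. apply Hser_cser, HE.
Qed.

Lemma cder_exp_poly (k : nat) (q : nat -> C) (u : C) : supp k q ->
  cder (fun u => Csum_nat (fun j => q j * (u ^ j / INR (fact j))) k) u
    (Csum_nat (fun j => q (S j) * (u ^ j / INR (fact j))) k).
Proof.
  intros Hq.
  set (d := fun j => match j with O => RtoC 0 | S j' => q (S j') * (u ^ j' / INR (fact j')) end).
  replace (Csum_nat (fun j => q (S j) * (u ^ j / INR (fact j))) k) with (Csum_nat d k).
  - apply (cder_Csum (fun j u => q j * (u ^ j / INR (fact j)))). intros [|j] _; unfold d.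
    + apply (cder_ext_loc (fun _ => q O)). exists 1%R. split. lra. intros. simpl. field. apply cder_const.
    + apply cder_scal. apply (cder_ext_loc (fun x => / INR (fact (S j)) * x ^ S j)).
      exists 1%R. split. lra. intros. unfold Cdiv. ring.
      replace (u ^ j / INR (fact j)) with (/ INR (fact (S j)) * (INR (S j) * u ^ j)).
      apply cder_scal, cder_pow.
      rewrite fact_simpl, mult_INR, RtoC_mult. field. split. apply INR_fact_neq_0'. apply RtoC_INR_S_neq_0.
  - destruct k. reflexivity. rewrite Csum_nat_S_l. simpl. rewrite (Hq (S k)) by lia.
    replace (0 + Csum_nat (fun j => q (S j) * (u ^ j / INR (fact j))) k) with
      (Csum_nat (fun j => q (S j) * (u ^ j / INR (fact j))) k) by ring. ring.
Qed.

(** The factor al + m - c grows only linearly, and m <= 2^m is absorbed by using the decay at rate 2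
    r. *)
Lemma Ent_op (al c : C) (q : nat -> nat -> C) : Ent q -> Ent (fun m => op (al + INR m - c) (q m)).
Proof.
  intros HE r Hr. destruct (HE (2 * r)%R ltac:(lra)) as [M HM].
  assert (HM0 : (0 <= M)%R).
  { eapply Rle_trans. 2: apply (HM O O). apply Rmult_le_pos. apply Cmod_ge_0. apply pow_le. lra. }
  exists ((Cmod (al - c) + 2) * M)%R. intros m j.
  assert (H2 : (INR m <= 2 ^ m)%R).
  { clear. induction m. simpl; lra. rewrite S_INR. simpl. assert (1 <= 2 ^ m)%R by (apply pow_R1_Rle; lra). lra. }
  assert (H1 : (1 <= 2 ^ m)%R) by (apply pow_R1_Rle; lra).
  assert (Hrm := pow_lt r m Hr).
  pose proof (Cmod_ge_0 (al - c)) as Hc.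
  assert (Hq : forall j, (Cmod (q m j) * r ^ m * 2 ^ m <= M)%R).
  { intros i. specialize (HM m i). rewrite Rpow_mult_distr in HM. lra. }
  assert (Hb : (Cmod (op (al + INR m - c) (q m) j) <= (Cmod (al - c) + INR m) * Cmod (q m j) + Cmod (q m (S j)))%R).
  { unfold op. eapply Rle_trans. apply Cmod_triangle. rewrite Cmod_mult. apply Rplus_le_compat_r.
    apply Rmult_le_compat_r. apply Cmod_ge_0. replace (al + INR m - c) with (al - c + INR m) by ring.
    eapply Rle_trans. apply Cmod_triangle. rewrite Cmod_INR. lra. }
  apply Rle_trans with (((Cmod (al - c) + INR m) * Cmod (q m j) + Cmod (q m (S j))) * r ^ m)%R.
  apply Rmult_le_compat_r; lra.
  pose proof (Hq j) as Q1. pose proof (Hq (S j)) as Q2.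
  pose proof (Cmod_ge_0 (q m j)). pose proof (Cmod_ge_0 (q m (S j))).
  set (X := (Cmod (q m j) * r ^ m)%R) in *. set (Y := (Cmod (q m (S j)) * r ^ m)%R) in *.
  assert (0 <= X)%R by (apply Rmult_le_pos; lra). assert (0 <= Y)%R by (apply Rmult_le_pos; lra).
  replace (((Cmod (al - c) + INR m) * Cmod (q m j) + Cmod (q m (S j))) * r ^ m)%R with
    (Cmod (al - c) * X + INR m * X + Y)%R by (unfold X, Y; ring).
  assert (X <= M)%R by nra. assert (Y <= M)%R by nra. assert (INR m * X <= M)%R by nra. nra.
Qed.

Lemma supp_op (k : nat) (b : C) (q : nat -> C) : supp k q -> supp k (op b q).
Proof. intros H j Hj. unfold op. rewrite !H by lia. ring. Qed.

(** Applied to e^((al+m)u) times a polynomial, d/du - c is d/du + (al + m - c) on the polynomial;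
    termwise differentiation transfers this to the sum. *)
Lemma Hser_step (al c : C) (k : nat) (q : nat -> nat -> C) (u : C) :
  Ent q -> (forall m, supp k (q m)) ->
  exists d, cder (Hser al k q) u d /\
    Hser al k (fun m => op (al + INR m - c) (q m)) u = d - c * Hser al k q u.
Proof.
  intros HE Hk. destruct (Sc_Hterm_geom al k q 1 u ltac:(lra) HE) as [A [HA H]].
  set (dt := fun m => Hterm al k (fun m => op (al + INR m - 0) (q m)) m u).
  destruct (cder_series (fun m => Hterm al k q m) (Hser al k q) u dt 1 (fun m => A * (/ 2) ^ m)%R (A * 2)) as [D [HD1 HD2]].
  - lra.
  - intros m. apply (H 2%nat m).
  - apply summ_geom, HA.
  - intros m. unfold dt, Hterm.
    set (P := fun u => Csum_nat (fun j => q m j * (u ^ j / INR (fact j))) k).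
    replace (Cexp ((al + INR m) * u) * Csum_nat (fun j => op (al + INR m - 0) (q m) j * (u ^ j / INR (fact j))) k)
      with (Cexp ((al + INR m) * u) * ((al + INR m) * 1) * P u +
            Cexp ((al + INR m) * u) * Csum_nat (fun j => q m (S j) * (u ^ j / INR (fact j))) k).
    + apply (cder_mult (fun u => Cexp ((al + INR m) * u)) P).
      * apply (cder_comp Cexp (fun u => (al + INR m) * u)). apply Cexp_cder.
        apply (cder_scal (al + INR m) (fun x => x)), cder_id.
      * apply cder_exp_poly, Hk.
    + unfold P.
      rewrite (Csum_nat_ext (fun j => op (al + INR m - 0) (q m) j * (u ^ j / INR (fact j)))
        (fun j => (al + INR m) * (q m j * (u ^ j / INR (fact j))) + q m (S j) * (u ^ j / INR (fact j)))).
      rewrite Csum_nat_plus, Csum_nat_scal. ring. intros i _. unfold op. ring.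
  - intros e _. apply Hser_cser, HE.
  - exists D. split. exact HD2.
    apply (cser_unique (fun m => Hterm al k (fun m => op (al + INR m - c) (q m)) m u)).
    apply Hser_cser, Ent_op, HE.
    apply (cser_ext (fun m => dt m + (- c) * Hterm al k q m u)).
    + intros m. unfold dt, Hterm.
      rewrite (Csum_nat_ext (fun j => op (al + INR m - c) (q m) j * (u ^ j / INR (fact j)))
        (fun j => op (al + INR m - 0) (q m) j * (u ^ j / INR (fact j)) + (- c) * (q m j * (u ^ j / INR (fact j))))).
      rewrite Csum_nat_plus, Csum_nat_scal. ring. intros i _. unfold op. ring.
    + replace (D - c * Hser al k q u) with (D + (- c) * Hser al k q u) by ring.
      apply cser_plus. exact HD1. apply cser_scal, Hser_cser, HE.
Qed.

(** * Composition of the Euler factors and decay of the coefficients *)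

Lemma op_comm (b b' : C) (q : nat -> C) : op b (op b' q) = op b' (op b q).
Proof. apply functional_extensionality. intros j. unfold op. ring. Qed.

Lemma opl_perm (l l' : list C) (w : C) (q : nat -> C) :
  Permutation l l' -> opl l w q = opl l' w q.
Proof. intros H. induction H; simpl; try congruence. apply op_comm. Qed.

Lemma supp_opl (k : nat) (l : list C) (w : C) (q : nat -> C) : supp k q -> supp k (opl l w q).
Proof. intros H. induction l; simpl. exact H. apply supp_op, IHl. Qed.

(** Coefficients after the first [i] Euler factors, hence those of the intermediate functions
    demanded by [euler_apply]; the indices of [c] start at 1. *)
Fixpoint opit (al : C) (c : nat -> C) (q : nat -> nat -> C) (i : nat) : nat -> nat -> C :=
  match i with
  | O => q
  | S i' => fun m => op (al + INR m - c (S i')) (opit al c q i' m)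
  end.

(** [opit] puts the last factor outermost and [opl] the first; commutation of the operators
    reconciles the two orders. *)
Lemma opit_opl (al : C) (c : nat -> C) (q : nat -> nat -> C) (i m : nat) :
  opit al c q i m = opl (map c (seq 1 i)) (al + INR m) (q m).
Proof.
  rewrite (opl_perm _ (rev (map c (seq 1 i)))) by apply Permutation_rev.
  induction i. reflexivity.
  rewrite seq_S, map_app, rev_app_distr. simpl. rewrite <- IHi. reflexivity.
Qed.

Lemma opit_Ent_supp (al : C) (c : nat -> C) (k : nat) (q : nat -> nat -> C) (i : nat) :
  Ent q -> (forall m, supp k (q m)) -> Ent (opit al c q i) /\ forall m, supp k (opit al c q i m).
Proof.
  intros H1 H2. induction i as [|i [IH1 IH2]]; simpl. auto. split.
  apply Ent_op, IH1. intros m. apply supp_op, IH2.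
Qed.

(** Multiplication by e^u moves the exponent al + m to al + m + 1, so it matches the index shift;
    the vanishing of [q' O] removes the one unmatched term. *)
Lemma Hser_recurrence (al s : C) (k : nat) (q q' : nat -> nat -> C) (u : C) :
  Ent q -> Ent q' -> (forall m, q' (S m) = fun j => s * q m j) -> (q' O = fun _ => 0) ->
  Hser al k q' u = s * Cexp u * Hser al k q u.
Proof.
  intros HE HE' HS H0. apply (cser_unique (fun m => Hterm al k q' m u)). apply Hser_cser, HE'.
  assert (E0 : Hterm al k q' 0 u = 0).
  { unfold Hterm. rewrite Csum_nat_0. ring. intros i _. rewrite H0. ring. }
  replace (s * Cexp u * Hser al k q u) with (Hterm al k q' 0 u + s * Cexp u * Hser al k q u) by (rewrite E0; ring).
  apply (cser_incr_1 (fun m => Hterm al k q' m u)).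
  apply (cser_ext (fun m => s * Cexp u * Hterm al k q m u)).
  - intros m. unfold Hterm. rewrite HS.
    rewrite (Csum_nat_ext (fun j => s * q m j * (u ^ j / INR (fact j))) (fun j => s * (q m j * (u ^ j / INR (fact j))))) by (intros; ring).
    rewrite Csum_nat_scal, RtoC_INR_S.
    replace ((al + (INR m + 1)) * u) with ((al + INR m) * u + u) by ring. rewrite Cexp_plus. ring.
  - apply cser_scal, Hser_cser, HE.
Qed.

Definition bnd (M : R) (q : nat -> C) : Prop := forall j, (Cmod (q j) <= M)%R.

(** The operator is inverted downwards from the top of the support: b q_j is the given value minus
    q_(j+1). The bound M / r reproduces itself since M + M / r = (1 + r) M / r. *)
Lemma op_bound (k : nat) (b : C) (q : nat -> C) (M r : R) :
  supp k q -> (0 <= M)%R -> (0 < r)%R -> (1 + r <= Cmod b)%R -> bnd M (op b q) -> bnd (M / r) q.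
Proof.
  intros Hk HM Hr Hb H.
  assert (HMr : (0 <= M / r)%R) by (apply Rdiv_le_0_compat; lra).
  assert (Hd : forall i j, (k <= i + j)%nat -> (Cmod (q j) <= M / r)%R).
  { induction i; intros j Hj.
    - rewrite Hk by lia. rewrite Cmod_0. exact HMr.
    - specialize (IHi (S j) ltac:(lia)). specialize (H j). unfold op in H.
      assert (H1 : (Cmod (b * q j) <= M + M / r)%R).
      { replace (b * q j) with (b * q j + q (S j) - q (S j)) by ring.
        eapply Rle_trans. apply Cmod_triangle_minus. lra. }
      rewrite Cmod_mult in H1. pose proof (Cmod_ge_0 (q j)).
      apply Rmult_le_reg_l with (1 + r)%R. lra.
      apply Rle_trans with (M + M / r)%R. 2: right; field; lra.
      eapply Rle_trans. 2: exact H1. apply Rmult_le_compat_r; lra. }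
  intros j. apply (Hd k j). lia.
Qed.

Lemma opl_bound (k : nat) (l : list C) (w : C) (q : nat -> C) (M r : R) :
  supp k q -> (0 <= M)%R -> (1 <= r)%R -> l <> nil ->
  (forall c, In c l -> (1 + r <= Cmod (w - c))%R) -> bnd M (opl l w q) -> bnd (M / r) q.
Proof.
  intros Hk HM Hr. revert M HM. induction l as [|c l IH]; intros M HM Hne Hl H. contradiction.
  simpl in H.
  assert (H1 : bnd (M / r) (opl l w q)).
  { apply (op_bound k (w - c)); auto. apply supp_opl, Hk. lra. apply Hl. left; reflexivity. }
  destruct l as [|c' l]. exact H1.
  assert (HMr : (0 <= M / r)%R) by (apply Rdiv_le_0_compat; lra).
  assert (H2 : bnd (M / r / r) q).
  { apply IH; auto. discriminate. intros; apply Hl; right; assumption. }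
  intros j. eapply Rle_trans. apply H2.
  apply Rmult_le_reg_r with r. lra. replace (M / r / r * r)%R with (M / r)%R by (field; lra). nra.
Qed.

(** For a given r all factors al + m + 1 - c eventually have modulus at least 1 + r, and from then
    on each step of the recurrence divides the supremum of the coefficients by r; finitely many
    earlier indices only enlarge the constant. *)
Lemma Ent_of_recurrence (k : nat) (l : list C) (al s : C) (q : nat -> nat -> C) :
  l <> nil -> (forall m, supp k (q m)) -> Cmod s = 1%R ->
  (forall m, opl l (al + INR (S m)) (q (S m)) = fun j => s * q m j) -> Ent q.
Proof.
  intros Hne Hk Hs Hrec.
  assert (Hfin : forall m, exists M, bnd M (q m)).
  { intros m.
    assert (H : forall i, exists M, (0 <= M)%R /\ forall j, (j < i)%nat -> (Cmod (q m j) <= M)%R).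
    { induction i as [|i [M [HM0 HM]]]. exists 0%R. split. lra. intros; lia.
      exists (M + Cmod (q m i))%R. pose proof (Cmod_ge_0 (q m i)). split. lra. intros j Hj.
      destruct (Nat.eq_dec j i). subst. lra. specialize (HM j ltac:(lia)). lra. }
    destruct (H k) as [M [HM0 HM]]. exists M. intros j. destruct (lt_dec j k). auto.
    rewrite (Hk m) by lia. rewrite Cmod_0. exact HM0. }
  assert (H1 : forall r, (1 <= r)%R -> exists M, forall m j, (Cmod (q m j) * r ^ m <= M)%R).
  { intros r Hr.
    assert (Hm0 : exists m0 : nat, forall m, (m0 <= m)%nat -> forall c, In c l -> (1 + r <= Cmod (al + INR (S m) - c))%R).
    { clear -Hr. induction l as [|c l [m0 Hm0]]. exists O. intros m _ c [].
      destruct (INR_unbounded (1 + r + Cmod (al - c))) as [n0 Hn0].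
      exists (m0 + n0)%nat. intros m Hm c' [E|Hc'].
      - subst c'. replace (al + INR (S m) - c) with (INR (S m) + (al - c)) by ring.
        pose proof (Cmod_minus_ge (INR (S m)) (al - c)). rewrite Cmod_INR in H.
        assert (INR n0 <= INR (S m))%R by (apply le_INR; lia). lra.
      - apply Hm0. lia. exact Hc'. }
    destruct Hm0 as [m0 Hm0].
    assert (Hinit : exists M, (0 <= M)%R /\ forall m, (m <= m0)%nat -> forall j, (Cmod (q m j) * r ^ m <= M)%R).
    { clear -Hfin Hr. induction m0 as [|m0 [M [HM0 HM]]].
      - destruct (Hfin O) as [M HM]. exists M. split. eapply Rle_trans; [apply Cmod_ge_0|apply (HM O)].
        intros m Hm j. replace m with O by lia. simpl. rewrite Rmult_1_r. apply HM.
      - destruct (Hfin (S m0)) as [M' HM'].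
        assert (HM'0 : (0 <= M')%R) by (eapply Rle_trans; [apply Cmod_ge_0|apply (HM' O)]).
        assert (Hp := pow_lt r (S m0) ltac:(lra)).
        exists (M + M' * r ^ S m0)%R. split. nra. intros m Hm j.
        destruct (Nat.eq_dec m (S m0)). subst. specialize (HM' j). pose proof (Cmod_ge_0 (q (S m0) j)). nra.
        specialize (HM m ltac:(lia) j). nra. }
    destruct Hinit as [M [HM0 HM]].
    assert (Hall : forall i j, (Cmod (q (m0 + i)%nat j) * r ^ (m0 + i) <= M)%R).
    { induction i; intros j. rewrite Nat.add_0_r. apply HM. lia.
      assert (Hp := pow_lt r (m0 + i) ltac:(lra)).
      assert (Hb : bnd (M / r ^ (m0 + i) / r) (q (S (m0 + i)))).
      { apply (opl_bound k l (al + INR (S (m0 + i)))); auto. apply Rdiv_le_0_compat; lra.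
        intros c Hc. apply Hm0. lia. exact Hc.
        rewrite Hrec. intros j'. rewrite Cmod_mult, Hs, Rmult_1_l.
        apply Rmult_le_reg_r with (r ^ (m0 + i))%R. exact Hp.
        replace (M / r ^ (m0 + i) * r ^ (m0 + i))%R with M by (field; lra). apply IHi. }
      rewrite Nat.add_succ_r. specialize (Hb j). simpl.
      apply Rmult_le_compat_r with (r := (r * r ^ (m0 + i))%R) in Hb. 2: nra.
      replace (M / r ^ (m0 + i) / r * (r * r ^ (m0 + i)))%R with M in Hb by (field; lra). exact Hb. }
    exists M. intros m j. destruct (le_lt_dec m m0). apply HM; assumption.
    replace m with (m0 + (m - m0))%nat by lia. apply Hall. }
  intros r Hr. destruct (H1 (Rmax 1 r) (Rmax_l 1 r)) as [M HM]. exists M. intros m j.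
  eapply Rle_trans. 2: apply (HM m j). apply Rmult_le_compat_l. apply Cmod_ge_0.
  apply pow_incr. split. lra. apply Rmax_r.
Qed.

(** * Summation over the poles *)

Lemma cser_shift (a : nat -> C) (l : C) (d : nat) :
  cser a l -> cser (fun n => a (d + n)%nat) (l - Csum_nat a d).
Proof.
  intros H. induction d; simpl.
  - replace (l - 0) with l by ring. exact H.
  - apply (cser_ext (fun n => a (d + S n)%nat)). intros n. f_equal. lia.
    apply (cser_incr_1 (fun n => a (d + n)%nat)). rewrite Nat.add_0_r.
    replace (a d + (l - (Csum_nat a d + a d))) with (l - Csum_nat a d) by ring. exact IHd.
Qed.

Lemma cser_finite (a : nat -> C) (N : nat) : cser (fun n => if Nat.ltb n N then a n else 0) (Csum_nat a N).
Proof.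
  intros eps He. exists N. intros n Hn.
  assert (E : Csum_nat (fun n => if Nat.ltb n N then a n else 0) n = Csum_nat a N).
  { replace n with (N + (n - N))%nat by lia. rewrite Csum_nat_split, (Csum_nat_0 (fun i => if Nat.ltb (N + i) N then _ else _)).
    rewrite (Csum_nat_ext _ a). ring.
    - intros i Hi. destruct (Nat.ltb_spec i N); [reflexivity|lia].
    - intros i Hi. destruct (Nat.ltb_spec (N + i) N); [lia|reflexivity]. }
  rewrite E. replace (Csum_nat a N - Csum_nat a N) with (RtoC 0) by ring. rewrite Cmod_0. exact He.
Qed.

(** The parameters are al + d_0, al + d_1, ... with d decreasing to 0. By the first-occurrence rule
    the first one owns all poles from d_0 on, and parameter i + 1 only the finitely many from
    d_(i+1) to d_i - 1; the double sum is thus a single sum over m. *)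
Lemma cser_poles (a : list C) (al : C) (d : nat -> nat) (Res : C -> C) (l : C) :
  a <> nil -> (forall i, (i < length a)%nat -> nth i a 0 = al + INR (d i)) ->
  (forall i, (S i < length a)%nat -> (d (S i) <= d i)%nat) -> d (length a - 1)%nat = O ->
  cser (fun m => Res (al + INR m)) l ->
  cser (fun n => Csum_nat (fun i => occ_weight a i n * Res (nth i a 0 + INR n)) (length a)) l.
Proof.
  intros Hne Hd Hmono Hlast Hl.
  assert (Hdec : forall i i', (i' <= i)%nat -> (i < length a)%nat -> (d i <= d i')%nat).
  { intros i i' H. induction H; intros Hi. lia. specialize (Hmono m Hi). specialize (IHle ltac:(lia)). lia. }
  assert (Hinj : forall x y : nat, al + INR x = al + INR y -> x = y).
  { intros x y E. apply INR_eq, RtoC_inj. replace (RtoC (INR x)) with (al + INR x - al) by ring. rewrite E. ring. }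
  assert (Hpt : forall i n, (i < length a)%nat -> nth i a 0 + INR n = al + INR (d i + n)).
  { intros i n Hi. rewrite Hd by exact Hi. rewrite plus_INR, RtoC_plus. ring. }
  assert (Hw0 : forall n, occ_weight a 0 n = 1).
  { intros n. unfold occ_weight. destruct excluded_middle_informative as [H|H]. reflexivity.
    exfalso. apply H. intros [i' [n' [Hi _]]]. lia. }
  assert (HwS : forall i n, (S i < length a)%nat ->
     occ_weight a (S i) n = if Nat.ltb n (d i - d (S i)) then 1 else 0).
  { intros i n Hi. unfold occ_weight.
    destruct excluded_middle_informative as [H|H]; destruct (Nat.ltb_spec n (d i - d (S i))) as [Hlt|Hge]; try reflexivity; exfalso.
    - apply H. exists i, (d (S i) + n - d i)%nat. split. lia. rewrite !Hpt by lia. do 2 f_equal.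
      specialize (Hmono i Hi). f_equal. lia.
    - apply H. intros [i' [n' [Hi' E]]]. rewrite !Hpt in E by lia. apply Hinj in E.
      pose proof (Hdec i i' ltac:(lia) ltac:(lia)). lia. }
  set (R := fun m : nat => Res (al + INR m)) in *.
  (* The first I + 1 parameters account exactly for the poles al + m with m >= d I; at the last
     parameter nothing is missing. *)
  assert (HI : forall I, (S I <= length a)%nat ->
     cser (fun n => Csum_nat (fun i => occ_weight a i n * Res (nth i a 0 + INR n)) (S I)) (l - Csum_nat R (d I))).
  { induction I; intros HI.
    - apply (cser_ext (fun n => R (d O + n)%nat)).
      + intros n. simpl. rewrite Hw0, Hpt by lia. unfold R. ring.
      + apply cser_shift, Hl.
    - replace (l - Csum_nat R (d (S I))) with ((l - Csum_nat R (d I)) + Csum_nat (fun n => R (d (S I) + n)%nat) (d I - d (S I))).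
      + apply (cser_ext (fun n => Csum_nat (fun i => occ_weight a i n * Res (nth i a 0 + INR n)) (S I) +
            (if Nat.ltb n (d I - d (S I)) then R (d (S I) + n)%nat else 0))).
        * intros n. change (Csum_nat (fun i => occ_weight a i n * Res (nth i a 0 + INR n)) (S (S I))) with
            (Csum_nat (fun i => occ_weight a i n * Res (nth i a 0 + INR n)) (S I) + occ_weight a (S I) n * Res (nth (S I) a 0 + INR n)).
          f_equal. rewrite HwS, Hpt by lia. unfold R. destruct (Nat.ltb n (d I - d (S I))); ring.
        * apply cser_plus. apply IHI. lia. apply (cser_finite (fun n => R (d (S I) + n)%nat)).
      + specialize (Hmono I HI).
        replace (d I) with (d (S I) + (d I - d (S I)))%nat at 1 by lia. rewrite Csum_nat_split. ring. }
  assert (Hlen : (0 < length a)%nat) by (destruct a; [contradiction|simpl; lia]).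
  specialize (HI (length a - 1)%nat ltac:(lia)). rewrite Hlast in HI. simpl (Csum_nat R 0) in HI.
  replace (S (length a - 1)) with (length a) in HI by lia.
  replace (l - 0) with l in HI by ring. exact HI.
Qed.

Lemma meijerG_Hser (a b : list C) (al : C) (d : nat -> nat) :
  a <> nil -> (forall i, (i < length a)%nat -> nth i a 0 = al + INR (d i)) ->
  (forall i, (S i < length a)%nat -> (d (S i) <= d i)%nat) -> d (length a - 1)%nat = O ->
  exists q : nat -> nat -> C,
    Ent q /\ (forall m, supp (length a) (q m)) /\
    (forall m, opl (a ++ b) (al + INR (S m)) (q (S m)) = fun j => (- (1)) ^ length a * q m j) /\
    (opl (a ++ b) al (q O) = fun _ => 0) /\
    (Cprod_list (fun c => rGamma (1 - c + nth 0 a 0)) b <> 0 -> q (d O) (length a - 1)%nat <> 0) /\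
    (length a = 1%nat -> q O O = Cprod_list (fun c => rGamma (1 - c + al)) b) /\
    (forall L x, meijerG L a b x = Hser al (length a) q (L x)).
Proof.
  intros Hne Hd Hmono Hlast.
  assert (Hdec : forall i, (i < length a)%nat -> (d i <= d O)%nat).
  { induction i; intros Hi. lia. specialize (Hmono i Hi). specialize (IHi ltac:(lia)). lia. }
  assert (Hlen : (0 < length a)%nat) by (destruct a; [contradiction|simpl; lia]).
  assert (HIn : forall c, In c a -> exists i, (i < length a)%nat /\ c = al + INR (d i)).
  { intros c Hc. destruct (In_nth a c 0 Hc) as [i [Hi E]]. exists i. split. exact Hi. rewrite <- E. apply Hd, Hi. }
  destruct (meijer_coefficients a b al Hne) as [q [Hk [Hrec [H0 [Hnz [H1 Hres]]]]]].
  { intros c Hc. destruct (HIn c Hc) as [i [Hi E]]. exists (d i). rewrite E. ring. }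
  (* The minus sign of the definition of G is absorbed in the coefficients, which keeps the linear
     recurrence. *)
  set (q' := fun m j => - (1) * q m j).
  assert (Hop : forall l w (p : nat -> C), opl l w (fun j => - (1) * p j) = fun j => - (1) * opl l w p j).
  { intros l w p. induction l; simpl. reflexivity. rewrite IHl.
    apply functional_extensionality. intros j. unfold op. ring. }
  assert (Hsupp : forall m, supp (length a) (q' m)) by (intros m j Hj; unfold q'; rewrite Hk by exact Hj; ring).
  assert (Hrec' : forall m, opl (a ++ b) (al + INR (S m)) (q' (S m)) = fun j => (- (1)) ^ length a * q' m j).
  { intros m. unfold q'. rewrite Hop, Hrec. apply functional_extensionality. intros j. ring. }
  assert (HE : Ent q').
  { apply (Ent_of_recurrence (length a) (a ++ b) al ((- (1)) ^ length a)); auto.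
    destruct a; [contradiction|discriminate]. rewrite Cmod_pow, Cmod_m1. apply pow1. }
  exists q'. split. exact HE. split. exact Hsupp. split. exact Hrec'. split; [|split; [|split]].
  - unfold q'. rewrite Hop, H0. apply functional_extensionality. intros j. ring.
  - intros Hb. unfold q'. apply Cmult_neq_0. rewrite <- RtoC_opp; apply RtoC_neq; lra.
    apply Hnz.
    + intros c Hc. destruct (HIn c Hc) as [i [Hi E]]. exists (d O - d i)%nat. specialize (Hdec i Hi).
      rewrite E, minus_INR, RtoC_minus by exact Hdec. ring.
    + rewrite <- Hd by exact Hlen. exact Hb.
  - intros Hl1. unfold q'. replace O with (length a - 1)%nat at 2 by lia. rewrite H1, Hl1.
    + simpl. ring.
    + intros c Hc. destruct (HIn c Hc) as [i [Hi E]]. rewrite E. replace i with (length a - 1)%nat by lia. rewrite Hlast. simpl. ring.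
  - intros L x. unfold meijerG.
    assert (Hc : cser (fun m => residue (meijer_integrand L a b x) (al + INR m)) (- (1) * Hser al (length a) q' (L x))).
    { apply (cser_ext (fun m => - (1) * Hterm al (length a) q' m (L x))).
      - intros m. rewrite Hres. unfold Hterm, q'.
        rewrite (Csum_nat_ext (fun j => - (1) * q m j * (L x ^ j / INR (fact j))) (fun j => - (1) * (q m j * (L x ^ j / INR (fact j))))) by (intros; ring).
        rewrite Csum_nat_scal. ring.
      - apply cser_scal, Hser_cser, HE. }
    pose proof (cser_poles a al d (residue (meijer_integrand L a b x)) _ Hne Hd Hmono Hlast Hc) as Hp.
    rewrite (Cseries_unique _ _ Hp). ring.
Qed.

(** * Entire functions and the shift by the period *)

(** On each disc [B] is chosen before [K]: one norm serves all orders, and this is what makes F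
    determined by its Taylor coefficients. *)
Definition entire (F : C -> C) : Prop :=
  forall u0 rho, (0 < rho)%R -> exists B, forall K, exists p, Sc rho K B p (fun e => F (u0 + e)).

Lemma entire_plus (F G : C -> C) : entire F -> entire G -> entire (fun u => F u + G u).
Proof.
  intros HF HG u0 rho Hr. destruct (HF u0 rho Hr) as [B HB]. destruct (HG u0 rho Hr) as [B' HB'].
  exists (B + B')%R. intros K. destruct (HB K) as [p Hp]. destruct (HB' K) as [p' Hp'].
  eexists. apply (Sc_plus rho K _ _ _ _ _ _ (Rlt_le _ _ Hr) Hp Hp').
Qed.

Lemma entire_scal (c : C) (F : C -> C) : entire F -> entire (fun u => c * F u).
Proof.
  intros HF u0 rho Hr. destruct (HF u0 rho Hr) as [B HB].
  exists (Cmod c * B)%R. intros K. destruct (HB K) as [p Hp].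
  eexists. apply (Sc_scal rho K _ _ _ _ (Rlt_le _ _ Hr) Hp).
Qed.

Lemma entire_0 : entire (fun _ => 0).
Proof.
  intros u0 rho Hr. eexists. intros K. eexists. apply (Sc_const rho K 0). lra.
Qed.

Lemma entire_Csum (F : nat -> C -> C) (n : nat) :
  (forall i, (i < n)%nat -> entire (F i)) -> entire (fun u => Csum_nat (fun i => F i u) n).
Proof.
  induction n; intros H; simpl. apply entire_0.
  apply (entire_plus (fun u => Csum_nat (fun i => F i u) n)). apply IHn. auto. apply H. lia.
Qed.

Lemma entire_shift (F : C -> C) (k : C) : entire F -> entire (fun u => F (u + k)).
Proof.
  intros HF u0 rho Hr. destruct (HF (u0 + k) rho Hr) as [B HB]. exists B. intros K.
  destruct (HB K) as [p Hp]. exists p. eapply Sc_ext. lra. exact Hp. lra. reflexivity.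
  intros e _. cbv beta. f_equal. ring.
Qed.

Lemma entire_zero (F : C -> C) (u0 : C) (d : R) :
  entire F -> (0 < d)%R -> (forall e, (Cmod e < d)%R -> F (u0 + e) = 0) -> forall u, F u = 0.
Proof.
  intros HF Hd H0 u.
  (* The radius exceeds 2 |e|, so vanishing of the first K coefficients gives |F u| <= (1/2)^K B,
     and K is arbitrary. *)
  set (e := u - u0). set (rho := (2 * Cmod e + 1)%R).
  pose proof (Cmod_ge_0 e) as He. assert (Hr : (0 < rho)%R) by (unfold rho; lra).
  destruct (HF u0 rho Hr) as [B HB].
  assert (Hb : forall K, (Cmod (F u) <= (/ 2) ^ K * B)%R).
  { intros K. destruct (HB K) as [p Hp].
    assert (Hz : forall j, (j < K)%nat -> p j = 0).
    { apply (Sc_coef_zero rho K B p (fun e => F (u0 + e)) (fun e => (Cmod e < d)%R) Hr Hp).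
      - intros d' Hd'. exists (RtoC (Rmin d d' / 2)). assert (Hm := Rmin_pos d d' Hd Hd').
        rmin_facts. rewrite Cmod_R, Rabs_right; lra.
      - intros x Hx _ _. apply H0, Hx. }
    pose proof (Sc_zero_coef_bound rho K B p _ e Hr Hp Hz ltac:(unfold rho; lra)) as Hbd.
    cbv beta in Hbd. replace (u0 + e) with u in Hbd by (unfold e; ring).
    eapply Rle_trans. exact Hbd. apply Rmult_le_compat_r. apply (Sc_nonneg _ _ _ _ _ (Rlt_le _ _ Hr) Hp).
    apply pow_incr. split. apply Rdiv_le_0_compat; lra.
    apply Rmult_le_reg_r with rho. exact Hr. replace (Cmod e / rho * rho)%R with (Cmod e) by (field; lra). unfold rho. lra. }
  apply Cmod_small_eq. intros eps Heps. replace (F u - 0) with (F u) by ring.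
  pose proof (Sc_nonneg _ _ _ _ _ (Rlt_le _ _ Hr) (proj2_sig (constructive_indefinite_description _ (HB O)))) as HB0.
  destruct (pow_lt_1_zero (/ 2)%R ltac:(rewrite Rabs_right; lra) (eps / (B + 1))%R ltac:(apply Rdiv_lt_0_compat; lra)) as [K HK].
  specialize (HK K (le_n K)). rewrite Rabs_right in HK by (apply Rle_ge, pow_le; lra).
  eapply Rle_trans. apply (Hb K).
  assert (Hp := pow_lt (/ 2) K ltac:(lra)).
  apply Rle_trans with (eps / (B + 1) * (B + 1))%R. apply Rmult_le_compat; lra. right. field. lra.
Qed.

(** * Translation by the period and its generalized eigenspaces *)

Definition tau : C := Ci * (2 * PI).

Lemma tau_neq_0 : tau <> 0.
Proof.
  unfold tau. pose proof PI_RGT_0. apply Cmult_neq_0.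
  - intros E. apply (f_equal Cmod) in E. rewrite Cmod_Ci, Cmod_0 in E. lra.
  - rewrite <- RtoC_mult. apply RtoC_neq. lra.
Qed.

Lemma Cexp_tau_INR (m : nat) : Cexp (INR m * tau) = 1.
Proof.
  rewrite <- Cexp_pow. replace (Cexp tau) with (RtoC 1). apply Cpow_1_l.
  unfold tau. rewrite <- RtoC_mult, Cexp_Ci, cos_2PI, sin_2PI. reflexivity.
Qed.

Lemma Cexp_tau_IZR (k : Z) : Cexp (IZR k * tau) = 1.
Proof.
  destruct (Z_le_gt_dec 0 k) as [H|H].
  - rewrite <- (Z2Nat.id k H), <- INR_IZR_INZ. apply Cexp_tau_INR.
  - replace (IZR k * tau) with (- (INR (Z.to_nat (- k)) * tau)).
    rewrite Cexp_opp, Cexp_tau_INR. field.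
    rewrite INR_IZR_INZ, Z2Nat.id, opp_IZR, RtoC_opp by lia. ring.
Qed.

Lemma Cexp_eq_1 (h : C) : Cexp h = 1 -> exists k : Z, h = IZR k * tau.
Proof.
  intros H.
  assert (Hre : Re h = 0%R).
  { assert (E : exp (Re h) = 1%R) by (rewrite <- Cmod_Cexp, H; apply Cmod_1).
    rewrite <- exp_0 in E. apply exp_inv in E. exact E. }
  assert (Hcos : cos (Im h) = 1%R).
  { apply (f_equal fst) in H. unfold Cexp in H; simpl in H. rewrite Hre, exp_0 in H. lra. }
  assert (Hsin : sin (Im h / 2) = 0%R).
  { pose proof (cos_2a_sin (Im h / 2)) as E. replace (2 * (Im h / 2))%R with (Im h) in E by field.
    rewrite Hcos in E. assert (sin (Im h / 2) * sin (Im h / 2) = 0)%R by lra.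
    apply Rmult_integral in H0. destruct H0; assumption. }
  apply sin_eq_0_0 in Hsin. destruct Hsin as [k Hk]. exists k.
  destruct h as [x y]. unfold Re, Im in *; simpl in *. unfold tau, Ci, RtoC, Cmult; simpl.
  f_equal; [rewrite Hre; ring|]. replace y with (2 * (y / 2))%R by field. rewrite Hk. ring.
Qed.

(** With T the translation by [tau], this is T - w; in terms of x = e^u, T is the monodromy around
    0. *)
Definition Tshift (w : C) (f : C -> C) : C -> C := fun u => f (u + tau) - w * f u.

Fixpoint Titer (w : C) (n : nat) (f : C -> C) : C -> C :=
  match n with O => f | S n' => Tshift w (Titer w n' f) end.

Definition zf : C -> C := fun _ => 0.

Lemma Tshift_zf (w : C) : Tshift w zf = zf.
Proof. apply functional_extensionality. intros u. unfold Tshift, zf. ring. Qed.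

Lemma Titer_zf (w : C) (n : nat) : Titer w n zf = zf.
Proof. induction n; simpl. reflexivity. rewrite IHn. apply Tshift_zf. Qed.

Lemma Tshift_comm (w w' : C) (f : C -> C) : Tshift w (Tshift w' f) = Tshift w' (Tshift w f).
Proof. apply functional_extensionality. intros u. unfold Tshift. ring. Qed.

Lemma Titer_Tshift (w w' : C) (n : nat) (f : C -> C) : Titer w n (Tshift w' f) = Tshift w' (Titer w n f).
Proof. induction n; simpl. reflexivity. rewrite IHn. apply Tshift_comm. Qed.

Lemma Titer_comm (w w' : C) (n n' : nat) (f : C -> C) : Titer w n (Titer w' n' f) = Titer w' n' (Titer w n f).
Proof. induction n'; simpl. reflexivity. rewrite Titer_Tshift, IHn'. reflexivity. Qed.

Lemma Titer_le (w : C) (n m : nat) (f : C -> C) : (n <= m)%nat -> Titer w n f = zf -> Titer w m f = zf.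
Proof. intros H Hn. induction H. exact Hn. simpl. rewrite IHle. apply Tshift_zf. Qed.

Lemma Tshift_Csum (w : C) (f : nat -> C -> C) (n : nat) :
  Tshift w (fun u => Csum_nat (fun i => f i u) n) = fun u => Csum_nat (fun i => Tshift w (f i) u) n.
Proof.
  apply functional_extensionality. intros u. unfold Tshift. induction n; simpl. ring. rewrite <- IHn. ring.
Qed.

Lemma Titer_Csum (w : C) (f : nat -> C -> C) (n m : nat) :
  Titer w m (fun u => Csum_nat (fun i => f i u) n) = fun u => Csum_nat (fun i => Titer w m (f i) u) n.
Proof. induction m; simpl. reflexivity. rewrite IHm. apply Tshift_Csum. Qed.

Lemma Titer_scal (w c : C) (f : C -> C) (n : nat) : Titer w n (fun u => c * f u) = fun u => c * Titer w n f u.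
Proof. induction n; simpl. reflexivity. rewrite IHn. apply functional_extensionality. intros u. unfold Tshift. ring. Qed.

Lemma Titer_shift (w k : C) (f : C -> C) (n : nat) : Titer w n (fun u => f (u + k)) = fun u => Titer w n f (u + k).
Proof.
  induction n; simpl. reflexivity. rewrite IHn. apply functional_extensionality. intros u. unfold Tshift.
  replace (u + tau + k) with (u + k + tau) by ring. reflexivity.
Qed.

(** By induction on n + n', both (T - w) f and (T - w') f vanish; their difference is a nonzero
    multiple of f. *)
Lemma eigenspaces_disjoint (w w' : C) (n n' : nat) (f : C -> C) :
  w <> w' -> Titer w n f = zf -> Titer w' n' f = zf -> f = zf.
Proof.
  intros Hw. remember (n + n')%nat as N eqn:EN. revert n n' f EN.
  induction N as [N IH] using lt_wf_ind. intros n n' f EN H H'.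
  destruct n as [|n]; [exact H|]. destruct n' as [|n']; [exact H'|].
  assert (H1 : Tshift w f = zf).
  { apply (IH (n + S n')%nat ltac:(lia) n (S n')). reflexivity.
    rewrite Titer_Tshift. exact H. rewrite Titer_Tshift, H'. apply Tshift_zf. }
  assert (H2 : Tshift w' f = zf).
  { apply (IH (S n + n')%nat ltac:(lia) (S n) n'). reflexivity.
    rewrite Titer_Tshift, H. apply Tshift_zf. rewrite Titer_Tshift. exact H'. }
  apply functional_extensionality. intros u.
  apply (f_equal (fun g => g u)) in H1. apply (f_equal (fun g => g u)) in H2. unfold Tshift, zf in *.
  assert (Hd : w - w' <> 0).
  { intros E. apply Hw. replace w with (w - w' + w') by ring. rewrite E. ring. }
  assert (E : (w - w') * f u = 0).
  { replace ((w - w') * f u) with ((f (u + tau) - w' * f u) - (f (u + tau) - w * f u)) by ring. rewrite H1, H2. ring. }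
  replace (f u) with ((w - w') * f u / (w - w')) by (field; exact Hd). rewrite E. unfold Cdiv. ring.
Qed.

(** A power of T minus the last eigenvalue kills the last summand; by induction it kills all others
    too, so each of these lies in two eigenspaces. *)
Lemma eigenspaces_sum (r : nat) (w : nat -> C) (n : nat -> nat) (G : nat -> C -> C) :
  (forall s s', (s < r)%nat -> (s' < r)%nat -> s <> s' -> w s <> w s') ->
  (forall s, (s < r)%nat -> Titer (w s) (n s) (G s) = zf) ->
  (fun u => Csum_nat (fun s => G s u) r) = zf ->
  forall s, (s < r)%nat -> G s = zf.
Proof.
  revert G. induction r; intros G Hw HG Hsum s Hs. lia.
  assert (Hlt : forall s, (s < r)%nat -> G s = zf).
  { intros s' Hs'.
    apply (eigenspaces_disjoint (w s') (w r) (n s') (n r)). apply Hw; lia. apply HG; lia.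
    apply (IHr (fun s => Titer (w r) (n r) (G s))); auto.
    - intros i Hi. rewrite Titer_comm, HG by lia. apply Titer_zf.
    - rewrite <- Titer_Csum.
      assert (E : Titer (w r) (n r) (fun u => Csum_nat (fun s => G s u) (S r)) = zf) by (rewrite Hsum; apply Titer_zf).
      rewrite Titer_Csum in E. simpl in E. rewrite (HG r) in E by lia. rewrite Titer_Csum.
      apply functional_extensionality. intros u. apply (f_equal (fun g => g u)) in E. unfold zf in *.
      rewrite <- E. ring. }
  destruct (Nat.eq_dec s r) as [->|Hne]; [|apply Hlt; lia].
  apply functional_extensionality. intros u. apply (f_equal (fun g => g u)) in Hsum. simpl in Hsum.
  rewrite Csum_nat_0 in Hsum. unfold zf in *. rewrite <- Hsum. ring.
  intros i Hi. rewrite Hlt by exact Hi. reflexivity.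
Qed.

(** Applying (T - w)^k to a relation whose highest term has index k annihilates all lower terms and
    isolates the top coefficient. *)
Lemma chain_indep (w : C) (n : nat) (f : nat -> C -> C) (c : nat -> C) :
  (forall k, (k < n)%nat -> Titer w (S k) (f k) = zf /\ Titer w k (f k) <> zf) ->
  (fun u => Csum_nat (fun k => c k * f k u) n) = zf ->
  forall k, (k < n)%nat -> c k = 0.
Proof.
  induction n; intros Hf Hsum k Hk. lia.
  assert (Hn : c n = 0).
  { destruct (Ceq_dec (c n) 0) as [E|E]; [exact E|]. exfalso. apply (proj2 (Hf n ltac:(lia))).
    pose proof (f_equal (Titer w n) Hsum) as H. rewrite Titer_zf, (Titer_Csum w (fun k u => c k * f k u)) in H.
    apply functional_extensionality. intros u. apply (f_equal (fun g => g u)) in H. simpl in H.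
    rewrite Csum_nat_0 in H.
    - rewrite Titer_scal in H. unfold zf in *. replace (Titer w n (f n) u) with ((0 + c n * Titer w n (f n) u) / c n) by (field; exact E).
      rewrite H. unfold Cdiv. ring.
    - intros i Hi. rewrite Titer_scal, (Titer_le w (S i) n (f i)). unfold zf. ring. lia. apply Hf. lia. }
  destruct (Nat.eq_dec k n) as [->|Hne]; [exact Hn|].
  apply IHn; try lia. intros; apply Hf; lia.
  apply functional_extensionality. intros u. apply (f_equal (fun g => g u)) in Hsum. simpl in Hsum.
  rewrite Hn in Hsum. rewrite <- Hsum. ring.
Qed.

(** The commutator of T - w with multiplication by u is [tau] T, and it commutes with T - w; this is
    the resulting Leibniz rule. *)
Lemma Titer_X (w : C) (n : nat) (g : C -> C) :
  Titer w (S n) (fun u => u * g u) = fun u => u * Titer w (S n) g u + INR (S n) * tau * Titer w n g (u + tau).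
Proof.
  induction n.
  - apply functional_extensionality. intros u. simpl. unfold Tshift. ring.
  - change (Tshift w (Titer w (S n) (fun u => u * g u)) = fun u => u * Tshift w (Titer w (S n) g) u + INR (S (S n)) * tau * Titer w (S n) g (u + tau)).
    rewrite IHn. apply functional_extensionality. intros u.
    rewrite (RtoC_INR_S (S n)). unfold Tshift at 1.
    change (Titer w (S n) g) with (Tshift w (Titer w n g)). unfold Tshift. ring.
Qed.

(** On u^j f with f an eigenfunction, T - w acts like a derivative in u: it lowers the degree by
    one. *)
Lemma Titer_pow (w : C) (j : nat) (f : C -> C) : (forall u, f (u + tau) = w * f u) ->
  Titer w (S j) (fun u => u ^ j * f u) = zf /\
  Titer w j (fun u => u ^ j * f u) = fun u => INR (fact j) * (tau * w) ^ j * f u.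
Proof.
  intros Hf. induction j.
  - split; apply functional_extensionality; intros u; simpl; unfold Tshift, zf; rewrite ?Hf; ring.
  - destruct IHj as [IH1 IH2].
    assert (E : (fun u => u ^ S j * f u) = (fun u => u * (u ^ j * f u))).
    { apply functional_extensionality. intros u. simpl. ring. }
    rewrite E. split.
    + rewrite Titer_X. change (Titer w (S (S j)) (fun u => u ^ j * f u)) with (Tshift w (Titer w (S j) (fun u => u ^ j * f u))).
      rewrite IH1, Tshift_zf. apply functional_extensionality. intros u. unfold zf. ring.
    + rewrite Titer_X, IH1, IH2. apply functional_extensionality. intros u. unfold zf.
      rewrite Hf, fact_simpl, mult_INR, RtoC_mult. simpl (_ ^ S j). ring.
Qed.

(** * Generalized eigenfunctions from logarithmic series *)

Definition col (q : nat -> nat -> C) (j : nat) : nat -> nat -> C :=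
  fun m i => match i with O => q m j | _ => 0 end.

Lemma Ent_col (q : nat -> nat -> C) (j : nat) : Ent q -> Ent (col q j).
Proof.
  intros H r Hr. destruct (H r Hr) as [M HM]. exists M. intros m [|i]; simpl. apply HM.
  rewrite Cmod_0, Rmult_0_l. eapply Rle_trans. 2: apply (HM O O). apply Rmult_le_pos. apply Cmod_ge_0. apply pow_le; lra.
Qed.

Lemma Hterm_1 (al : C) (q : nat -> nat -> C) (m : nat) (u : C) :
  Hterm al 1 q m u = Cexp ((al + INR m) * u) * q m O.
Proof. unfold Hterm. simpl. f_equal. field. Qed.

(** Collecting powers of u: each [col q j] gives a logarithm-free series, hence an eigenfunction of
    T, so the sum is a polynomial in u over eigenfunctions. *)
Lemma Hser_col (al : C) (k : nat) (q : nat -> nat -> C) (u : C) : Ent q ->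
  Hser al k q u = Csum_nat (fun j => / INR (fact j) * (u ^ j * Hser al 1 (col q j) u)) k.
Proof.
  intros HE. apply (cser_unique (fun m => Hterm al k q m u)). apply Hser_cser, HE.
  apply (cser_ext (fun m => Csum_nat (fun j => / INR (fact j) * u ^ j * Hterm al 1 (col q j) m u) k)).
  - intros m. unfold Hterm at 2. rewrite <- Csum_nat_scal. apply Csum_nat_ext. intros j _.
    rewrite Hterm_1. simpl. unfold Cdiv. ring.
  - apply (cser_Csum (fun m j => / INR (fact j) * u ^ j * Hterm al 1 (col q j) m u)).
    intros j _. rewrite Cmult_assoc. apply cser_scal, Hser_cser, Ent_col, HE.
Qed.

Lemma Hser_period (al : C) (q : nat -> nat -> C) (u : C) : Ent q ->
  Hser al 1 q (u + tau) = Cexp (al * tau) * Hser al 1 q u.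
Proof.
  intros HE. apply (cser_unique (fun m => Hterm al 1 q m (u + tau))). apply Hser_cser, HE.
  apply (cser_ext (fun m => Cexp (al * tau) * Hterm al 1 q m u)).
  - intros m. rewrite !Hterm_1.
    replace ((al + INR m) * (u + tau)) with (al * tau + ((al + INR m) * u + INR m * tau)) by ring.
    rewrite !Cexp_plus, Cexp_tau_INR. ring.
  - apply cser_scal, Hser_cser, HE.
Qed.

(** At u = log x with 0 < x <= 1, removing x^al leaves the power series of the q_m in x; its
    vanishing on this interval would make every coefficient zero. *)
Lemma Hser_1_nonzero (al : C) (q : nat -> nat -> C) (m0 : nat) :
  Ent q -> q m0 O <> 0 -> Hser al 1 q <> zf.
Proof.
  intros HE Hq H0.
  destruct (HE 2%R ltac:(lra)) as [M HM].
  assert (HM0 : (0 <= M)%R).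
  { eapply Rle_trans. 2: apply (HM O O). apply Rmult_le_pos. apply Cmod_ge_0. apply pow_le; lra. }
  assert (Hb : forall m, (Cmod (q m O) <= M * (/ 2) ^ m)%R).
  { intros m. specialize (HM m O). assert (Hp := pow_lt 2 m ltac:(lra)).
    apply Rmult_le_reg_r with (2 ^ m)%R. exact Hp. rewrite pow_inv.
    replace (M * / 2 ^ m * 2 ^ m)%R with M by (field; lra). exact HM. }
  assert (Hex : forall e, exists l, (Cmod e <= 1)%R -> cser (fun m => q m O * e ^ m) l).
  { intros e. destruct (Rle_dec (Cmod e) 1) as [He|He]; [|exists 0; tauto].
    destruct (cser_dominated (fun m => q m O * e ^ m) (fun m => M * (/ 2) ^ m)%R (M * 2)) as [l [Hl _]].
    - intros m. rewrite Cmod_mult, Cmod_pow. rewrite <- (Rmult_1_r (M * (/ 2) ^ m)).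
      apply Rmult_le_compat. apply Cmod_ge_0. apply pow_le, Cmod_ge_0. apply Hb.
      rewrite <- (pow1 m). apply pow_incr. split. apply Cmod_ge_0. exact He.
    - apply summ_geom, HM0.
    - exists l. auto. }
  apply choice in Hex. destruct Hex as [A HA].
  assert (HS : Sc 1 (S m0) (M * 2) (fun m => q m O) A).
  { apply (Sc_series 1 (S m0) (fun m => M * (/ 2) ^ m)%R (fun n j => if Nat.eqb j n then q n O else 0)
       (fun n e => q n O * e ^ n)).
    - lra.
    - intros n. eapply Sc_le. lra. apply Sc_monomial. lra. rewrite pow1, Rmult_1_r. apply Hb.
    - apply summ_geom, HM0.
    - intros j _. apply (cser_single (fun n => q n O)).
    - exact HA. }
  apply Hq. apply (Sc_coef_zero 1 (S m0) _ _ _ (fun e => exists x : R, (0 < x)%R /\ e = x) Rlt_0_1 HS).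
  - intros d Hd. exists (RtoC (d / 2)). split. exists (d / 2)%R. split. lra. reflexivity.
    rewrite Cmod_R, Rabs_right; lra.
  - intros e [x [Hx ->]] _ Hxr.
    pose proof (f_equal (fun g => g (RtoC (ln x))) H0) as Hz. unfold zf in Hz. cbv beta in Hz.
    pose proof (Hser_cser al 1 q (ln x) HE) as Hc. rewrite Hz in Hc.
    apply (cser_unique (fun m => q m O * RtoC x ^ m)). apply HA, Hxr.
    apply (cser_ext (fun m => / Cexp (al * ln x) * Hterm al 1 q m (ln x))).
    + intros m. rewrite Hterm_1.
      replace ((al + INR m) * ln x) with (al * ln x + INR m * ln x) by ring.
      rewrite Cexp_plus, <- Cexp_pow, Cexp_RtoC, exp_ln by exact Hx. field. apply Cexp_neq_0.
    + pose proof (cser_scal (/ Cexp (al * ln x)) _ _ Hc) as Hc'. rewrite Cmult_0_r in Hc'. exact Hc'.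
  - lia.
Qed.

(** (T - w)^K reduces the expansion in powers of u to (tau w)^K times the eigenfunction in front of
    u^K / K!, and that one is nonzero because [q m0 K] is. *)
Lemma Hser_chain (al : C) (K : nat) (q : nat -> nat -> C) (m0 : nat) :
  Ent q -> q m0 K <> 0 ->
  Titer (Cexp (al * tau)) (S K) (Hser al (S K) q) = zf /\ Titer (Cexp (al * tau)) K (Hser al (S K) q) <> zf.
Proof.
  intros HE Hq. set (w := Cexp (al * tau)).
  assert (HF : Hser al (S K) q = fun u => Csum_nat (fun j => / INR (fact j) * (u ^ j * Hser al 1 (col q j) u)) (S K)).
  { apply functional_extensionality. intros u. apply Hser_col, HE. }
  assert (Hper : forall j u, Hser al 1 (col q j) (u + tau) = w * Hser al 1 (col q j) u).
  { intros j u. apply Hser_period, Ent_col, HE. }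
  rewrite HF. rewrite !(Titer_Csum w (fun j u => / INR (fact j) * (u ^ j * Hser al 1 (col q j) u))).
  assert (Hz : forall j n, (j < n)%nat -> Titer w n (fun u => / INR (fact j) * (u ^ j * Hser al 1 (col q j) u)) = zf).
  { intros j n Hj. rewrite (Titer_scal w _ (fun u => u ^ j * Hser al 1 (col q j) u)), (Titer_le w (S j) n).
    apply functional_extensionality. intros u. unfold zf. ring. lia. apply Titer_pow, Hper. }
  split.
  - apply functional_extensionality. intros u. apply Csum_nat_0. intros j Hj. rewrite Hz by lia. reflexivity.
  - intros E. apply (Hser_1_nonzero al (col q K) m0 (Ent_col q K HE)). exact Hq.
    apply functional_extensionality. intros u. apply (f_equal (fun g => g u)) in E.
    simpl in E. rewrite Csum_nat_0 in E by (intros j Hj; rewrite Hz by lia; reflexivity).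
    rewrite (Titer_scal w _ (fun u => u ^ K * Hser al 1 (col q K) u)), (proj2 (Titer_pow w K _ (Hper K))) in E.
    unfold zf in *. assert (HF' := INR_fact_neq_0' K).
    assert (Hp : (tau * w) ^ K <> 0) by (apply Cpow_nz, Cmult_neq_0; [apply tau_neq_0|apply Cexp_neq_0]).
    replace (Hser al 1 (col q K) u) with ((0 + / INR (fact K) * (INR (fact K) * (tau * w) ^ K * Hser al 1 (col q K) u)) / (tau * w) ^ K)
      by (field; auto).
    rewrite E. unfold Cdiv. ring.
Qed.

(** * Branches of the logarithm *)

Lemma open_Cmod (D : C -> Prop) (z : C) : open D -> D z ->
  exists d, (0 < d)%R /\ forall h, (Cmod h < d)%R -> D (z + h).
Proof.
  intros HD Hz. pose proof (proj1 (locally_Cmod z D) (HD z Hz)) as [d [Hd H]].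
  exists d. split. exact Hd. intros h Hh. apply H. replace (z + h - z) with h by ring. exact Hh.
Qed.

(** The arguments (-1)^k zeta of the solutions run through D and -D. *)
Definition sym_hull (D : C -> Prop) (x : C) : Prop := D x \/ D (- x).

Lemma sym_hull_open (D : C -> Prop) (x : C) : open D -> sym_hull D x -> 
  exists d, (0 < d)%R /\ forall h, (Cmod h < d)%R -> sym_hull D (x + h).
Proof.
  intros hDopen [H|H]; destruct (open_Cmod D _ hDopen H) as [d [Hd Hh]]; exists d; split; auto; intros h Hlt.
  - left. apply Hh, Hlt.
  - right. replace (- (x + h)) with (- x + - h) by ring. apply Hh. rewrite Cmod_opp. exact Hlt.
Qed.

Lemma log_branch_neq_0 (L : C -> C) (U : C -> Prop) (x : C) : log_branch_on L U -> U x -> x <> 0.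
Proof. intros hL H E. destruct (hL x H) as [HE _]. apply (Cexp_neq_0 (L x)). rewrite HE. exact E. Qed.

Lemma log_branch_continuous (L : C -> C) (D : C -> Prop) (x : C) :
  open D -> log_branch_on L (sym_hull D) -> sym_hull D x -> forall eps, (0 < eps)%R ->
  exists d, (0 < d)%R /\ forall h, (Cmod h < d)%R -> sym_hull D (x + h) /\ (Cmod (L (x + h)%C - L x) < eps)%R.
Proof.
  intros hDopen hL Hx eps He. destruct (sym_hull_open D x hDopen Hx) as [d1 [Hd1 H1]].
  destruct (hL x Hx) as [_ Hc].
  pose proof (proj1 (filterlim_Cmod (@locally C_UniformSpace x) L (L x)) Hc eps He) as Hl.
  apply locally_Cmod in Hl. destruct Hl as [d2 [Hd2 H2]].
  exists (Rmin d1 d2). split. apply Rmin_pos; assumption. intros h Hh.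
  rmin_facts. split. apply H1. lra.
  apply H2. replace (x + h - x) with h by ring. lra.
Qed.

Lemma log_branch_cder (L : C -> C) (D : C -> Prop) (x : C) :
  open D -> log_branch_on L (sym_hull D) -> sym_hull D x -> cder L x (/ x).
Proof.
  intros hDopen hL Hx eps He. assert (Hx0 := log_branch_neq_0 L _ x hL Hx). assert (Hm : (0 < Cmod x)%R) by apply Cmod_gt_0, Hx0.
  (* The increment v of L satisfies e^v = 1 + h/x. The choice eta <= 1/2 yields |v| <= 2 |h| / |x|,
     and eta <= eps |x| / 2 then gives the final error eps |h|. *)
  set (eta := Rmin (/ 2) (eps * Cmod x / 2)).
  assert (Heta : (0 < eta)%R) by (apply Rmin_pos; nra).
  assert (Heta1 : (eta <= / 2)%R) by apply Rmin_l. assert (Heta2 : (eta <= eps * Cmod x / 2)%R) by apply Rmin_r.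
  destruct (Cexp_cder_0 eta Heta) as [d1 [Hd1 H1]].
  destruct (log_branch_continuous L D x hDopen hL Hx d1 Hd1) as [d2 [Hd2 H2]].
  exists d2. split. exact Hd2. intros h Hh. destruct (H2 h Hh) as [HU Hv].
  set (v := L (x + h) - L x) in *. specialize (H1 v Hv).
  replace (0 + v) with v in H1 by ring. rewrite Cexp_0 in H1.
  assert (Ev : Cexp v = 1 + / x * h).
  { unfold v, Cminus. rewrite Cexp_plus, Cexp_opp, (proj1 (hL _ HU)), (proj1 (hL _ Hx)). field. exact Hx0. }
  rewrite Ev in H1. replace (1 + / x * h - 1 - 1 * v) with (- (v - / x * h)) in H1 by ring. rewrite Cmod_opp in H1.
  assert (Hb : (Cmod v <= 2 * (/ Cmod x * Cmod h))%R).
  { pose proof (Cmod_triangle (v - / x * h) (/ x * h)). replace (v - / x * h + / x * h) with v in H by ring.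
    rewrite (Cmod_mult (/ x)), Cmod_inv in H by exact Hx0. pose proof (Cmod_ge_0 v). nra. }
  eapply Rle_trans. exact H1.
  apply Rle_trans with (eta * (2 * (/ Cmod x * Cmod h)))%R. apply Rmult_le_compat_l; lra.
  apply Rle_trans with ((eps * Cmod x / 2) * (2 * (/ Cmod x * Cmod h)))%R.
  apply Rmult_le_compat_r. pose proof (Cmod_ge_0 h). assert (0 < / Cmod x)%R by (apply Rinv_0_lt_compat; exact Hm). nra. exact Heta2.
  right. field. lra.
Qed.

Lemma mul_exp_near (x : C) (eps : R) : (0 < eps)%R ->
  exists d, (0 < d)%R /\ forall v, (Cmod v < d)%R -> (Cmod (x * Cexp v - x) < eps)%R.
Proof.
  intros He. destruct (cder_lip _ _ _ (cder_scal x Cexp 0 _ (Cexp_cder 0))) as [d2 [Hd2 H2]].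
  set (M := (Cmod (x * Cexp 0) + 1)%R) in *.
  assert (HM : (0 < M)%R) by (unfold M; pose proof (Cmod_ge_0 (x * Cexp 0)); lra).
  exists (Rmin d2 (eps / M)). split. apply Rmin_pos. lra. apply Rdiv_lt_0_compat; lra.
  intros v Hv. rmin_facts.
  specialize (H2 v ltac:(lra)). replace (0 + v) with v in H2 by ring. rewrite Cexp_0, Cmult_1_r in H2.
  eapply Rle_lt_trans. exact H2. apply Rlt_le_trans with (M * (eps / M))%R. apply Rmult_lt_compat_l; lra. right. field. lra.
Qed.

(** L(x e^v) - L(x) - v is an integer multiple of [tau], and continuity makes its modulus less than
    1, so it is 0. Locally the variable u is thus v up to a constant. *)
Lemma log_branch_mul_exp (L : C -> C) (D : C -> Prop) (x : C) :
  open D -> log_branch_on L (sym_hull D) -> sym_hull D x ->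
  exists d, (0 < d)%R /\ forall v, (Cmod v < d)%R -> L (x * Cexp v) = L x + v.
Proof.
  intros hDopen hL Hx. destruct (log_branch_continuous L D x hDopen hL Hx (/ 2)%R ltac:(lra)) as [d1 [Hd1 H1]].
  destruct (mul_exp_near x d1 Hd1) as [d2 [Hd2 H2]].
  exists (Rmin (/ 2) d2). split. apply Rmin_pos; lra.
  intros v Hv. rmin_facts.
  destruct (H1 (x * Cexp v - x)) as [HU Hd]. apply H2. lra.
  replace (x + (x * Cexp v - x)) with (x * Cexp v) in HU, Hd by ring.
  set (h := L (x * Cexp v) - L x - v).
  assert (Hh1 : Cexp h = 1).
  { unfold h, Cminus. rewrite !Cexp_plus, !Cexp_opp, (proj1 (hL _ HU)), (proj1 (hL _ Hx)). field.
    split. apply Cexp_neq_0. apply (log_branch_neq_0 L _ x hL Hx). }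
  assert (Hh2 : (Cmod h < 1)%R).
  { unfold h. eapply Rle_lt_trans. apply Cmod_triangle_minus. lra. }
  destruct (Cexp_eq_1 h Hh1) as [k Hk].
  assert (Hk0 : k = 0%Z).
  { destruct (Z.eq_dec k 0) as [E|E]; [exact E|exfalso].
    rewrite Hk, Cmod_mult, Cmod_R in Hh2. unfold tau in Hh2. rewrite Cmod_mult, Cmod_Ci, <- RtoC_mult, Cmod_R in Hh2.
    rewrite <- abs_IZR in Hh2. assert (1 <= IZR (Z.abs k))%R by (apply IZR_le; lia).
    pose proof PI_RGT_0. pose proof PI2_1. rewrite (Rabs_right (2 * PI)) in Hh2 by lra. nra. }
  subst k. replace (L (x * Cexp v)) with (h + L x + v) by (unfold h; ring). rewrite Hk. ring.
Qed.

(** * Blocks of parameters *)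

Lemma block_start_S (n : nat -> nat) (s : nat) : (1 <= s)%nat ->
  block_start n (S s) = (block_start n s + n s)%nat.
Proof.
  intros Hs. destruct s as [|s]; [lia|]. unfold block_start.
  replace (S (S s) - 1)%nat with (S s) by lia. replace (S s - 1)%nat with s by lia.
  rewrite seq_S, map_app. generalize (map n (seq 1 s)). intros l. simpl.
  induction l; simpl. lia. rewrite IHl. lia.
Qed.

Lemma block_cover (n : nat -> nat) (r j : nat) : (1 <= j <= block_start n (S r))%nat ->
  exists s k, (1 <= s <= r)%nat /\ (1 <= k <= n s)%nat /\ j = (block_start n s + k)%nat.
Proof.
  induction r; intros Hj. unfold block_start in Hj; simpl in Hj; lia.
  rewrite block_start_S in Hj by lia.
  destruct (le_lt_dec j (block_start n (S r))) as [H|H].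
  - destruct IHr as [s [k [Hs [Hk E]]]]. lia. exists s, k. repeat split; lia.
  - exists (S r), (j - block_start n (S r))%nat. repeat split; lia.
Qed.

Lemma block_le (n : nat -> nat) (r s : nat) : (1 <= s <= r)%nat ->
  (block_start n s + n s <= block_start n (S r))%nat.
Proof.
  induction r; intros Hs. lia. rewrite (block_start_S n (S r)) by lia.
  destruct (Nat.eq_dec s (S r)) as [->|H]. lia. specialize (IHr ltac:(lia)). lia.
Qed.

Lemma block_Csum (n : nat -> nat) (r : nat) (f : nat -> C) :
  Csum_nat (fun i => f (S i)) (block_start n (S r)) =
  Csum_nat (fun s => Csum_nat (fun k => f (block_start n (S s) + S k)%nat) (n (S s))) r.
Proof.
  induction r. reflexivity. rewrite block_start_S, Csum_nat_split, IHr by lia. simpl. f_equal.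
  apply Csum_nat_ext. intros i _. f_equal. lia.
Qed.

Lemma filter_all {A : Type} (f : A -> bool) (l : list A) :
  (forall x, In x l -> f x = true) -> filter f l = l.
Proof.
  induction l; intros H; simpl. reflexivity. rewrite H by (left; reflexivity). f_equal.
  apply IHl. intros; apply H; right; assumption.
Qed.

Lemma filter_none {A : Type} (f : A -> bool) (l : list A) :
  (forall x, In x l -> f x = false) -> filter f l = nil.
Proof.
  induction l; intros H; simpl. reflexivity. rewrite H by (left; reflexivity).
  apply IHl. intros; apply H; right; assumption.
Qed.

Lemma filter_outside (N m k : nat) : (m + k <= N)%nat ->
  filter (fun j => negb ((m + 1 <=? j) && (j <=? m + k))) (seq 1 N) =
  seq 1 m ++ seq (m + k + 1) (N - m - k).
Proof.
  intros H. replace N with (m + (k + (N - m - k)))%nat at 1 by lia.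
  rewrite !seq_app, !filter_app.
  rewrite (filter_all _ (seq 1 m)), (filter_none _ (seq (1 + m) k)), (filter_all _ (seq (1 + m + k) _)).
  - simpl. do 2 f_equal. lia.
  - intros x Hx. apply in_seq in Hx. destruct (Nat.leb_spec (m + 1) x); destruct (Nat.leb_spec x (m + k)); simpl; lia.
  - intros x Hx. apply in_seq in Hx. destruct (Nat.leb_spec (m + 1) x); destruct (Nat.leb_spec x (m + k)); simpl; lia.
  - intros x Hx. apply in_seq in Hx. destruct (Nat.leb_spec (m + 1) x); destruct (Nat.leb_spec x (m + k)); simpl; lia.
Qed.

(** * Meijer functions as solutions of the Euler equation *)

Lemma Cprod_list_neq_0 (f : C -> C) (l : list C) :
  (forall c, In c l -> f c <> 0) -> Cprod_list f l <> 0.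
Proof.
  induction l; intros H; simpl. apply RtoC_neq; lra.
  apply Cmult_neq_0. apply H. left; reflexivity. apply IHl. intros; apply H; right; assumption.
Qed.

(** Here m is the number of parameters before the block; [c (m + 1)] is the largest of the first
    group and [c (m + k)] the smallest, the leftmost pole. The last hypothesis keeps the 1/Gamma
    factors nonzero at the largest one, where the pole then has full order k. *)
Lemma meijer_solution (N m k : nat) (c : nat -> C) :
  (1 <= k)%nat -> (m + k <= N)%nat ->
  (forall i, (i < k)%nat -> exists n : nat, c (m + 1 + i)%nat = c (m + k)%nat + INR n) ->
  (forall i, (S i < k)%nat -> (Re (c (m + 1 + S i)%nat) <= Re (c (m + 1 + i)%nat))%R) ->
  (forall j, (1 <= j <= N)%nat -> (j <= m \/ m + k < j)%nat ->
     forall n : nat, 1 - c j + c (m + 1)%nat <> - INR n) ->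
  exists q : nat -> nat -> C,
    Ent q /\ (forall i, supp k (q i)) /\
    (forall i, opl (map c (seq 1 N)) (c (m + k)%nat + INR (S i)) (q (S i)) = fun j => (- (1)) ^ k * q i j) /\
    (opl (map c (seq 1 N)) (c (m + k)%nat) (q O) = fun _ => 0) /\
    (exists i, q i (k - 1)%nat <> 0) /\
    (k = 1%nat -> q O O <> 0 /\ q O O = Cprod_list (fun x => rGamma (1 - x + c (m + 1)%nat))
        (map c (seq 1 m ++ seq (m + k + 1) (N - m - k)))) /\
    (forall L x, meijerG L (map c (seq (m + 1) k))
       (map c (filter (fun j => negb ((m + 1 <=? j) && (j <=? m + k))) (seq 1 N))) x =
       Hser (c (m + k)%nat) k q (L x)).
Proof.
  intros Hk HN Hint Hre Hb. rewrite filter_outside by exact HN.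
  set (a := map c (seq (m + 1) k)). set (b := map c (seq 1 m ++ seq (m + k + 1) (N - m - k))).
  set (al := c (m + k)%nat) in *.
  assert (Hla : length a = k) by (unfold a; rewrite length_map, length_seq; reflexivity).
  assert (Hd : forall i, exists n : nat, (i < k)%nat -> c (m + 1 + i)%nat = al + INR n).
  { intros i. destruct (lt_dec i k) as [H|H]. destruct (Hint i H) as [n Hn]. exists n; auto. exists O; tauto. }
  apply choice in Hd. destruct Hd as [d Hd].
  assert (Hnth : forall i, (i < k)%nat -> nth i a 0 = c (m + 1 + i)%nat).
  { intros i Hi. unfold a. rewrite (nth_indep _ (RtoC 0) (c O)) by (rewrite length_map, length_seq; exact Hi).
    rewrite map_nth, seq_nth by exact Hi. reflexivity. }
  destruct (meijerG_Hser a b al d) as [q [HE [Hs [Hrec [H0 [Hnz [H1 HG]]]]]]].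
  - intros E. rewrite E in Hla. simpl in Hla. lia.
  - rewrite Hla. intros i Hi. rewrite Hnth by exact Hi. apply Hd, Hi.
  - rewrite Hla. intros i Hi. specialize (Hre i Hi). rewrite (Hd (S i)), (Hd i) in Hre by lia.
    apply INR_le. unfold Re in Hre; simpl in Hre. lra.
  - rewrite Hla. specialize (Hd (k - 1)%nat ltac:(lia)). replace (m + 1 + (k - 1))%nat with (m + k)%nat in Hd by lia.
    fold al in Hd. apply INR_eq, RtoC_inj. replace (RtoC (INR (d (k - 1)%nat))) with (al + INR (d (k - 1)%nat) - al) by ring.
    rewrite <- Hd. simpl. ring.
  - rewrite Hla in *. rewrite Hnth in Hnz by lia. rewrite Nat.add_0_r in Hnz.
    assert (Hp : Permutation (a ++ b) (map c (seq 1 N))).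
    { unfold a, b. rewrite <- map_app. apply Permutation_map.
      replace N with (m + (k + (N - m - k)))%nat at 2 by lia. rewrite !seq_app.
      replace (1 + m)%nat with (m + 1)%nat by lia. replace (m + 1 + k)%nat with (m + k + 1)%nat by lia.
      apply Permutation_app_swap_app. }
    assert (Hbnz : Cprod_list (fun x => rGamma (1 - x + c (m + 1)%nat)) b <> 0).
    { apply Cprod_list_neq_0. intros x Hx. apply rGamma_neq_0. unfold b in Hx. apply in_map_iff in Hx.
      destruct Hx as [j [E Hj]]. subst x. apply in_app_or in Hj. rewrite !in_seq in Hj. apply Hb; lia. }
    specialize (Hnz Hbnz).
    exists q. split. exact HE. split. exact Hs. split; [|split; [|split; [|split]]].
    + intros i. rewrite <- (opl_perm _ _ _ _ Hp). apply Hrec.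
    + rewrite <- (opl_perm _ _ _ _ Hp). exact H0.
    + exists (d O). exact Hnz.
    + intros Hk1. specialize (H1 Hk1). assert (Eal : al = c (m + 1)%nat) by (unfold al; rewrite Hk1; reflexivity).
      rewrite Eal in H1. split; [|exact H1].
      rewrite H1. exact Hbnz.
    + intros L x. apply HG.
Qed.

Lemma sign_cases (k : nat) : (- (1)) ^ k = 1 \/ (- (1)) ^ k = - (1).
Proof.
  induction k as [|k [IH|IH]]. left; reflexivity.
  right. rewrite Cpow_S, IH. ring. left. rewrite Cpow_S, IH. ring.
Qed.

Lemma sym_hull_sign (D : C -> Prop) (k : nat) (z : C) : D z -> sym_hull D ((- (1)) ^ k * z).
Proof.
  intros H. destruct (sign_cases k) as [->| ->].
  - left. replace (1 * z) with z by ring. exact H.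
  - right. replace (- (- (1) * z)) with z by ring. exact H.
Qed.

(** z d/dz becomes d/du under u = L((-1)^k z), and the sign of the recurrence cancels against that
    of the argument: (-1)^k e^u = z. *)
Lemma solution_euler (N k : nat) (al : C) (c : nat -> C) (q : nat -> nat -> C) (L : C -> C) (D : C -> Prop) :
  open D -> log_branch_on L (sym_hull D) ->
  Ent q -> (forall i, supp k (q i)) ->
  (forall i, opl (map c (seq 1 N)) (al + INR (S i)) (q (S i)) = fun j => (- (1)) ^ k * q i j) ->
  (opl (map c (seq 1 N)) al (q O) = fun _ => 0) ->
  exists g : nat -> C -> C,
    g O = (fun z => Hser al k q (L ((- (1)) ^ k * z))) /\
    (forall i z, D z -> exists d, cder (g i) z d /\ g (S i) z = z * d - c (S i) * g i z) /\
    (forall z, D z -> g N z = z * g O z).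
Proof.
  intros HD HL HE Hs Hrec H0.
  exists (fun i z => Hser al k (opit al c q i) (L ((- (1)) ^ k * z))).
  split. reflexivity. split.
  - intros i z Hz. destruct (opit_Ent_supp al c k q i HE Hs) as [HEi Hsi].
    pose proof (sym_hull_sign D k z Hz) as HU. set (s := (- (1)) ^ k) in *.
    destruct (Hser_step al (c (S i)) k (opit al c q i) (L (s * z)) HEi Hsi) as [d0 [Hd0 E]].
    exists (d0 * (/ (s * z) * (s * 1))). split.
    + apply (cder_comp (Hser al k (opit al c q i)) (fun z => L (s * z))). exact Hd0.
      apply (cder_comp L (fun z => s * z)). apply (log_branch_cder L D); assumption.
      apply (cder_scal s (fun x => x)), cder_id.
    + assert (Hnz := log_branch_neq_0 L _ _ HL HU).
      replace (z * (d0 * (/ (s * z) * (s * 1)))) with d0.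
      exact E. assert (s <> 0) by (intros E'; apply Hnz; rewrite E'; ring).
      assert (z <> 0) by (intros E'; apply Hnz; rewrite E'; ring). field. auto.
  - intros z Hz. destruct (opit_Ent_supp al c k q N HE Hs) as [HEN HsN].
    pose proof (sym_hull_sign D k z Hz) as HU.
    rewrite (Hser_recurrence al ((- (1)) ^ k) k q (opit al c q N)); auto.
    + rewrite (proj1 (HL _ HU)). rewrite (Cmult_assoc ((- (1)) ^ k)), <- Cpow_mult_l.
      replace (- (1) * - (1)) with (RtoC 1) by ring. rewrite Cpow_1_l. simpl opit. ring.
    + intros i. rewrite opit_opl. apply Hrec.
    + rewrite opit_opl. simpl INR. replace (al + 0) with al by ring. exact H0.
Qed.

(** * The hypergeometric case k = 1 *)

Lemma opl_supp_1 (l : list C) (w : C) (q : nat -> C) : supp 1 q ->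
  opl l w q O = Cprod_list (fun c => w - c) l * q O.
Proof.
  intros H. induction l; simpl. ring. unfold op. rewrite IHl, (supp_opl 1 l w q H 1%nat) by lia. ring.
Qed.

(** Inversion is total with / 0 = 0, so the reciprocal of a product of [Gamma] values can be
    rewritten through [rGamma] without side conditions. *)
Lemma Cinv_mult_total (x y : C) : / (x * y) = / x * / y.
Proof.
  assert (H0 : / (RtoC 0) = 0).
  { unfold Cinv, RtoC; simpl. f_equal; unfold Rdiv; ring. }
  destruct (Ceq_dec x 0) as [->|Hx]. rewrite Cmult_0_l, H0. ring.
  destruct (Ceq_dec y 0) as [->|Hy]. rewrite Cmult_0_r, H0. ring.
  field. auto.
Qed.

Lemma Cprod_nat_inv_Gamma (f : nat -> C) (n : nat) :
  / Cprod_nat (fun i => Gamma (f i)) n = Cprod_nat (fun i => rGamma (f i)) n.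
Proof.
  induction n; simpl. field. rewrite Cinv_mult_total, IHn. unfold Gamma. rewrite Cinv_invol. reflexivity.
Qed.

Lemma Cprod_nat_list (f : C -> C) (c : nat -> C) (n : nat) :
  Cprod_nat (fun i => f (c (S i))) n = Cprod_list f (map c (seq 1 n)).
Proof.
  induction n. reflexivity. rewrite seq_S, map_app, Cprod_list_app, <- IHn. simpl. ring.
Qed.

Lemma Cprod_list_map (f : C -> C) (g : nat -> C) (l : list nat) :
  Cprod_list f (map g l) = fold_right (fun j acc => f (g j) * acc) 1 l.
Proof. induction l; simpl. reflexivity. rewrite IHl. reflexivity. Qed.

Lemma Cprod_list_split (f : C -> C) (c : nat -> C) (N m : nat) : (m + 1 <= N)%nat ->
  Cprod_list f (map c (seq 1 N)) =
  f (c (m + 1)%nat) * Cprod_list f (map c (seq 1 m ++ seq (m + 1 + 1) (N - m - 1))).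
Proof.
  intros H. replace N with (m + (1 + (N - m - 1)))%nat at 1 by lia.
  rewrite seq_app, !map_app, !Cprod_list_app. simpl (seq (1 + m) (1 + _)). simpl map.
  replace (S m) with (m + 1)%nat by lia. replace (S (m + 1)) with (m + 1 + 1)%nat by lia. simpl. ring.
Qed.

(* For k = 1 the recurrence is scalar and is solved by the coefficients of 0F(N-1). *)
Lemma hypergeometric_solution (N m : nat) (c : nat -> C) (q : nat -> nat -> C) (Lx zeta : C) :
  (m + 1 <= N)%nat ->
  (forall j, (1 <= j <= N)%nat -> (j <= m \/ m + 1 < j)%nat ->
     forall n : nat, 1 - c j + c (m + 1)%nat <> - INR n) ->
  Ent q -> (forall i, supp 1 (q i)) -> q O O <> 0 ->
  (forall i, opl (map c (seq 1 N)) (c (m + 1)%nat + INR (S i)) (q (S i)) = fun j => (- (1)) ^ 1 * q i j) ->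
  Cexp Lx = - zeta ->
  Hser (c (m + 1)%nat) 1 q Lx = Cexp (c (m + 1)%nat * Lx) * q O O *
    hyp0F (map (fun j => 1 - c j + c (m + 1)%nat) (seq 1 m ++ seq (m + 1 + 1) (N - m - 1))) zeta.
Proof.
  intros HN Hb HE Hs Hq0 Hrec Hx. set (al := c (m + 1)%nat) in *.
  set (l := seq 1 m ++ seq (m + 1 + 1) (N - m - 1)).
  assert (Hlin : forall j, In j l -> forall n : nat, 1 - c j + al <> - INR n).
  { intros j Hj. unfold l in Hj. apply in_app_or in Hj. rewrite !in_seq in Hj. apply Hb; lia. }
  set (P := fun i => Cprod_list (fun b => poch b i) (map (fun j => 1 - c j + al) l)).
  assert (HP : forall i, P i <> 0).
  { intros i. apply Cprod_list_neq_0. intros b Hbm. apply in_map_iff in Hbm. destruct Hbm as [j [<- Hj]].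
    unfold poch. induction i; simpl. apply RtoC_neq; lra. apply Cmult_neq_0. exact IHi.
    intros E. apply (Hlin j Hj i). replace (1 - c j + al) with (1 - c j + al + INR i - INR i) by ring. rewrite E. ring. }
  assert (HPS : forall i, P (S i) = P i * Cprod_list (fun x => al + INR (S i) - x) (map c l)).
  { intros i. unfold P. rewrite !Cprod_list_map. clear. induction l as [|j l IH]; cbn [fold_right]. ring.
    rewrite IH. change (poch (1 - c j + al) (S i)) with (poch (1 - c j + al) i * (1 - c j + al + INR i)).
    rewrite RtoC_INR_S. ring. }
  (* The factor belonging to al itself is i + 1 and builds the factorial; the other N - 1 factors
     build the Pochhammer products. *)
  assert (Hq : forall i, q i O = (- (1)) ^ i * q O O / (INR (fact i) * P i)).
  { induction i.
    - replace (P O) with (RtoC 1). simpl. field. unfold P. rewrite Cprod_list_map. clear.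
      induction l as [|j l IH]; simpl. reflexivity. rewrite <- IH. unfold poch; simpl. ring.
    - pose proof (f_equal (fun g => g O) (Hrec i)) as E. cbv beta in E.
      rewrite opl_supp_1 in E by apply Hs. rewrite (Cprod_list_split _ c N m HN) in E.
      fold al l in E. rewrite IHi in E.
      assert (HX : Cprod_list (fun x => al + INR (S i) - x) (map c l) <> 0).
      { intros E0. apply (HP (S i)). rewrite HPS, E0. ring. }
      rewrite HPS. set (X := Cprod_list (fun x => al + INR (S i) - x) (map c l)) in *.
      replace (al + INR (S i) - al) with (RtoC (INR (S i))) in E by ring.
      assert (HS := RtoC_INR_S_neq_0 i). assert (HF := INR_fact_neq_0' i).
      rewrite fact_simpl, mult_INR, RtoC_mult.
      replace (q (S i) O) with (INR (S i) * X * q (S i) O / (INR (S i) * X)) by (field; auto).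
      rewrite E. simpl (_ ^ 1). rewrite Cpow_S. field. repeat split; auto. }
  assert (Hc : cser (fun i => zeta ^ i / (INR (fact i) * P i)) (/ (Cexp (al * Lx) * q O O) * Hser al 1 q Lx)).
  { apply (cser_ext (fun i => / (Cexp (al * Lx) * q O O) * Hterm al 1 q i Lx)).
    - intros i. rewrite Hterm_1, (Hq i).
      replace ((al + INR i) * Lx) with (al * Lx + INR i * Lx) by ring.
      rewrite Cexp_plus, <- Cexp_pow, Hx. replace (- zeta) with (- (1) * zeta) by ring. rewrite Cpow_mult_l.
      (* The sign (-1)^i of the coefficients cancels that of (-zeta)^i. *)
      assert (Hsq : (- (1)) ^ i * (- (1)) ^ i = 1).
      { rewrite <- Cpow_mult_l. replace (- (1) * - (1)) with (RtoC 1) by ring. apply Cpow_1_l. }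
      revert Hsq. generalize ((- (1)) ^ i). intros sg Hsq.
      assert (HF := INR_fact_neq_0' i). assert (HX := Cexp_neq_0 (al * Lx)). assert (HPi := HP i).
      revert HF HX HPi. generalize (RtoC (INR (fact i))) (Cexp (al * Lx)) (P i) (zeta ^ i). intros.
      transitivity (sg * sg * (c3 / (c0 * c2))). field. auto. rewrite Hsq. ring.
    - apply cser_scal, Hser_cser, HE. }
  change (hyp0F (map (fun j => 1 - c j + al) l) zeta) with (Cseries (fun i => zeta ^ i / (INR (fact i) * P i))).
  rewrite (Cseries_unique _ _ Hc). field. split. exact Hq0. apply Cexp_neq_0.
Qed.

(** * Assembly over the blocks and the change of variable *)

Lemma open_mul_exp (D : C -> Prop) (z : C) : open D -> D z ->
  exists d, (0 < d)%R /\ forall v, (Cmod v < d)%R -> D (z * Cexp v).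
Proof.
  intros HD Hz. destruct (open_Cmod D z HD Hz) as [d1 [Hd1 H1]].
  destruct (mul_exp_near z d1 Hd1) as [d [Hd H]]. exists d. split. exact Hd. intros v Hv.
  replace (z * Cexp v) with (z + (z * Cexp v - z)) by ring. apply H1, H, Hv.
Qed.

Lemma Re_div_INR (z : C) (N : nat) : (1 <= N)%nat -> Re (z / INR N) = (Re z / INR N)%R.
Proof.
  intros H. assert (INR N <> 0%R) by (apply not_0_INR; lia).
  unfold Cdiv. rewrite <- RtoC_inv by assumption. destruct z. unfold Re; simpl. unfold Rdiv. ring.
Qed.

Theorem theorem4p3
  (N : nat) (lam : nat -> C) (r : nat) (n : nat -> nat)
  (hr : (1 <= r)%nat)
  (hn : forall s, (1 <= s <= r)%nat -> (1 <= n s)%nat)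
  (hN : block_start n (S r) = N)
  (hblocks : forall s s' j j', (1 <= s <= r)%nat -> (1 <= s' <= r)%nat ->
      in_block n s j -> in_block n s' j' ->
      (s = s' -> isZ ((lam j - lam j') / INR N)) /\
      (s <> s' -> ~ isZ ((lam j - lam j') / INR N)))
  (hord : forall s k, (1 <= s <= r)%nat -> (1 <= k < n s)%nat ->
      (Re (lam (block_start n s + S k)%nat) <= Re (lam (block_start n s + k)%nat))%R)
  (L : C -> C) (D : C -> Prop)
  (hDopen : open D) (hDne : exists z, D z)
  (hL : log_branch_on L (fun w => D w \/ D (- w)))
  (eta : nat -> C -> C)
  (heta : forall s k, (1 <= s <= r)%nat -> (1 <= k <= n s)%nat ->
      eta (block_start n s + k)%nat =
      (fun zeta => meijerG L
         (map (fun j => lam j / INR N) (seq (block_start n s + 1)%nat k))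
         (map (fun j => lam j / INR N)
            (filter (fun j => negb ((block_start n s + 1 <=? j) && (j <=? block_start n s + k)))
                    (seq 1 N)))
         ((- 1) ^ k * zeta))) :
  fundamental_system
    (fun f => exists h, euler_apply (fun j => lam j / INR N) N D f h /\
                        forall zeta, D zeta -> h zeta - zeta * f zeta = 0)
    N D eta
  /\
  (forall s, (1 <= s <= r)%nat -> forall zeta, D zeta ->
     eta (block_start n s + 1)%nat zeta =
       Cpowb L (- zeta) (lam (block_start n s + 1)%nat / INR N)
       / Cprod_nat (fun i => Gamma (1 + (lam (block_start n s + 1)%nat - lam (S i)) / INR N)) N
       * hyp0F (map (fun j => 1 + (lam (block_start n s + 1)%nat - lam j) / INR N)
                    (filter (fun j => negb (j =? block_start n s + 1)) (seq 1 N)))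
               zeta)
  /\
  (forall mu : C, mu <> 0 -> forall E : C -> Prop, open E -> (exists z, E z) ->
     (forall z, E z -> D (mu * (z / INR N) ^ N)) ->
     fundamental_system
       (fun y => exists h, euler_apply lam N E y h /\
                           forall z, E z -> h z / z ^ N = mu * y z)
       N E (fun j z => eta j (mu * (z / INR N) ^ N))).
Proof.
  set (c := fun j => lam j / INR N).
  set (bs := block_start n) in *.
  change (log_branch_on L (sym_hull D)) in hL.
  assert (HN1 : (1 <= N)%nat).
  { pose proof (block_le n r 1 ltac:(lia)). specialize (hn 1%nat ltac:(lia)). fold bs in H. lia. }
  assert (HNC : RtoC (INR N) <> 0) by (apply RtoC_neq, not_0_INR; lia).
  assert (HNR : (0 < INR N)%R) by (apply lt_0_INR; lia).
  assert (Hblk : forall s k, (1 <= s <= r)%nat -> (1 <= k <= n s)%nat -> in_block n s (bs s + k)%nat)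
    by (intros s k Hs Hk; unfold in_block; fold bs; lia).
  assert (HleN : forall s k, (1 <= s <= r)%nat -> (1 <= k <= n s)%nat -> (bs s + k <= N)%nat).
  { intros s k Hs Hk. pose proof (block_le n r s Hs). fold bs in H. lia. }
  assert (Hcdiff : forall i j, c i - c j = (lam i - lam j) / INR N) by (intros; unfold c, Cdiv; ring).
  assert (Hsame : forall s k k', (1 <= s <= r)%nat -> (1 <= k <= n s)%nat -> (1 <= k' <= n s)%nat ->
     isZ (c (bs s + k)%nat - c (bs s + k')%nat)).
  { intros s k k' Hs Hk Hk'. rewrite Hcdiff. apply (hblocks s s); auto. }
  assert (Hdiff : forall s s' k k', (1 <= s <= r)%nat -> (1 <= s' <= r)%nat -> s <> s' ->
     (1 <= k <= n s)%nat -> (1 <= k' <= n s')%nat -> ~ isZ (c (bs s + k)%nat - c (bs s' + k')%nat)).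
  { intros s s' k k' Hs Hs' Hne Hk Hk'. rewrite Hcdiff. apply (hblocks s s'); auto. }
  assert (Hmono : forall s k, (1 <= s <= r)%nat -> (1 <= k < n s)%nat ->
     (Re (c (bs s + S k)%nat) <= Re (c (bs s + k)%nat))%R).
  { intros s k Hs Hk. unfold c. rewrite !Re_div_INR by exact HN1. unfold Rdiv. apply Rmult_le_compat_r.
    left; apply Rinv_0_lt_compat, HNR. apply hord; assumption. }
  (* Integer differences and decreasing real parts together give nonnegative integers. *)
  assert (Hnat : forall s k k', (1 <= s <= r)%nat -> (1 <= k <= k')%nat -> (k' <= n s)%nat ->
     exists i : nat, c (bs s + k)%nat = c (bs s + k')%nat + INR i).
  { intros s k k' Hs Hk Hk'.
    assert (Hle : (Re (c (bs s + k')%nat) <= Re (c (bs s + k)%nat))%R).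
    { destruct Hk as [Hk1 Hk2]. revert Hk'. induction Hk2; intros Hk'. lra.
      specialize (IHHk2 ltac:(lia)). specialize (Hmono s m Hs ltac:(lia)). lra. }
    destruct (Hsame s k k' Hs ltac:(lia) ltac:(lia)) as [z Hz].
    assert (Hz0 : (0 <= z)%Z).
    { apply le_IZR. apply (f_equal Re) in Hz. rewrite Re_minus in Hz.
      change (Re (RtoC (IZR z))) with (IZR z) in Hz. lra. }
    exists (Z.to_nat z). rewrite INR_IZR_INZ, Z2Nat.id by exact Hz0. rewrite <- Hz. ring. }
  (* No 1/Gamma factor vanishes at the largest parameter of the block: within the block the argument
     is 1 + t with t >= 0, and for other blocks it is not an integer. *)
  assert (Hout : forall s k, (1 <= s <= r)%nat -> (1 <= k <= n s)%nat ->
     forall j, (1 <= j <= N)%nat -> (j <= bs s \/ bs s + k < j)%nat ->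
     forall i : nat, 1 - c j + c (bs s + 1)%nat <> - INR i).
  { intros s k Hs Hk j Hj Hjo i E.
    destruct (block_cover n r j) as [s' [k' [Hs' [Hk' Ej]]]]. fold bs. rewrite hN. exact Hj.
    fold bs in Ej. subst j.
    destruct (Nat.eq_dec s' s) as [->|Hne].
    - destruct (Hnat s 1%nat k' Hs ltac:(lia) ltac:(lia)) as [t Ht]. rewrite Ht in E.
      replace (1 - c (bs s + k')%nat + (c (bs s + k')%nat + INR t)) with (RtoC (1 + INR t)) in E by (rewrite RtoC_plus; ring).
      rewrite <- RtoC_opp in E. apply RtoC_inj in E. pose proof (pos_INR t). pose proof (pos_INR i). lra.
    - apply (Hdiff s s' 1%nat k' Hs Hs' ltac:(lia) ltac:(lia) Hk').
      exists (- (1 + Z.of_nat i))%Z. rewrite opp_IZR, plus_IZR, <- INR_IZR_INZ, RtoC_opp, RtoC_plus.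
      replace (c (bs s + 1)%nat - c (bs s' + k')%nat) with (1 - c (bs s' + k')%nat + c (bs s + 1)%nat - 1) by ring.
      rewrite E. ring. }
  assert (Hsol : forall s k, (1 <= s <= r)%nat -> (1 <= k <= n s)%nat ->
     exists q : nat -> nat -> C,
      Ent q /\ (forall i, supp k (q i)) /\
      (forall i, opl (map c (seq 1 N)) (c (bs s + k)%nat + INR (S i)) (q (S i)) = fun j => (- (1)) ^ k * q i j) /\
      (opl (map c (seq 1 N)) (c (bs s + k)%nat) (q O) = fun _ => 0) /\
      (exists i, q i (k - 1)%nat <> 0) /\
      (k = 1%nat -> q O O <> 0 /\ q O O = Cprod_list (fun x => rGamma (1 - x + c (bs s + 1)%nat))
        (map c (seq 1 (bs s) ++ seq (bs s + k + 1) (N - bs s - k)))) /\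
      eta (bs s + k)%nat = fun z => Hser (c (bs s + k)%nat) k q (L ((- (1)) ^ k * z))).
  { intros s k Hs Hk.
    destruct (meijer_solution N (bs s) k c) as [q [H1 [H2 [H3 [H4 [H5 [H6 H7]]]]]]].
    - lia.
    - apply HleN; assumption.
    - intros i Hi. rewrite <- Nat.add_assoc. apply Hnat; lia.
    - intros i Hi. rewrite <- !Nat.add_assoc. apply Hmono; lia.
    - apply Hout; assumption.
    - exists q. repeat (split; [assumption|]).
      rewrite (heta s k Hs Hk). apply functional_extensionality. intros z.
      etransitivity; [exact (H7 L _)|].
      replace (RtoC (-1)) with (- (1)) by (rewrite <- RtoC_opp; reflexivity). reflexivity. }
  assert (Heuler : forall j, (1 <= j <= N)%nat -> exists g : nat -> C -> C,
    g O = eta j /\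
    (forall i z, D z -> exists d, cder (g i) z d /\ g (S i) z = z * d - c (S i) * g i z) /\
    (forall z, D z -> g N z = z * g O z)).
  { intros j Hj. destruct (block_cover n r j) as [s [k [Hs [Hk Ej]]]]. fold bs; rewrite hN; exact Hj.
    fold bs in Ej. subst j. destruct (Hsol s k Hs Hk) as [q [H1 [H2 [H3 [H4 [_ [_ H7]]]]]]]. rewrite H7.
    apply (solution_euler N k (c (bs s + k)%nat) c q L D); assumption. }
  (* The relation is assumed only on points z0 e^v with v small, a form that serves both the
     original equation and its pullback. *)
  assert (Hindep : forall (z0 : C) (cf : nat -> C) (d : R), D z0 -> (0 < d)%R ->
     (forall v, (Cmod v < d)%R -> Csum_nat (fun i => cf (S i) * eta (S i) (z0 * Cexp v)) N = 0) ->
     forall j, (1 <= j <= N)%nat -> cf j = 0).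
  { intros z0 cf d Hz0 Hd Hzero.
    set (w := fun s => Cexp (c (bs s + 1)%nat * tau)).
    (* [choice] wants a total family indexed by pairs; [zf] fills the pairs outside the blocks. *)
    assert (HF : forall p : nat * nat, exists F : C -> C, (1 <= fst p <= r)%nat -> (1 <= snd p <= n (fst p))%nat ->
       entire F /\ Titer (w (fst p)) (snd p) F = zf /\ Titer (w (fst p)) (snd p - 1) F <> zf /\
       forall z, eta (bs (fst p) + snd p)%nat z = F (L ((- (1)) ^ snd p * z))).
    { intros [s k]. cbn [fst snd].
      destruct (excluded_middle_informative ((1 <= s <= r)%nat /\ (1 <= k <= n s)%nat)) as [[Hs Hk]|Hno].
      2: { exists zf. intros; exfalso; tauto. }
      destruct (Hsol s k Hs Hk) as [q [H1 [_ [_ [_ [[i Hi] [_ H7]]]]]]].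
      exists (Hser (c (bs s + k)%nat) k q). intros _ _.
      (* Parameters of one block differ by integers, so the first of them and the leftmost pole give
         the same eigenvalue. *)
      assert (Hw : w s = Cexp (c (bs s + k)%nat * tau)).
      { unfold w. destruct (Hsame s 1%nat k Hs ltac:(lia) Hk) as [z Hz].
        replace (c (bs s + 1)%nat * tau) with (c (bs s + k)%nat * tau + IZR z * tau) by (rewrite <- Hz; ring).
        rewrite Cexp_plus, Cexp_tau_IZR. ring. }
      rewrite Hw. split.
      - intros u0 rho Hrho. apply Sc_Hser; assumption.
      - destruct k as [|K]; [lia|]. rewrite Nat.sub_succ, Nat.sub_0_r in Hi |- *.
        destruct (Hser_chain (c (bs s + S K)%nat) K q i H1 Hi) as [Hc1 Hc2].
        split. exact Hc1. split. exact Hc2. rewrite H7. reflexivity. }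
    apply choice in HF. destruct HF as [F HF].
    assert (HF' : forall s k, (s < r)%nat -> (k < n (S s))%nat ->
       entire (F (S s, S k)) /\ Titer (w (S s)) (S k) (F (S s, S k)) = zf /\ Titer (w (S s)) k (F (S s, S k)) <> zf /\
       forall z, eta (bs (S s) + S k)%nat z = F (S s, S k) (L ((- (1)) ^ S k * z))).
    { intros s k Hs Hk. specialize (HF (S s, S k)). cbn [fst snd] in HF. rewrite Nat.sub_succ, Nat.sub_0_r in HF.
      apply HF; lia. }
    clear HF.
    (* The base value of the branch depends on the parity of k; one radius serves both parities. *)
    set (lk := fun k => L ((- (1)) ^ k * z0)).
    assert (Hlk : exists d', (0 < d')%R /\ forall k v, (Cmod v < d')%R -> L ((- (1)) ^ k * (z0 * Cexp v)) = lk k + v).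
    { destruct (log_branch_mul_exp L D (1 * z0) hDopen hL) as [d1 [Hd1 H1]]. exact (sym_hull_sign D 0 z0 Hz0).
      destruct (log_branch_mul_exp L D (- (1) * z0) hDopen hL) as [d2 [Hd2 H2]].
      { right. replace (- (- (1) * z0)) with z0 by ring. exact Hz0. }
      exists (Rmin d1 d2). split. apply Rmin_pos; assumption. intros k v Hv.
      rmin_facts. unfold lk. rewrite Cmult_assoc.
      destruct (sign_cases k) as [-> | ->]. apply H1; lra. apply H2; lra. }
    destruct Hlk as [d' [Hd' Hlk]].
    set (G := fun s u => Csum_nat (fun k => cf (bs (S s) + S k)%nat * F (S s, S k) (u + lk (S k))) (n (S s))).
    (* The relation holds for small u and extends to the whole plane because every summand is
       entire. *)
    assert (Htot : forall u, Csum_nat (fun s => G s u) r = 0).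
    { apply (entire_zero _ 0 (Rmin d d')).
      - apply (entire_Csum G). intros s Hs. unfold G.
        apply (entire_Csum (fun k u => cf (bs (S s) + S k)%nat * F (S s, S k) (u + lk (S k)))). intros k Hk.
        apply (entire_scal _ (fun u => F (S s, S k) (u + lk (S k)))), entire_shift. apply HF'; assumption.
      - apply Rmin_pos; assumption.
      - intros e He. rmin_facts.
        etransitivity; [|apply (Hzero e); lra]. rewrite <- hN. unfold bs.
        rewrite (block_Csum n r (fun i => cf i * eta i (z0 * Cexp e))).
        apply Csum_nat_ext. intros s Hs. apply Csum_nat_ext. intros k Hk. fold bs.
        rewrite (proj2 (proj2 (proj2 (HF' s k Hs Hk)))), Hlk by lra.
        replace (0 + e + lk (S k)) with (lk (S k) + e) by ring. reflexivity. }
    assert (HG0 : forall s, (s < r)%nat -> G s = zf).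
    { apply (eigenspaces_sum r (fun s => w (S s)) (fun s => n (S s)) G).
      (* Equal eigenvalues would make the difference of the two first parameters an integer,
         contrary to the separation of blocks. *)
      - intros s s' Hs Hs' Hne Ew.
        pose proof (hn (S s) ltac:(lia)). pose proof (hn (S s') ltac:(lia)).
        apply (Hdiff (S s) (S s') 1%nat 1%nat); try lia. unfold w in Ew.
        destruct (Cexp_eq_1 ((c (bs (S s) + 1)%nat - c (bs (S s') + 1)%nat) * tau)) as [z Hz].
        + replace ((c (bs (S s) + 1)%nat - c (bs (S s') + 1)%nat) * tau) with
            (c (bs (S s) + 1)%nat * tau + - (c (bs (S s') + 1)%nat * tau)) by ring.
          rewrite Cexp_plus, Cexp_opp, Ew. field. apply Cexp_neq_0.
        + exists z. pose proof tau_neq_0.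
          replace (c (bs (S s) + 1)%nat - c (bs (S s') + 1)%nat) with
            ((c (bs (S s) + 1)%nat - c (bs (S s') + 1)%nat) * tau / tau) by (field; assumption).
          rewrite Hz. field. assumption.
      - intros s Hs. unfold G. rewrite (Titer_Csum _ (fun k u => cf (bs (S s) + S k)%nat * F (S s, S k) (u + lk (S k)))).
        apply functional_extensionality. intros u. apply Csum_nat_0. intros k Hk.
        rewrite (Titer_scal _ _ (fun u => F (S s, S k) (u + lk (S k)))), Titer_shift.
        rewrite (Titer_le _ (S k)). unfold zf. ring. lia. apply HF'; assumption.
      - apply functional_extensionality. exact Htot. }
    intros j Hj. destruct (block_cover n r j) as [s [k [Hs [Hk Ej]]]]. fold bs; rewrite hN; exact Hj.
    fold bs in Ej. subst j. destruct s as [|s]; [lia|]. destruct k as [|k]; [lia|].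
    (* Translating by the constants [lk] commutes with T - w, so it preserves the exact order of
       each generalized eigenfunction. *)
    apply (chain_indep (w (S s)) (n (S s)) (fun k u => F (S s, S k) (u + lk (S k))) (fun k => cf (bs (S s) + S k)%nat)).
    - intros i Hi. destruct (HF' s i ltac:(lia) Hi) as [_ [H1 [H2 _]]]. rewrite !Titer_shift. split.
      + rewrite H1. reflexivity.
      + intros E. apply H2. apply functional_extensionality. intros u.
        apply (f_equal (fun g => g (u - lk (S i)))) in E. cbv beta in E.
        replace (u - lk (S i) + lk (S i)) with u in E by ring. exact E.
    - apply (HG0 s). lia.
    - lia. }
  split; [|split].
  - split.
    + intros j Hj. destruct (Heuler j Hj) as [g [H0 [H1 H2]]]. exists (g N). split.
      * exists g. split. exact H0. split; [|reflexivity]. intros i _ z Hz. destruct (H1 i z Hz) as [d [Hd E]].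
        exists d. split. apply cder_is_derive, Hd. exact E.
      * intros z Hz. rewrite (H2 z Hz), H0. ring.
    + intros cf Hcf j Hj. destruct hDne as [z0 Hz0]. destruct (open_mul_exp D z0 hDopen Hz0) as [d [Hd Hv]].
      apply (Hindep z0 cf d Hz0 Hd); auto.
  - intros s Hs zeta Hz. specialize (hn s Hs).
    destruct (Hsol s 1%nat Hs ltac:(lia)) as [q [H1 [H2 [H3 [_ [_ [H6 H7]]]]]]].
    destruct (H6 eq_refl) as [Hq0 Hq]. rewrite H7.
    replace ((- (1)) ^ 1 * zeta) with (- zeta) by (simpl; ring).
    assert (HNs := HleN s 1%nat Hs ltac:(lia)).
    rewrite (hypergeometric_solution N (bs s) c q (L (- zeta)) zeta HNs); auto.
    + unfold Cpowb, Cdiv at 1. fold (c (bs s + 1)%nat).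
      rewrite (Cprod_nat_inv_Gamma (fun i => 1 + (lam (bs s + 1)%nat - lam (S i)) / INR N)).
      f_equal; [f_equal|f_equal].
      * rewrite Hq.
        transitivity (Cprod_list (fun x => rGamma (1 - x + c (bs s + 1)%nat)) (map c (seq 1 N))).
        -- rewrite (Cprod_list_split _ c N (bs s) HNs).
           replace (1 - c (bs s + 1)%nat + c (bs s + 1)%nat) with (RtoC 1) by ring. rewrite rGamma_1. ring.
        -- rewrite <- (Cprod_nat_list (fun x => rGamma (1 - x + c (bs s + 1)%nat))). f_equal.
           apply functional_extensionality. intros i. f_equal. rewrite <- Hcdiff. ring.
      * rewrite (filter_ext _ (fun j => negb ((bs s + 1 <=? j) && (j <=? bs s + 1)))).
        rewrite filter_outside by exact HNs. apply map_ext. intros j. rewrite <- Hcdiff. ring.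
        intros j. f_equal. destruct (Nat.eqb_spec j (bs s + 1)); destruct (Nat.leb_spec (bs s + 1) j); destruct (Nat.leb_spec j (bs s + 1)); simpl; lia.
    + apply (Hout s 1%nat); [assumption|lia].
    + apply hL. right. replace (- - zeta) with zeta by ring. exact Hz.
  - intros mu Hmu E HE [z0 Hz0] HED. set (phi := fun z => mu * (z / INR N) ^ N).
    (* At z = 0 the argument of eta would be 0, where no logarithm exists. *)
    assert (Hz : forall z, E z -> z <> 0).
    { intros z Hz ->. apply (log_branch_neq_0 L (sym_hull D) (phi 0) hL). left. apply HED, Hz.
      unfold phi. destruct N as [|N']; [lia|]. rewrite Cpow_S. unfold Cdiv. ring. }
    (* z d/dz of a composite with phi is N times the Euler derivative taken at phi(z). *)
    assert (Hphi : forall z, exists d, cder phi z d /\ z * d = INR N * phi z).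
    { intros z. destruct N as [|N']; [lia|].
      exists (mu * (INR (S N') * (/ INR (S N') * z) ^ N' * (/ INR (S N') * 1))). split.
      - apply (cder_ext_loc (fun z => mu * (/ INR (S N') * z) ^ S N')).
        exists 1%R. split. lra. intros. unfold phi, Cdiv. rewrite (Cmult_comm (/ _)). reflexivity.
        apply cder_scal. apply (cder_comp (fun x => x ^ S N') (fun z => / INR (S N') * z)). apply cder_pow.
        apply (cder_scal (/ INR (S N')) (fun x => x)), cder_id.
      - unfold phi. rewrite Cpow_S. unfold Cdiv. rewrite (Cmult_comm z (/ _)). ring. }
    split.
    + intros j Hj. destruct (Heuler j Hj) as [g [H0 [H1 H2]]].
      exists (fun z => INR N ^ N * g N (phi z)). split.
      (* Each factor z d/dz - lam_j equals N times the factor with parameter lam_j / N in the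
         variable phi(z), hence the weight N^i after i factors. *)
      * exists (fun i z => INR N ^ i * g i (phi z)). split; [|split].
        -- apply functional_extensionality. intros z. rewrite H0. simpl. unfold phi. ring.
        -- intros i _ z HzE. destruct (H1 i (phi z) (HED z HzE)) as [d [Hd Ed]].
           destruct (Hphi z) as [dp [Hdp Edp]]. exists (INR N ^ i * (d * dp)). split.
           ++ apply cder_is_derive, cder_scal, (cder_comp (g i) phi); assumption.
           ++ rewrite Ed, Cpow_S.
              transitivity (INR N ^ i * (d * (z * dp)) - lam (S i) * (INR N ^ i * g i (phi z))); [|ring].
              rewrite Edp. unfold c. field. exact HNC.
        -- reflexivity.
      * intros z HzE. rewrite (H2 (phi z) (HED z HzE)), H0. unfold phi.
        assert (Hz0' := Hz z HzE). unfold Cdiv at 2. rewrite Cpow_mult_l, Cpow_inv by exact HNC.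
        field. split; apply Cpow_nz; assumption.
    + intros cf Hcf j Hj. destruct (open_mul_exp E z0 HE Hz0) as [d [Hd Hv]].
      apply (Hindep (phi z0) cf d (HED z0 Hz0) Hd); [|exact Hj].
      intros v Hvd.
      (* Multiplying z0 by e^(v/N) multiplies phi(z0) by e^v, so the relation on E reaches all
         points required by the independence statement. *)
      assert (Hsc : phi (z0 * Cexp (v / INR N)) = phi z0 * Cexp v).
      { unfold phi. replace (z0 * Cexp (v / INR N) / INR N) with (z0 / INR N * Cexp (v / INR N)) by (field; exact HNC).
        rewrite Cpow_mult_l, Cexp_pow. replace (INR N * (v / INR N)) with v by (field; exact HNC). ring. }
      rewrite <- Hsc. apply (Hcf (z0 * Cexp (v / INR N))). apply Hv.
      rewrite Cmod_div, Cmod_INR by exact HNC. eapply Rle_lt_trans. 2: exact Hvd.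
      apply Rmult_le_reg_r with (INR N). exact HNR. unfold Rdiv. rewrite Rmult_assoc, Rinv_l, Rmult_1_r by lra.
      rewrite <- (Rmult_1_r (Cmod v)) at 1. apply Rmult_le_compat_l. apply Cmod_ge_0.
      apply (le_INR 1). exact HN1.
Qed.
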